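(* Let $n\ge 2$. For every $\alpha>-1$, the algebra $\mathrm{End}_{A_n\rtimes\mathbb{T}^n}(\mathcal{H}^2_\alpha(\mathbb{B}^n))$ is commutative. More precisely, consider the unitary map $$R:\mathcal{H}^2_\alpha(\mathbb{B}^n)\to \ell^2(\mathbb{Z}_+^n),\qquad R(f)=(\langle f,e_m\rangle)_{m\in\mathbb{Z}_+^n}.$$ Then for every $T\in \mathrm{End}_{A_n\rtimes\mathbb{T}^n}(\mathcal{H}^2_\alpha(\mathbb{B}^n))$, the operator $T$ is unitarily equivalent to $RTR^*$, and $RTR^*$ is the multiplication operator on $\ell^2(\mathbb{Z}_+^n)$ by the function $\gamma_T:\mathbb{Z}_+^n\to\mathbb{C}$, $\gamma_T(m)=\langle Te_m,e_m\rangle$. Furthermore, fix an odd permutation $\sigma\in S_n$ and choose the unit vectors $u_\iota=e_\iota\in\mathcal{P}_\iota(\mathbb{C}^n)$ for $\iota\in\mathcal{I}^0$, and $u_\iota^+=e_\iota\in\mathcal{P}_\iota^+(\mathbb{C}^n)$, $u_\iota^-=e_{\sigma(\iota)}\in\mathcal{P}_\iota^-(\mathbb{C}^n)$ for $\iota\in\mathcal{I}^c$. Let $\mathcal{I}^c_+$ and $\mathcal{I}^c_-$ be two copies of $\mathcal{I}^c$, and write $\iota_+\in\mathcal{I}^c_+$, $\iota_-\in\mathcal{I}^c_-$ for the copies of $\iota\in\mathcal{I}^c$. Define $\hat\gamma_T:\mathcal{I}^0\sqcup\mathcal{I}^c_+\sqcup\mathcal{I}^c_-\to\mathbb{C}$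 by $\hat\gamma_T(\iota)=\langle Tu_\iota,u_\iota\rangle$ for $\iota\in\mathcal{I}^0$, and $\hat\gamma_T(\iota_+)=\langle Tu_\iota^+,u_\iota^+\rangle$, $\hat\gamma_T(\iota_-)=\langle Tu_\iota^-,u_\iota^-\rangle$ for $\iota\in\mathcal{I}^c$. Then: 1. For $\iota\in\mathcal{I}^0$, $\hat\gamma_T(\iota)=\gamma_T(m)$ for every $m\in\mathcal{I}_\iota$; i.e. $\gamma_T(m)=\gamma_T(m')$ whenever $m,m'\in\mathcal{I}_\iota$. 2. For $\iota\in\mathcal{I}^c$, $\hat\gamma_T(\iota_+)=\gamma_T(m)$ for every $m\in\mathcal{I}_\iota^+$; i.e. $\gamma_T(m)=\gamma_T(m')$ whenever $m,m'\in\mathcal{I}^+_\iota$. 3. For $\iota\in\mathcal{I}^c$, $\hat\gamma_T(\iota_-)=\gamma_T(m)$ for every $m\in\mathcal{I}_\iota^-$; i.e. $\gamma_T(m)=\gamma_T(m')$ whenever $m,m'\in\mathcal{I}^-_\iota$.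
   Context: $\mathbb{Z}_+=\{0,1,2,\dots\}$; for $m\in\mathbb{Z}_+^n$, $|m|=m_1+\cdots+m_n$, $m!=m_1!\cdots m_n!$, $z^m=z_1^{m_1}\cdots z_n^{m_n}$. $\mathbb{B}^n=\{z\in\mathbb{C}^n:|z|<1\}$ is the open unit ball. For $\alpha>-1$, $dv_\alpha(z)=c_\alpha(1-|z|^2)^\alpha\,dv(z)$ with $c_\alpha=\frac{\Gamma(n+\alpha+1)}{n!\,\Gamma(\alpha+1)}$ and $dv$ Lebesgue measure normalized by $v(\mathbb{B}^n)=1$ (so $v_\alpha$ is a probability measure). $\mathcal{H}^2_\alpha(\mathbb{B}^n)$ is the weighted Bergman space of holomorphic functions in $L^2(\mathbb{B}^n,v_\alpha)$, with the $L^2$ inner product $\langle\cdot,\cdot\rangle$. It has the orthonormal basis $(e_m)_{m\in\mathbb{Z}_+^n}$, $e_m(z)=\sqrt{\frac{\Gamma(n+|m|+\alpha+1)}{m!\,\Gamma(n+\alpha+1)}}\,z^m$. $\mathbb{T}$ is the group of complex numbers of modulus one, $S_n$ the symmetric group of $\{1,\dots,n\}$, $A_n$ its subgroup of even permutations. The group $A_n\rtimes\mathbb{T}^n$ is identified with the group of unitary maps of $\mathbb{C}^n$ of the form $g_{\sigma,t}(z)=(t_1z_{\sigma(1)},\dots,t_nz_{\sigma(n)})$, $\sigma\in A_n$, $t\in\mathbb{T}^n$. It acts unitarily on $\mathcal{H}^2_\alpha(\mathbb{B}^n)$ by $\pi_\alpha(g)f=f\circ g^{-1}$. $\mathrm{End}_{A_n\rtimes\mathbb{T}^n}(\mathcal{H}^2_\alpha(\mathbb{B}^n))$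 is the algebra of bounded operators $T$ on $\mathcal{H}^2_\alpha(\mathbb{B}^n)$ with $T\pi_\alpha(g)=\pi_\alpha(g)T$ for all $g\in A_n\rtimes\mathbb{T}^n$. $\mathcal{I}=\{\iota\in\mathbb{Z}_+^n:\iota_1\ge\cdots\ge\iota_n\ge 0\}$; $\mathcal{I}^0=\{\iota\in\mathcal{I}:\iota_{l_1}=\iota_{l_2}\text{ for some }l_1\ne l_2\}$; $\mathcal{I}^c=\{\iota\in\mathcal{I}:\iota_1>\cdots>\iota_n\}$. For $\sigma\in S_n$, $\sigma(\iota)=(\iota_{\sigma(1)},\dots,\iota_{\sigma(n)})$. For $\iota\in\mathcal{I}$: $\mathcal{I}_\iota=\{\sigma(\iota):\sigma\in S_n\}$, $\mathcal{I}^+_\iota=\{\sigma(\iota):\sigma\in A_n\}$, $\mathcal{I}^-_\iota=\{\sigma(\iota):\sigma\in S_n\setminus A_n\}$; and $\mathcal{P}_\iota(\mathbb{C}^n)$, $\mathcal{P}^+_\iota(\mathbb{C}^n)$, $\mathcal{P}^-_\iota(\mathbb{C}^n)$ are the linear spans of the monomials $z^m$ with $m\in\mathcal{I}_\iota$, $m\in\mathcal{I}_\iota^+$, $m\in\mathcal{I}_\iota^-$ respectively (restricted to $\mathbb{B}^n$). *)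

(* Defs.v *)
From HB Require Import structures.
From mathcomp Require Import all_boot all_order all_algebra all_fingroup all_solvable.
From mathcomp Require Import all_classical all_reals all_analysis.
From mathcomp Require Import complex.
From mathcomp Require summability.

Set Implicit Arguments.
Unset Strict Implicit.
Unset Printing Implicit Defensive.

Import Order.TTheory GRing.Theory Num.Theory.
Import numFieldNormedType.Exports.
Import ComplexField.Normc.

Local Open Scope classical_set_scope.
Local Open Scope ring_scope.

(* A linear space of functions X -> C together with its inner product (linear
   in the first argument).  [ip] is only meaningful on [carrier]; likewise an
   operator between two such spaces is a map between the ambient function
   types of which only the restriction to [carrier] matters. *)
Record fun_space (R : realType) (X : Type) := FunSpace {
  carrier : set (X -> R[i]);
  ip : (X -> R[i]) -> (X -> R[i]) -> R[i] }.

Section Operators.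
Variables (R : realType) (X Y : Type).
Variables (H : fun_space R X) (K : fun_space R Y).

Definition fnorm (f : X -> R[i]) : R := Num.sqrt (complex.Re (ip H f f)).

Definition linear_map (U : (X -> R[i]) -> (Y -> R[i])) : Prop :=
  (forall f, carrier H f -> carrier K (U f)) /\
  (forall (a : R[i]) f g, carrier H f -> carrier H g ->
     U (fun x => a * f x + g x) = (fun y => a * U f y + U g y)).

Definition unitary_map (U : (X -> R[i]) -> (Y -> R[i])) : Prop :=
  [/\ linear_map U,
      forall f g, carrier H f -> carrier H g -> ip K (U f) (U g) = ip H f g
    & forall a, carrier K a -> exists2 f, carrier H f & U f = a].

(* Hilbert-space adjoint: the vector representing h |-> <U h, a>, and 0 if
   there is none (which does not occur for a unitary U). *)
Definition adjoint (U : (X -> R[i]) -> (Y -> R[i])) (a : Y -> R[i]) :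
    X -> R[i] :=
  xget (fun=> 0) [set f | carrier H f /\
    forall h, carrier H h -> ip H h f = ip K (U h) a].

Definition unitarily_equivalent (T : (X -> R[i]) -> (X -> R[i]))
    (S : (Y -> R[i]) -> (Y -> R[i])) : Prop :=
  exists2 U, unitary_map U & forall f, carrier H f -> U (T f) = S (U f).

End Operators.

Definition bounded_operator (R : realType) (X : Type) (H : fun_space R X)
    (T : (X -> R[i]) -> (X -> R[i])) : Prop :=
  linear_map H H T /\
  exists M : R, forall f, carrier H f -> fnorm H (T f) <= M * fnorm H f.

Section ProdSigmaFinite.
Context d1 d2 (T1 : measurableType d1) (T2 : measurableType d2) (R : realType).
Variables (m1 : {sigma_finite_measure set T1 -> \bar R}).
Variables (m2 : {sigma_finite_measure set T2 -> \bar R}).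

(* [m1 \x m2] under a name carrying the sigma-finite structure, so that the
   product can be iterated. *)
Definition prod_measure : set (T1 * T2)%type -> \bar R := (m1 \x m2)%E.

HB.instance Definition _ := Measure.on prod_measure.

Let prod_measure_sigma_finite : sigma_finite setT prod_measure.
Proof.
have /sigma_finiteP[F [TF ndF Foo]] := sigma_finiteT m1.
have /sigma_finiteP[G [TG ndG Goo]] := sigma_finiteT m2.
exists (fun n => F n `*` G n).
  rewrite -setXTT TF TG predeqE => -[x y]; split.
    move=> [/= [n _ Fnx] [k _ Gky]]; exists (maxn n k) => //; split.
    - by move: x Fnx; exact/subsetPset/ndF/leq_maxl.
    - by move: y Gky; exact/subsetPset/ndG/leq_maxr.
  by move=> [n _ []/= ? ?]; split; exists n.
move=> k; have [? ?] := Foo k; have [? ?] := Goo k.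
split; first exact: measurableX.
rewrite /prod_measure product_measure1E// lte_mul_pinfty//.
by rewrite ge0_fin_numE.
Qed.

HB.instance Definition _ := Measure_isSigmaFinite.Build _ _ _
  prod_measure prod_measure_sigma_finite.

End ProdSigmaFinite.

Section TupleMeasure.
Context d (T : measurableType d) (R : realType).
Variable mu : {sigma_finite_measure set T -> \bar R}.

Section Step.
Variables (n : nat) (nu : {sigma_finite_measure set (n.-tuple T) -> \bar R}).

Let cons_pair (p : T * n.-tuple T) : n.+1.-tuple T := [tuple of p.1 :: p.2].

Let uncons (t : n.+1.-tuple T) : T * n.-tuple T :=
  (thead t, [tuple of behead t]).

Let cons_pairK : cancel cons_pair uncons.
Proof. by case=> p t; congr pair; apply/val_inj. Qed.

Let measurable_cons_pair : measurable_fun setT cons_pair.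
Proof. exact: measurable_cons. Qed.

Let measurable_uncons : measurable_fun setT uncons.
Proof.
by apply/measurable_fun_pair; [exact: measurable_tnth|exact: measurable_behead].
Qed.

Definition tuple_measure_step : set (n.+1.-tuple T) -> \bar R :=
  pushforward (prod_measure mu nu) cons_pair.

Let step0 : tuple_measure_step set0 = 0%E.
Proof. by rewrite /tuple_measure_step /pushforward preimage_set0 measure0. Qed.

Let step_ge0 A : (0 <= tuple_measure_step A)%E.
Proof. exact: measure_ge0. Qed.

Let step_sigma_additive : semi_sigma_additive tuple_measure_step.
Proof.
move=> F mF tF mUF; rewrite /tuple_measure_step /pushforward preimage_bigcup.
apply: measure_semi_sigma_additive.
- by move=> k; rewrite -[X in measurable X]setTI; exact: measurable_cons_pair.
- apply/trivIsetP => /= i j _ _ ij; rewrite -preimage_setI.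
  by move/trivIsetP : tF => /(_ _ _ _ _ ij) ->//; rewrite preimage_set0.
- rewrite -preimage_bigcup -[X in measurable X]setTI.
  exact: measurable_cons_pair.
Qed.

HB.instance Definition _ := isMeasure.Build _ _ _
  tuple_measure_step step0 step_ge0 step_sigma_additive.

Let step_sigma_finite : sigma_finite setT tuple_measure_step.
Proof.
have [F TF Foo] := sigma_finiteT (prod_measure mu nu).
exists (fun k => uncons @^-1` F k).
  by rewrite -preimage_bigcup -TF preimage_setT.
move=> k; have [mF Fk] := Foo k; split.
  by rewrite -[X in measurable X]setTI; exact: measurable_uncons.
rewrite /tuple_measure_step /pushforward -comp_preimage.
rewrite (_ : uncons \o cons_pair = id)//.
by apply/funext => p /=; rewrite cons_pairK.
Qed.

HB.instance Definition _ := Measure_isSigmaFinite.Build _ _ _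
  tuple_measure_step step_sigma_finite.

End Step.

Fixpoint tuple_measure (n : nat) :
    {sigma_finite_measure set (n.-tuple T) -> \bar R} :=
  if n is n'.+1 then tuple_measure_step (tuple_measure n')
  else \d_([tuple] : 0.-tuple T).

End TupleMeasure.

(* C as R * R: real and imaginary part. *)
Notation plane R := (measurableTypeR R * measurableTypeR R)%type.

Definition lebesgueC (R : realType) (n : nat) :
    {sigma_finite_measure set (n.-tuple (plane R)) -> \bar R} :=
  tuple_measure (prod_measure (@lebesgue_measure R) (@lebesgue_measure R)) n.

Definition Gamma (R : realType) (x : R) : R :=
  \int[lebesgue_measure]_(t in `]0, +oo[) (t `^ (x - 1) * expR (- t)).

Notation mindex n := {ffun 'I_n -> nat}.

Section Bergman.
Variables (R : realType) (n : nat) (alpha : R).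

Definition normsq (z : 'rV[R[i]]_n) : R := \sum_(i < n) normc (z 0 i) ^+ 2.

Definition uball : set 'rV[R[i]]_n := [set z | normsq z < 1].

Definition vecC (w : n.-tuple (plane R)) : 'rV[R[i]]_n :=
  \row_i ((tnth w i).1 +i* (tnth w i).2)%C.

Definition uball_coords : set (n.-tuple (plane R)) := vecC @^-1` uball.

(* Density of v_alpha on the ball with respect to [lebesgueC R n]; the last
   factor normalizes Lebesgue measure so that the ball has measure 1. *)
Definition bergman_weight (z : 'rV[R[i]]_n) : R :=
  Gamma (n%:R + alpha + 1) / (n`!%:R * Gamma (alpha + 1))
  * (1 - normsq z) `^ alpha / fine (lebesgueC R n uball_coords).

Definition bergman_integral (F : 'rV[R[i]]_n -> R[i]) : R[i] :=
  ((\int[lebesgueC R n]_(w in uball_coords)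
      (complex.Re (F (vecC w)) * bergman_weight (vecC w)))
   +i* (\int[lebesgueC R n]_(w in uball_coords)
      (complex.Im (F (vecC w)) * bergman_weight (vecC w))))%C.

(* A function on the ball is represented by its extension by 0 to C^n, so that
   equality in the Bergman space is equality of functions.  Differentiability
   is over the field R[i], i.e. complex Frechet differentiability. *)
Definition bergman_set : set ('rV[R[i]]_n -> R[i]) :=
  [set f | [/\ forall z, ~ uball z -> f z = 0,
      forall z : 'rV[(R[i] : numFieldType)]_n, uball z ->
        differentiable (f : 'rV[(R[i] : numFieldType)]_n -> R[i]^o) z
    & (\int[lebesgueC R n]_(w in uball_coords)
         (normc (f (vecC w)) ^+ 2 * bergman_weight (vecC w))%:E < +oo)%E]].

Definition bergman : fun_space R 'rV[R[i]]_n :=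
  FunSpace bergman_set
    (fun f g => bergman_integral (fun z => f z * conjc (g z))).

Definition monomial (m : mindex n) (z : 'rV[R[i]]_n) : R[i] :=
  if normsq z < 1 then \prod_(i < n) z 0 i ^+ m i else 0.

Definition mdeg (m : mindex n) : nat := (\sum_(i < n) m i)%N.

Definition mfact (m : mindex n) : nat := (\prod_(i < n) (m i)`!)%N.

Definition e_ (m : mindex n) (z : 'rV[R[i]]_n) : R[i] :=
  (Num.sqrt (Gamma (n%:R + (mdeg m)%:R + alpha + 1)
             / ((mfact m)%:R * Gamma (n%:R + alpha + 1))))%:C%C
  * monomial m z.

Definition ell2 : fun_space R (mindex n) :=
  FunSpace [set a | (\esum_(m in setT) (normc (a m) ^+ 2)%:E < +oo)%E]
    (fun a b => summability.sum (fun m => a m * conjc (b m) : R[i]^o)).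

Definition coeff_map (f : 'rV[R[i]]_n -> R[i]) (m : mindex n) : R[i] :=
  ip bergman f (e_ m).

Definition mult_op (g : mindex n -> R[i]) (a : mindex n -> R[i]) :
    mindex n -> R[i] := fun m => g m * a m.

Definition torus : set ('I_n -> R[i]) := [set t | forall i, `|t i| = 1].

Definition gact (s : 'S_n) (t : 'I_n -> R[i]) (z : 'rV[R[i]]_n) :
    'rV[R[i]]_n := \row_i (t i * z 0 (s i)).

Definition gact_inv (s : 'S_n) (t : 'I_n -> R[i]) (z : 'rV[R[i]]_n) :
    'rV[R[i]]_n := \row_j ((t ((s^-1)%g j))^-1 * z 0 ((s^-1)%g j)).

Lemma gactK s t : torus t -> cancel (gact s t) (gact_inv s t).
Proof.
move=> t1 z; apply/rowP => j; rewrite !mxE permKV mulKf//.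
by rewrite -normr_eq0 t1 oner_eq0.
Qed.

Lemma gact_invK s t : torus t -> cancel (gact_inv s t) (gact s t).
Proof.
move=> t1 z; apply/rowP => j; rewrite !mxE permK mulVKf//.
by rewrite -normr_eq0 t1 oner_eq0.
Qed.

Definition pi_alpha (s : 'S_n) (t : 'I_n -> R[i])
    (f : 'rV[R[i]]_n -> R[i]) : 'rV[R[i]]_n -> R[i] := f \o gact_inv s t.

Definition End_AT : set (('rV[R[i]]_n -> R[i]) -> ('rV[R[i]]_n -> R[i])) :=
  [set T | bounded_operator bergman T /\
    forall s t f, s \in Alt 'I_n -> torus t -> carrier bergman f ->
      T (pi_alpha s t f) = pi_alpha s t (T f)].

Definition gamma (T : ('rV[R[i]]_n -> R[i]) -> ('rV[R[i]]_n -> R[i]))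
    (m : mindex n) : R[i] := ip bergman (T (e_ m)) (e_ m).

End Bergman.

Arguments e_ {R} {n} alpha m z.
Arguments coeff_map {R} n alpha f m.
Arguments End_AT {R} n alpha _.

Section Orbits.
Variable n : nat.

(* Indices run over 'I_n = {0, ..., n-1} instead of {1, ..., n}. *)
Definition I_dec : set (mindex n) :=
  [set m | forall i j : 'I_n, (i <= j)%N -> (m j <= m i)%N].

Definition I_zero : set (mindex n) :=
  [set m | I_dec m /\ exists i j : 'I_n, i != j /\ m i = m j].

Definition I_strict : set (mindex n) :=
  [set m | forall i j : 'I_n, (i < j)%N -> (m j < m i)%N].

Definition mperm (s : 'S_n) (m : mindex n) : mindex n := [ffun i => m (s i)].

Definition orbit_full (m : mindex n) : set (mindex n) :=
  [set mperm s m | s in [set: 'S_n]].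

Definition orbit_plus (m : mindex n) : set (mindex n) :=
  [set mperm s m | s in [set s | s \in Alt 'I_n]].

Definition orbit_minus (m : mindex n) : set (mindex n) :=
  [set mperm s m | s in [set s | s \notin Alt 'I_n]].

(* The disjoint union of I^0 and two copies of I^c. *)
Variant spectrum : Type :=
  | Zero of I_zero
  | Plus of I_strict
  | Minus of I_strict.

End Orbits.

Arguments I_zero n _ : clear implicits.
Arguments I_strict n _ : clear implicits.

Section GammaHat.
Variables (R : realType) (n : nat) (alpha : R).

(* Linear span, inside functions on the ball, of the monomials with exponent
   in A. *)
Definition monomial_span (A : set (mindex n)) : set ('rV[R[i]]_n -> R[i]) :=
  [set f | exists (r : seq (mindex n)) (c : mindex n -> R[i]),
    (forall m, m \in r -> A m) /\
    f = (fun z => \sum_(m <- r) c m * monomial m z)].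

Definition P_full (m : mindex n) := monomial_span (orbit_full m).
Definition P_plus (m : mindex n) := monomial_span (orbit_plus m).
Definition P_minus (m : mindex n) := monomial_span (orbit_minus m).

Definition u_vec (s : 'S_n) (x : spectrum n) : 'rV[R[i]]_n -> R[i] :=
  match x with
  | Zero i => e_ alpha (set_val i)
  | Plus i => e_ alpha (set_val i)
  | Minus i => e_ alpha (mperm s (set_val i))
  end.

Definition gamma_hat (s : 'S_n)
    (T : ('rV[R[i]]_n -> R[i]) -> ('rV[R[i]]_n -> R[i]))
    (x : spectrum n) : R[i] :=
  ip (bergman n alpha) (T (u_vec s x)) (u_vec s x).

End GammaHat.

Arguments P_full R {n} m _.
Arguments P_plus R {n} m _.
Arguments P_minus R {n} m _.

(* Main.v *)
(* The monomial basis diagonalizes the torus action, with pairwise distinct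
   characters; hence an operator commuting with the torus maps each e_m to
   gamma(m) e_m, and all such operators are simultaneously diagonal. Since
   f |-> f o g^-1 maps e_m to e_(sigma m) for a permutation g of the coordinates,
   commuting with even permutations makes gamma constant on A_n-orbits. On I^0 an
   odd permutation can be corrected by a transposition that fixes the index.

   What takes work is that (e_m) is an orthonormal basis.
   - Norms: integrate prod |w_i|^(2 m_i) u^a e^(-|w|^2 - u) in two ways.
   - Orthogonality: rotate one coordinate by an angle that changes the sign.
   - Completeness: the homogeneous part f_k of f is a polynomial, by Cauchy
     estimates on complex lines and Euler's identity for partial derivatives. If
     f is orthogonal to all monomials then so are its averages over roots of
     unity; these converge pointwise to f_k with bounded norms, and by Fatou's
     lemma |s av_N + f_k|^2 = s^2 |av_N|^2 + |f_k|^2 gives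
     (s + 1)^2 |f_k|^2 <= s^2 |f|^2 + |f_k|^2 for all s > 0, so f_k = 0.
   - Surjectivity on l^2: sum_m |e_m(z)|^2 is locally bounded, so the series
     sum_m a_m e_m converges locally uniformly, to a holomorphic function. *)

Require Import Defs.
From HB Require Import structures.
From mathcomp Require Import all_boot all_order all_algebra all_fingroup.
From mathcomp Require Import all_solvable.
From mathcomp Require Import all_classical all_reals all_analysis.
From mathcomp Require Import complex.
From mathcomp Require Import measurable_realfun.
From mathcomp Require Import ring lra.

Import Order.TTheory GRing.Theory Num.Theory.
Import numFieldNormedType.Exports.
Import ComplexField.Normc.

Local Open Scope classical_set_scope.
Local Open Scope ring_scope.

Set Implicit Arguments.
Unset Strict Implicit.
Unset Printing Implicit Defensive.

(** * Cauchy theory in one variable *)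

(** A member of the space is only known to be complex differentiable at each point, with no
    continuity of the derivative. Cauchy's theorem is therefore proved by Goursat's bisection, in
    the coordinate log z, where circles about 0 become vertical segments and annuli become
    rectangles. Iterating Euler's identity requires the partial derivatives to be holomorphic again;
    this and the holomorphy of the sum of a series both come from one lemma on locally uniform
    limits, [weierstrass], whose differential is read off one-variable Cauchy coefficients on
    complex lines. Limits inside the Bergman space are handled by Fatou's lemma, hence through norm
    inequalities; in the completeness argument the final inequality is divided by s before s tends
    to 0. The Gaussian moments behind the norms come from the case n = 1 of the double integral,
    used with two exponents of 1 - |w|^2, in place of polar coordinates. Boundedness of an operator
    enters when the diagonal formula passes from finite sums of basis vectors to a general f. *)

Section RealIntegral.
Context {R : realType}.
Implicit Types (u v : R -> R) (a b : R).

Definition eint a b u : R := \int[lebesgue_measure]_(x in `[a, b]) u x.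

Lemma within_continuous_epsP a b u :
  (forall x, a <= x <= b -> forall e, 0 < e -> exists2 d, 0 < d &
     forall y, a <= y <= b -> `|y - x| < d -> `|u y - u x| <= e) ->
  {within `[a, b], continuous u}.
Proof.
move=> cu; apply/subspace_continuousP => x /=.
rewrite in_itv /= => xab; apply/cvgrPdist_le => /= e e0.
have [d d0 H] := cu _ xab _ e0.
rewrite near_withinE; apply/nbhs_ballP; exists d => //= y xy yab.
rewrite distrC; apply: H; first by move: yab; rewrite /= in_itv.
by rewrite distrC.
Qed.

Lemma eint_integrable a b u : {within `[a, b], continuous u} ->
  lebesgue_measure.-integrable `[a, b] (EFin \o u).
Proof.
move=> cu; apply: continuous_compact_integrable => //; exact: segment_compact.
Qed.

Lemma eint_split a b c u : a <= c <= b -> {within `[a, b], continuous u} ->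
  eint a b u = eint a c u + eint c b u.
Proof.
move=> /andP[ac cb] cu; rewrite /eint.
have := @Rintegral_itvB R u (BLeft a) (BRight b) c (eint_integrable cu).
rewrite !bnd_simp => /(_ ac cb) H.
rewrite -(@Rintegral_itv_obnd_cbnd R c (BRight b) u).
  by rewrite -H addrC subrK.
apply: integrableS (eint_integrable cu) => //.
by apply: subset_itvr; rewrite bnd_simp.
Qed.

Lemma eint_cst a b k : a <= b -> eint a b (fun=> k) = k * (b - a).
Proof.
move=> ab; rewrite /eint Rintegral_cst //=.
rewrite lebesgue_measure_itv /= lte_fin.
by case: ltP => //= ba; rewrite (@le_anti _ _ a b) ?ab ?ba // subrr.
Qed.

Lemma eintD a b u v : {within `[a, b], continuous u} ->
  {within `[a, b], continuous v} ->
  eint a b (fun x => u x + v x) = eint a b u + eint a b v.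
Proof. by move=> cu cv; apply: RintegralD => //; exact: eint_integrable. Qed.

Lemma eintB a b u v : {within `[a, b], continuous u} ->
  {within `[a, b], continuous v} ->
  eint a b (fun x => u x - v x) = eint a b u - eint a b v.
Proof. by move=> cu cv; apply: RintegralB => //; exact: eint_integrable. Qed.

Lemma eintZ a b k u : {within `[a, b], continuous u} ->
  eint a b (fun x => k * u x) = k * eint a b u.
Proof. by move=> cu; apply: RintegralZl => //; exact: eint_integrable. Qed.

Lemma eq_eint a b u v : (forall x, a <= x <= b -> u x = v x) ->
  eint a b u = eint a b v.
Proof.
by move=> uv; apply: eq_Rintegral => x; rewrite inE /= in_itv /= => /uv.
Qed.

Lemma le_abs_eint a b u M : a <= b -> {within `[a, b], continuous u} ->
  (forall x, a <= x <= b -> `|u x| <= M) -> `|eint a b u| <= M * (b - a).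
Proof.
move=> ab cu uM; rewrite -eint_cst //.
apply: le_trans (le_normr_Rintegral _ (eint_integrable cu)) _ => //.
apply: le_Rintegral => //.
- exact: (integrable_norm (eint_integrable cu)).
- have := @eint_integrable a b (fun=> M); apply.
  by apply: continuous_subspaceT => x; exact: cst_continuous.
Qed.

End RealIntegral.

(** * Goursat's theorem on rectangles *)

Section Goursat.
Context {R : realType}.
Variables P Q : R -> R -> R.

(* Pointwise differentiability of P dx + Q dy at (x0, y0), relative to the
   rectangle, with dP/dy = dQ/dx = p2; no continuity of p2 is assumed. *)
Definition closed_at (a b c d x0 y0 : R) := exists p1 p2 q2 : R,
  forall e, 0 < e -> exists2 r, 0 < r & forall x y, a <= x <= b -> c <= y <= d ->
    `|x - x0| < r -> `|y - y0| < r ->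
    `|P x y - P x0 y0 - p1 * (x - x0) - p2 * (y - y0)|
       <= e * (`|x - x0| + `|y - y0|) /\
    `|Q x y - Q x0 y0 - p2 * (x - x0) - q2 * (y - y0)|
       <= e * (`|x - x0| + `|y - y0|).

Definition closed_on (a b c d : R) :=
  forall x y, a <= x <= b -> c <= y <= d -> closed_at a b c d x y.

(** The counterclockwise boundary integral of P dx + Q dy, with opposite sides paired under one
    integral sign. *)
Definition circulation (a b c d : R) : R :=
  eint a b (fun x => P x c - P x d) + eint c d (fun y => Q b y - Q a y).

Lemma closed_onS a b c d a' b' c' d' : a <= a' -> b' <= b -> c <= c' -> d' <= d ->
  closed_on a b c d -> closed_on a' b' c' d'.
Proof.
move=> aa bb cc dd H x y /andP[x1 x2] /andP[y1 y2].
have [||p1 [p2 [q2 K]]] := H x y; [by apply/andP; split; lra..|].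
exists p1, p2, q2 => e /K[r r0 L]; exists r => // x' y' /andP[? ?] /andP[? ?].
by apply: L; apply/andP; split; lra.
Qed.

Lemma closed_on_contP a b c d y : closed_on a b c d -> c <= y <= d ->
  {within `[a, b], continuous (P ^~ y)} .
Proof.
move=> H yI; apply: within_continuous_epsP => x xI e e0.
have [p1 [p2 [q2 /(_ 1 ltr01)[r r0 K]]]] := H _ _ xI yI.
exists (Num.min r (e / (1 + `|p1|))) => [|x' x'I].
  by rewrite lt_min r0 divr_gt0 // ltr_pwDl.
rewrite lt_min => /andP[xr xe].
have [] := K _ _ x'I yI xr; first by rewrite subrr normr0.
rewrite subrr !mulr0 !subr0 normr0 addr0 mul1r => L _.
have q0 : 0 < 1 + `|p1| by rewrite ltr_pwDl.
move: xe; rewrite ltr_pdivlMr // => xe.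
rewrite (_ : P x' y - P x y = (P x' y - P x y - p1 * (x' - x)) + p1 * (x' - x)); last by ring.
apply: le_trans (ler_normD _ _) _; rewrite normrM.
apply/ltW/(le_lt_trans _ xe); lra.
Qed.

Lemma closed_on_contQ a b c d x : closed_on a b c d -> a <= x <= b ->
  {within `[c, d], continuous (Q x)} .
Proof.
move=> H xI; apply: within_continuous_epsP => y yI e e0.
have [p1 [p2 [q2 /(_ 1 ltr01)[r r0 K]]]] := H _ _ xI yI.
exists (Num.min r (e / (1 + `|q2|))) => [|x' x'I].
  by rewrite lt_min r0 divr_gt0 // ltr_pwDl.
rewrite lt_min => /andP[xr xe].
have [] := K _ _ xI x'I _ xr; first by rewrite subrr normr0.
rewrite subrr !mulr0 !subr0 normr0 add0r mul1r => _ L.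
have q0 : 0 < 1 + `|q2| by rewrite ltr_pwDl.
move: xe; rewrite ltr_pdivlMr // => xe.
rewrite (_ : Q x x' - Q x y = (Q x x' - Q x y - q2 * (x' - y)) + q2 * (x' - y)); last by ring.
apply: le_trans (ler_normD _ _) _; rewrite normrM.
apply/ltW/(le_lt_trans _ xe); lra.
Qed.

Lemma within_contB (u v : R -> R) a b : {within `[a, b], continuous u} ->
  {within `[a, b], continuous v} -> {within `[a, b], continuous (fun x => u x - v x)}.
Proof. by move=> cu cv x; apply: cvgB; [exact: cu|exact: cv]. Qed.

(** The two integrals along the cut x = m cancel. *)
Lemma circulation_splitx a b c d m : a <= m <= b -> c <= d -> closed_on a b c d ->
  circulation a b c d = circulation a m c d + circulation m b c d.
Proof.
move=> /andP[am mb] cd H; rewrite /circulation.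
have ab : a <= b by lra.
have c1 : c <= c <= d by rewrite lexx.
have d1 : c <= d <= d by rewrite lexx cd.
have a1 : a <= a <= b by rewrite lexx.
have b1 : a <= b <= b by rewrite lexx ab.
have m1 : a <= m <= b by rewrite am.
rewrite (@eint_split _ a b m) ?am //; last first.
  by apply: within_contB; apply: closed_on_contP H _.
rewrite !(@eintB _ c d); do ?[exact: closed_on_contQ H _].
by ring.
Qed.

Lemma circulation_splity a b c d m : c <= m <= d -> a <= b -> closed_on a b c d ->
  circulation a b c d = circulation a b c m + circulation a b m d.
Proof.
move=> /andP[am mb] ab H; rewrite /circulation.
have cd : c <= d by lra.
have c1 : c <= c <= d by rewrite lexx.
have d1 : c <= d <= d by rewrite lexx cd.
have a1 : a <= a <= b by rewrite lexx.
have b1 : a <= b <= b by rewrite lexx ab.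
have m1 : c <= m <= d by rewrite am.
rewrite (@eint_split _ c d m) ?am //; last first.
  by apply: within_contB; apply: closed_on_contQ H _.
rewrite !(@eintB _ a b); do ?[exact: closed_on_contP H _].
by ring.
Qed.

(** The affine part of a closed form has circulation 0: the p1 and q2 terms agree on opposite sides,
    and the two contributions of p2 cancel each other. What survives is a difference of two errors
    on each pair of sides, hence 2 * e per unit of length. *)
Lemma circulation_local a b c d x0 y0 p1 p2 q2 e : a <= b -> c <= d ->
  closed_on a b c d ->
  (forall x y, a <= x <= b -> c <= y <= d ->
    `|P x y - P x0 y0 - p1 * (x - x0) - p2 * (y - y0)| <= e /\
    `|Q x y - Q x0 y0 - p2 * (x - x0) - q2 * (y - y0)| <= e) ->
  `|circulation a b c d| <= 2 * e * ((b - a) + (d - c)).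
Proof.
move=> ab cd H K.
have c1 : c <= c <= d by rewrite lexx.
have d1 : c <= d <= d by rewrite lexx cd.
have a1 : a <= a <= b by rewrite lexx.
have b1 : a <= b <= b by rewrite lexx ab.
have cP y : c <= y <= d -> {within `[a, b], continuous (P ^~ y)}.
  by move=> ?; apply: closed_on_contP H _.
have cQ y : a <= y <= b -> {within `[c, d], continuous (Q y)}.
  by move=> ?; apply: closed_on_contQ H _.
have cc (k l m : R) : {within `[l, m], continuous (fun=> k)}.
  by apply: continuous_subspaceT => x; exact: cst_continuous.
have -> : circulation a b c d =
  eint a b (fun x => P x c - P x d - p2 * (c - d)) +
  eint c d (fun y => Q b y - Q a y - p2 * (b - a)).
  rewrite /circulation (eintB (within_contB (cP _ c1) (cP _ d1)) (cc _ _ _)).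
  rewrite (eintB (within_contB (cQ _ b1) (cQ _ a1)) (cc _ _ _)) !eint_cst //.
  by ring.
apply: le_trans (ler_normD _ _) _; rewrite [leRHS]mulrDr; apply: lerD.
  apply: le_abs_eint => // [|x xI].
    by apply: within_contB (within_contB (cP _ c1) (cP _ d1)) (cc _ _ _).
  have [K1 _] := K _ _ xI c1; have [K2 _] := K _ _ xI d1.
  move: K1 K2; rewrite !ler_norml => /andP[? ?] /andP[? ?]; apply/andP; split; lra.
apply: le_abs_eint => // [|x xI].
  by apply: within_contB (within_contB (cQ _ b1) (cQ _ a1)) (cc _ _ _).
have [_ K1] := K _ _ a1 xI; have [_ K2] := K _ _ b1 xI.
move: K1 K2; rewrite !ler_norml => /andP[? ?] /andP[? ?]; apply/andP; split; lra.
Qed.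

Lemma quarter w h a c : 0 <= w -> 0 <= h -> closed_on a (a + w) c (c + h) ->
  exists a' c', [/\ a <= a' <= a + w / 2, c <= c' <= c + h / 2 &
   `|circulation a (a + w) c (c + h)| <=
   4 * `|circulation a' (a' + w / 2) c' (c' + h / 2)|].
Proof.
move=> w0 h0 H.
have w2 : a + w = a + w / 2 + w / 2 by lra.
have h2 : c + h = c + h / 2 + h / 2 by lra.
have -> : circulation a (a + w) c (c + h) =
   circulation a (a + w / 2) c (c + h / 2) +
   circulation (a + w / 2) (a + w / 2 + w / 2) c (c + h / 2) +
   (circulation a (a + w / 2) (c + h / 2) (c + h / 2 + h / 2) +
    circulation (a + w / 2) (a + w / 2 + w / 2) (c + h / 2) (c + h / 2 + h / 2)).
  have xm : a <= a + w / 2 <= a + w by lra.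
  have ym : c <= c + h / 2 <= c + h by lra.
  have aw : a <= a + w by lra.
  have c1 : c <= c + h / 2 by lra.
  have c2 : c + h / 2 <= c + h by lra.
  have H1 : closed_on a (a + w) c (c + h / 2) by apply: closed_onS H.
  have H2 : closed_on a (a + w) (c + h / 2) (c + h) by apply: closed_onS H.
  rewrite -w2 -h2 (circulation_splity ym aw H).
  by rewrite (circulation_splitx xm c1 H1) (circulation_splitx xm c2 H2).
set A := circulation _ _ _ _; set B := circulation _ _ _ _.
set C := circulation _ _ _ _; set D := circulation _ _ _ _.
pose X := `|A + B + (C + D)|.
have : `|A + B + (C + D)| <= `|A| + `|B| + (`|C| + `|D|).
  apply: le_trans (ler_normD _ _) _.
  by apply: lerD; exact: ler_normD.
rewrite -/X => XX.
have [h1|h1] := leP X (4 * `|A|); first by exists a, c; split => //; lra.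
have [h3|h3] := leP X (4 * `|B|).
  by exists (a + w / 2), c; split => //; lra.
have [h4|h4] := leP X (4 * `|C|).
  by exists a, (c + h / 2); split => //; lra.
by exists (a + w / 2), (c + h / 2); split => //; lra.
Qed.

(** Nested quarters shrink to a point (x0, y0). Differentiability there bounds the circulation of
    the k-th quarter by a multiple of e * 4 ^- k, which exactly balances the factor 4 ^ k lost in k
    bisections. *)
Theorem goursat a b c d : a <= b -> c <= d -> closed_on a b c d ->
  circulation a b c d = 0.
Proof.
move=> ab cd H.
pose w (k : nat) := (b - a) / 2 ^+ k; pose h (k : nat) := (d - c) / 2 ^+ k.
have p2 k : 0 < (2 : R) ^+ k by rewrite exprn_gt0.
have w0 k : 0 <= w k by rewrite divr_ge0 ?subr_ge0 // ltW.
have h0 k : 0 <= h k by rewrite divr_ge0 ?subr_ge0 // ltW.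
have wS k : w k.+1 = w k / 2 by rewrite /w exprS; field; rewrite lt0r_neq0.
have hS k : h k.+1 = h k / 2 by rewrite /h exprS; field; rewrite lt0r_neq0.
pose inv k (z : R * R) := [/\ a <= z.1, z.1 + w k <= b, c <= z.2 & z.2 + h k <= d].
(* The invariant is a premise inside [nxt], so that a successor can be chosen for every pair (k, z),
   including corners that do not occur. *)
pose nxt k (z z' : R * R) := inv k z ->
  [/\ z.1 <= z'.1 <= z.1 + w k / 2, z.2 <= z'.2 <= z.2 + h k / 2 &
   `|circulation z.1 (z.1 + w k) z.2 (z.2 + h k)| <=
   4 * `|circulation z'.1 (z'.1 + w k / 2) z'.2 (z'.2 + h k / 2)|].
have /choice[f Hf] : forall kz : nat * (R * R), exists z', nxt kz.1 kz.2 z'.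
  case=> k z; have [I|I] := pselect (inv k z); last by exists z.
  have [i1 i2 i3 i4] := I.
  have K : closed_on z.1 (z.1 + w k) z.2 (z.2 + h k) by apply: closed_onS H.
  have [a' [c' [? ? ?]]] := quarter (w0 k) (h0 k) K.
  by exists (a', c').
pose fix s k : R * R := if k is k'.+1 then f (k', s k') else (a, c).
have sI k : inv k (s k).
  elim: k => [|k IH].
    by rewrite /inv /= /w /h expr0 !divr1; split; lra.
  have [/andP[? ?] /andP[? ?] _] := Hf (k, s k) IH.
  by move: IH => [? ? ? ?]; rewrite /inv /= wS hS; split; lra.
have sN k := Hf (k, s k) (sI k).
have sC k : `|circulation a b c d| <= 4 ^+ k *
   `|circulation (s k).1 ((s k).1 + w k) (s k).2 ((s k).2 + h k)|.
  elim: k => [|k IH].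
    rewrite /w /h !expr0 !divr1 mul1r /=.
    by rewrite !(addrC _ (_ - _)) !subrK.
  apply: le_trans IH _; rewrite exprSr -mulrA ler_wpM2l ?exprn_ge0 //.
  by have [_ _] := sN k; rewrite wS hS.
have mon1 : {homo (fun k => (s k).1) : i j / (i <= j)%N >-> i <= j}.
  apply: homo_leq => // [x y z|k]; first exact: le_trans.
  by have [/andP[]] := sN k.
have mon2 : {homo (fun k => (s k).2) : i j / (i <= j)%N >-> i <= j}.
  apply: homo_leq => // [x y z|k]; first exact: le_trans.
  by have [_ /andP[]] := sN k.
have mon3 : {homo (fun k => (s k).1 + w k) : i j / (i <= j)%N >-> j <= i}.
  apply: homo_leq => // [x y z h1 h2|k]; first exact: le_trans h2 h1.
  have [/andP[? ?] _ _] := sN k; rewrite wS /=; lra.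
have mon4 : {homo (fun k => (s k).2 + h k) : i j / (i <= j)%N >-> j <= i}.
  apply: homo_leq => // [x y z h1 h2|k]; first exact: le_trans h2 h1.
  have [_ /andP[? ?] _] := sN k; rewrite hS /=; lra.
have cross1 i j : (s i).1 <= (s j).1 + w j.
  apply: le_trans (mon1 _ _ (leq_maxl i j)) _.
  by apply: le_trans (mon3 _ _ (leq_maxr i j)); rewrite lerDl.
have cross2 i j : (s i).2 <= (s j).2 + h j.
  apply: le_trans (mon2 _ _ (leq_maxl i j)) _.
  by apply: le_trans (mon4 _ _ (leq_maxr i j)); rewrite lerDl.
pose x0 := sup (range (fun k => (s k).1)).
pose y0 := sup (range (fun k => (s k).2)).
have sup1 : has_sup (range (fun k => (s k).1)).
  split; first by exists (s 0).1, 0.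
  by exists ((s 0).1 + w 0) => _ [k _ <-]; exact: cross1.
have sup2 : has_sup (range (fun k => (s k).2)).
  split; first by exists (s 0).2, 0.
  by exists ((s 0).2 + h 0) => _ [k _ <-]; exact: cross2.
have x01 k : (s k).1 <= x0 by apply: ub_le_sup; [case: sup1|exists k].
have y01 k : (s k).2 <= y0 by apply: ub_le_sup; [case: sup2|exists k].
have x02 k : x0 <= (s k).1 + w k.
  by apply: ge_sup; [case: sup1|move=> _ [i _ <-]; exact: cross1].
have y02 k : y0 <= (s k).2 + h k.
  by apply: ge_sup; [case: sup2|move=> _ [i _ <-]; exact: cross2].
have xI : a <= x0 <= b.
  by have [? ? _ _] := sI 0; have := x01 0; have := x02 0; lra.
have yI : c <= y0 <= d.
  by have [_ _ ? ?] := sI 0; have := y01 0; have := y02 0; lra.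
have [p1 [p' [q2 K]]] := H _ _ xI yI.
pose L := (b - a) + (d - c).
suff main e : 0 < e -> `|circulation a b c d| <= 2 * e * L ^+ 2.
  apply/eqP; rewrite -normr_eq0; apply/eqP/le_anti; rewrite normr_ge0 andbT.
  apply/ler_addgt0Pr => e e0; rewrite add0r.
  have L1 : 0 < 1 + L ^+ 2 by rewrite ltr_pwDl // sqr_ge0.
  apply: le_trans (main (e / (2 * (1 + L ^+ 2))) _) _.
    by rewrite divr_gt0 // mulr_gt0.
  rewrite (_ : 2 * _ * _ = e * (L ^+ 2 / (1 + L ^+ 2))); last first.
    by field; rewrite lt0r_neq0.
  by rewrite ler_piMr ?(ltW e0) // ler_pdivrMr // mul1r lerDr.
move=> e0.
have [r r0 Kr] := K e e0.
have [k kr] : exists k, L / 2 ^+ k < r.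
  have := @cvg_geometric R L 2^-1.
  rewrite ger0_norm ?invr_ge0 // invf_lt1 // ltr1n => /(_ isT).
  move=> /cvgrPdist_lt /(_ r r0)[k _ /(_ k (leqnn k))] /=.
  rewrite sub0r normrN ger0_norm /geometric /=; first by exists k; rewrite -exprVn.
  by rewrite mulr_ge0 ?exprn_ge0 ?invr_ge0 // /L; lra.
have wh : w k + h k = L / 2 ^+ k by rewrite /w /h -mulrDl.
have [i1 i2 i3 i4] := sI k.
have loc : `|circulation (s k).1 ((s k).1 + w k) (s k).2 ((s k).2 + h k)| <=
   2 * (e * (w k + h k)) * (w k + h k).
  rewrite {2}(_ : w k + h k = ((s k).1 + w k - (s k).1) + ((s k).2 + h k - (s k).2)); last by ring.
  apply: (@circulation_local _ _ _ _ x0 y0 p1 p' q2); rewrite ?lerDl //.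
    by apply: closed_onS H.
  move=> x y xI' yI'.
  have dx : `|x - x0| <= w k.
    by rewrite ler_norml; move: xI' (x01 k) (x02 k); clear; lra.
  have dy : `|y - y0| <= h k.
    by rewrite ler_norml; move: yI' (y01 k) (y02 k); clear; lra.
  have xr : `|x - x0| < r by apply: le_lt_trans kr; rewrite -wh; move: dx (w0 k) (h0 k); clear; lra.
  have yr : `|y - y0| < r by apply: le_lt_trans kr; rewrite -wh; move: dy (w0 k) (h0 k); clear; lra.
  have xab : a <= x <= b by move: xI' i1 i2; clear; lra.
  have ycd : c <= y <= d by move: yI' i3 i4; clear; lra.
  have [A B] := Kr x y xab ycd xr yr.
  have es : e * (`|x - x0| + `|y - y0|) <= e * (w k + h k) by rewrite ler_pM2l // lerD.
  by split; [exact: le_trans A es|exact: le_trans B es].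
apply: le_trans (sC k) _.
apply: le_trans (ler_wpM2l _ loc) _; first by rewrite exprn_ge0.
rewrite wh (_ : 4 ^+ k = (2 ^+ k) ^+ 2 :> R); last first.
  by rewrite exprAC; congr (_ ^+ _); ring.
by rewrite le_eqVlt; apply/orP; left; apply/eqP; field; rewrite lt0r_neq0.
Qed.

End Goursat.

(** * The real-valued modulus on R[i] *)

Section ComplexModulus.
Context {R : realType}.
Implicit Types x y z : R[i].

Lemma normcT z : `|z| = (normc z)%:C%C.
Proof. by rewrite normc_def; case: z. Qed.

Lemma normc_ge0 z : 0 <= normc z.
Proof. by rewrite -lecR -normcT normr_ge0. Qed.

Lemma normc_eq0 z : (normc z == 0) = (z == 0).
Proof. by apply/eqP/eqP => [/eq0_normc|->]; rewrite ?normc0. Qed.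

Lemma normc_gt0 z : (0 < normc z) = (z != 0).
Proof. by rewrite lt_def normc_ge0 normc_eq0 andbT. Qed.

Lemma normcD z y : normc (z + y) <= normc z + normc y.
Proof. exact: le_normcD. Qed.

Lemma normcN z : normc (- z) = normc z.
Proof. by apply: complexI; rewrite -!normcT normrN. Qed.

Lemma normcB z y : normc (z - y) <= normc z + normc y.
Proof. by rewrite -(normcN y) normcD. Qed.

Lemma normc_distC z y : normc (z - y) = normc (y - z).
Proof. by rewrite -normcN opprB. Qed.

Lemma normcX z k : normc (z ^+ k) = normc z ^+ k.
Proof. by elim: k => [|k IH]; rewrite ?expr0 ?normc1 // !exprS normcM IH. Qed.

Lemma normcR (a : R) : normc a%:C%C = `|a|.
Proof. by rewrite /normc /= expr0n addr0 sqrtr_sqr. Qed.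

Lemma normc_conj z : normc (conjc z) = normc z.
Proof. by case: z => a b /=; rewrite sqrrN. Qed.

Lemma sqr_normc_def z : normc z ^+ 2 = complex.Re z ^+ 2 + complex.Im z ^+ 2.
Proof. by case: z => a b /=; rewrite sqr_sqrtr // addr_ge0 ?sqr_ge0. Qed.

Lemma mul_conjc z : z * conjc z = (normc z ^+ 2)%:C%C.
Proof. by rewrite -sqr_normc normcT -rmorphXn. Qed.

Lemma normc_Re z : `|complex.Re z| <= normc z.
Proof. by rewrite -lecR -normcT normc_ge_Re. Qed.

Lemma normc_Im z : `|complex.Im z| <= normc z.
Proof.
rewrite -(@ler_pXn2r _ 2) ?nnegrE ?normc_ge0 //.
by rewrite -normrX ger0_norm ?sqr_ge0 // sqr_normc_def lerDr sqr_ge0.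
Qed.

Lemma normc_le_ReIm z : normc z <= `|complex.Re z| + `|complex.Im z|.
Proof.
rewrite -(@ler_pXn2r _ 2) ?nnegrE ?normc_ge0 ?addr_ge0 //.
rewrite sqr_normc_def -[in leLHS]real_normK ?num_real //.
rewrite -[X in _ + X <= _]real_normK ?num_real // sqrrD.
by rewrite -addrA addrCA addrC lerDl mulrn_wge0 // mulr_ge0.
Qed.

Lemma ReD z y : complex.Re (z + y) = complex.Re z + complex.Re y.
Proof. by case: z y => ? ? []. Qed.
Lemma ImD z y : complex.Im (z + y) = complex.Im z + complex.Im y.
Proof. by case: z y => ? ? []. Qed.
Lemma ReN z : complex.Re (- z) = - complex.Re z. Proof. by case: z. Qed.
Lemma ImN z : complex.Im (- z) = - complex.Im z. Proof. by case: z. Qed.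
Lemma ReM z y : complex.Re (z * y) =
  complex.Re z * complex.Re y - complex.Im z * complex.Im y.
Proof. by case: z y => ? ? []. Qed.
Lemma ImM z y : complex.Im (z * y) =
  complex.Re z * complex.Im y + complex.Im z * complex.Re y.
Proof. by case: z y => ? ? []. Qed.

Lemma complexP z y : complex.Re z = complex.Re y -> complex.Im z = complex.Im y ->
  z = y.
Proof. by case: z y => ? ? [? ?] /= -> ->. Qed.

End ComplexModulus.

(** * The complex exponential and complex differentiability *)

Section Circle.
Context {R : realType}.
Local Notation C := R[i].

Definition cis (t : R) : C := (cos t +i* sin t)%C.

Lemma normc_cis t : normc (cis t) = 1.
Proof. by rewrite /normc /cis cos2Dsin2 sqrtr1. Qed.

Lemma cisD s t : cis (s + t) = cis s * cis t.
Proof. by rewrite /cis cosD sinD; simpc; congr Complex; ring. Qed.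

Lemma cis0 : cis 0 = 1. Proof. by rewrite /cis cos0 sin0. Qed.

Lemma cis2pi : cis (2 * pi) = 1.
Proof. by rewrite /cis mulr_natl cos2pi sin2pi. Qed.

Lemma is_derive_eps (f : R -> R) (x d : R) : is_derive x (1 : R) f d ->
  forall e, 0 < e -> exists2 r, 0 < r & forall h, `|h| < r ->
    `|f (x + h) - f x - d * h| <= e * `|h|.
Proof.
move=> [df fd] e e0.
have /cvgrPdist_le /(_ e e0) : h^-1 *: (f (h *: 1 + x) - f x) @[h --> 0^'] --> d.
  by rewrite -fd; exact: df.
rewrite near_withinE => /nbhs_ballP[r /= r0 H]; exists r => // h hr.
have [->|h0] := eqVneq h 0; first by rewrite addr0 subrr mulr0 subrr normr0 mulr0.
have := H h; rewrite /ball /= sub0r normrN => /(_ hr h0).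
rewrite /GRing.scale /= mulr1 (addrC h x) => L.
rewrite (_ : f (x + h) - f x - d * h = - (d - h^-1 * (f (x + h) - f x)) * h); last by field.
by rewrite normrM normrN ler_wpM2r.
Qed.

Definition cexp (x y : R) : C := (expR x)%:C%C * cis y.

Lemma cexp_small e : 0 < e -> exists2 r, 0 < r & forall x y, `|x| < r -> `|y| < r ->
  normc (cexp x y - 1 - (x +i* y)%C) <= e * (`|x| + `|y|).
Proof.
move=> e0.
(* Once |e^x| <= 2, the errors add up to at most e' * |x| + 5 * e' * |y|, so e / 8 leaves room. *)
pose e' := Num.min 1 (e / 8).
have e'0 : 0 < e' by rewrite lt_min ltr01 divr_gt0.
have e'1 : e' <= 1 by rewrite ge_min lexx.
have e'2 : e' <= e / 8 by rewrite ge_min lexx orbT.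
have [r1 r10 H1] := is_derive_eps (is_derive_expR (0 : R)) e'0.
have [r2 r20 H2] := is_derive_eps (is_derive_cos (0 : R)) e'0.
have [r3 r30 H3] := is_derive_eps (is_derive_sin (0 : R)) e'0.
exists (Num.min (e' / 2) (Num.min r1 (Num.min r2 r3))).
  by rewrite !lt_min r10 r20 r30 divr_gt0.
move=> x y; rewrite !lt_min => /and4P[x0 x1 _ _] /and4P[y0 _ y2 y3].
have := H1 _ x1; have := H2 _ y2; have := H3 _ y3.
rewrite !add0r expR0 cos0 sin0 !(oppr0, mul0r, subr0, mul1r, addr0) => S1 C1 X1.
have x_ge0 := normr_ge0 x; have y_ge0 := normr_ge0 y.
have X2 : `|expR x - 1| <= e'.
  rewrite (_ : expR x - 1 = (expR x - 1 - x) + x); last by ring.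
  apply: le_trans (ler_normD _ _) _.
  have := ler_wpM2r x_ge0 e'1; lra.
have X3 : `|expR x| <= 2.
  rewrite (_ : expR x = (expR x - 1) + 1); last by ring.
  apply: le_trans (ler_normD _ _) _; rewrite normr1; lra.
apply: le_trans (normc_le_ReIm _) _.
rewrite /cexp !(ReD, ImD, ReN, ImN, ReM, ImM) /= !mul0r !subr0 addr0.
have -> : expR x * cos y - 1 - x = (expR x - 1 - x) + expR x * (cos y - 1) by ring.
have -> : expR x * sin y - y = expR x * (sin y - y) + (expR x - 1) * y by ring.
have T1 : `|expR x - 1 - x + expR x * (cos y - 1)| <= e' * `|x| + 2 * (e' * `|y|).
  apply: le_trans (ler_normD _ _) _; apply: lerD => //.
  by rewrite normrM ler_pM.
have T2 : `|expR x * (sin y - y) + (expR x - 1) * y| <= 2 * (e' * `|y|) + e' * `|y|.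
  apply: le_trans (ler_normD _ _) _; rewrite !normrM; apply: lerD.
    by rewrite ler_pM.
  by rewrite ler_wpM2r.
have := ler_wpM2r x_ge0 e'2; have := ler_wpM2r y_ge0 e'2.
move: (`|_ + expR x * (cos y - 1)|) (`|_ + (expR x - 1) * y|) T1 T2 => A B T1 T2.
move: (e' * `|x|) (e' * `|y|) T1 T2 => X Y T1 T2.
have : 0 <= e * `|x| by rewrite mulr_ge0 // ltW.
have : 0 <= e * `|y| by rewrite mulr_ge0 // ltW.
rewrite mulrDr (mulrAC e _ `|x|) (mulrAC e _ `|y|).
by move: (e * `|x|) (e * `|y|) => *; lra.
Qed.

Lemma cexpD x y a b : cexp (x + a) (y + b) = cexp x y * cexp a b.
Proof. by rewrite /cexp expRD cisD rmorphM mulrACA. Qed.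

Lemma normc_cexp x y : normc (cexp x y) = expR x.
Proof. by rewrite /cexp normcM normc_cis mulr1 normcR ger0_norm // expR_ge0. Qed.

(** Complex differentiability with real tolerances and the real-valued modulus, the form in which
    the estimates consume it; [cdiffP] relates it to [derivable]. *)
Definition cdiff (g : C -> C) (z : C) := exists d, forall e, 0 < e ->
  exists2 r, 0 < r & forall h, normc h < r ->
    normc (g (z + h) - g z - d * h) <= e * normc h.

Definition ccont (g : C -> C) (z : C) := forall e, 0 < e ->
  exists2 r, 0 < r & forall h, normc h < r -> normc (g (z + h) - g z) <= e.

Lemma cdiff_cont g z : cdiff g z -> ccont g z.
Proof.
move=> [d D] e e0; have [r r0 H] := D 1 ltr01.
have q0 : 0 < 1 + normc d by rewrite ltr_pwDl // normc_ge0.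
exists (Num.min r (e / (1 + normc d))) => [|h].
  by rewrite lt_min r0 divr_gt0.
rewrite lt_min ltr_pdivlMr // => /andP[/H K1 K2].
rewrite (_ : g (z + h) - g z = (g (z + h) - g z - d * h) + d * h); last by ring.
apply: le_trans (normcD _ _) _; rewrite normcM.
by apply/ltW/(le_lt_trans _ K2); rewrite mulrDr mulr1 (mulrC (normc h)); lra.
Qed.

(** Chain rule for g composed with exp. That a single complex number D serves for both real
    directions is the Cauchy-Riemann equations, which make the two real forms in [cavg_radius]
    closed. *)
Lemma cdiff_polar (g : C -> C) x0 y0 : cdiff g (cexp x0 y0) ->
  exists D, forall e, 0 < e -> exists2 r, 0 < r & forall x y,
    `|x - x0| < r -> `|y - y0| < r ->
    normc (g (cexp x y) - g (cexp x0 y0) - D * ((x - x0) +i* (y - y0))%C) <=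
    e * (`|x - x0| + `|y - y0|).
Proof.
move=> [d Hd]; pose E0 := cexp x0 y0; exists (d * E0) => e e0.
have E00 : 0 < normc E0 by rewrite normc_cexp expR_gt0.
(* Half of e is spent on the error of g, through e1 and |h| <= 2 |E0| (|a| + |b|); the other half on
   the error of exp, through e2. *)
pose e1 := e / (4 * normc E0).
have e10 : 0 < e1 by rewrite divr_gt0 // mulr_gt0.
have [r1 r10 H1] := Hd _ e10.
pose e2 := Num.min 1 (e / (2 * (1 + normc (d * E0)))).
have q0 : 0 < 1 + normc (d * E0) by rewrite ltr_pwDl // normc_ge0.
have e20 : 0 < e2 by rewrite lt_min ltr01 divr_gt0 // mulr_gt0.
have [r2 r20 H2] := cexp_small e20.
exists (Num.min r2 (r1 / (4 * normc E0))).
  by rewrite lt_min r20 divr_gt0 // mulr_gt0.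
move=> x y; rewrite !lt_min => /andP[xr xs] /andP[yr ys].
set a := x - x0; set b := y - y0.
have -> : cexp x y = E0 * cexp a b by rewrite -cexpD; congr cexp; rewrite /a /b; ring.
have K := H2 _ _ xr yr; rewrite -/a -/b in K.
pose h := E0 * (cexp a b - 1).
have -> : E0 * cexp a b = E0 + h by rewrite /h; ring.
have n0 : 0 <= `|a| + `|b| by rewrite addr_ge0.
have nh : normc (cexp a b - 1) <= 2 * (`|a| + `|b|).
  rewrite (_ : cexp a b - 1 = (cexp a b - 1 - (a +i* b)%C) + (a +i* b)%C); last by ring.
  apply: le_trans (normcD _ _) _; rewrite mulrDl mul1r; apply: lerD.
    apply: le_trans K _; rewrite ler_piMl // ge_min lexx //.
  exact: normc_le_ReIm.
have nhh : normc h <= normc E0 * (2 * (`|a| + `|b|)) by rewrite normcM ler_pM2l.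
have hr : normc h < r1.
  apply: le_lt_trans nhh _.
  have := xs; have := ys; rewrite !ltr_pdivlMr ?mulr_gt0 //; rewrite -/a -/b.
  by move: (`|a|) (`|b|) (normc E0) => A B N; lra.
have K2 := H1 _ hr.
have -> : g (E0 + h) - g E0 - d * E0 * (a +i* b)%C =
  (g (E0 + h) - g E0 - d * h) + d * E0 * (cexp a b - 1 - (a +i* b)%C).
  by rewrite /h; ring.
apply: le_trans (normcD _ _) _.
have K3 : e1 * normc h <= e / 2 * (`|a| + `|b|).
  apply: le_trans (ler_wpM2l (ltW e10) nhh) _.
  rewrite le_eqVlt; apply/orP; left; apply/eqP; rewrite /e1; field.
  by rewrite lt0r_neq0.
have K4 : normc (d * E0) * e2 <= e / 2.
  apply: (@le_trans _ _ ((1 + normc (d * E0)) * (e / (2 * (1 + normc (d * E0)))))).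
    rewrite ler_pM ?normc_ge0 ?(ltW e20) //; first by rewrite lerDr.
    by rewrite ge_min lexx orbT.
  rewrite le_eqVlt; apply/orP; left; apply/eqP; field.
  by rewrite lt0r_neq0.
rewrite normcM (_ : e = e / 2 + e / 2); last by field.
rewrite mulrDl; apply: lerD; first exact: le_trans K2 K3.
apply: le_trans (ler_wpM2l (normc_ge0 _) K) _.
by rewrite mulrA ler_wpM2r.
Qed.

End Circle.

(** * Means over circles and Cauchy's theorem on annuli *)

Section CircleAverage.
Context {R : realType}.
Local Notation C := R[i].
Implicit Types (F G : C -> C) (g h : C -> C).

Definition tpi : R := 2 * pi.

Lemma tpi_gt0 : 0 < tpi. Proof. by rewrite mulr_gt0 // pi_gt0. Qed.

Definition circ_cont F :=
  {within `[0, tpi], continuous (fun t => complex.Re (F (cis t)))} /\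
  {within `[0, tpi], continuous (fun t => complex.Im (F (cis t)))}.

Definition cavg F : C := (tpi^-1)%:C%C *
  (eint 0 tpi (fun t => complex.Re (F (cis t))) +i*
   eint 0 tpi (fun t => complex.Im (F (cis t))))%C.

Lemma cis_cont (t e : R) : 0 < e -> exists2 r, 0 < r & forall s, `|s - t| < r ->
  normc (cis s - cis t) <= e.
Proof.
move=> e0; have [r1 r10 H1] := @cexp_small R 1 ltr01.
exists (Num.min r1 (e / 2)) => [|s]; first by rewrite lt_min r10 divr_gt0.
rewrite lt_min => /andP[s1 s2].
have -> : cis s = cis t * cis (s - t) by rewrite -cisD; congr cis; ring.
rewrite (_ : _ - _ = cis t * (cis (s - t) - 1)); last by ring.
rewrite normcM normc_cis mul1r.
have := H1 0 (s - t) _ s1; rewrite normr0 add0r mul1r => /(_ r10).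
rewrite {1}/cexp expR0 mul1r => K.
rewrite (_ : cis (s - t) - 1 = (cis (s - t) - 1 - (0 +i* (s - t))%C) + (0 +i* (s - t))%C); last by ring.
apply: le_trans (normcD _ _) _.
have : normc (0 +i* (s - t))%C <= `|s - t|.
  by apply: le_trans (normc_le_ReIm _) _; rewrite /= normr0 add0r.
by move: (normc _) (normc _) K => a b; lra.
Qed.

Lemma circ_cont_eps F :
  (forall t e, 0 < e -> exists2 r, 0 < r & forall s, `|s - t| < r ->
     normc (F (cis s) - F (cis t)) <= e) -> circ_cont F.
Proof.
move=> H; split; apply: within_continuous_epsP => t _ e e0.
  have [r r0 K] := H t e e0; exists r => // s _ /K; apply: le_trans.
  by rewrite -ReN -ReD; exact: normc_Re.
have [r r0 K] := H t e e0; exists r => // s _ /K; apply: le_trans.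
by rewrite -ImN -ImD; exact: normc_Im.
Qed.

Lemma circ_cont_ccont F : (forall w, normc w = 1 -> ccont F w) -> circ_cont F.
Proof.
move=> H; apply: circ_cont_eps => t e e0.
have [r r0 K] := H (cis t) (normc_cis t) e e0.
have [r' r'0 K'] := cis_cont t (divr_gt0 r0 (ltr0n R 2) : 0 < r / 2).
exists r' => // s /K' L.
rewrite (_ : cis s = cis t + (cis s - cis t)); last by ring.
by apply: K; apply: le_lt_trans L _; rewrite ltr_pdivrMr // ltr_pMr // ltr1n.
Qed.

Lemma eq_circ_cont F G : (forall w, normc w = 1 -> F w = G w) ->
  circ_cont F -> circ_cont G.
Proof.
move=> FG [c1 c2].
have e1 : (fun t => complex.Re (G (cis t))) = (fun t => complex.Re (F (cis t))).
  by apply/funext => t; rewrite FG // normc_cis.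
have e2 : (fun t => complex.Im (G (cis t))) = (fun t => complex.Im (F (cis t))).
  by apply/funext => t; rewrite FG // normc_cis.
by split; rewrite ?e1 ?e2.
Qed.

Lemma eq_cavg F G : (forall w, normc w = 1 -> F w = G w) -> cavg F = cavg G.
Proof.
by move=> FG; congr (_ * Complex _ _); apply: eq_eint => t _; rewrite FG // normc_cis.
Qed.

Lemma within_contD (u v : R -> R) a b : {within `[a, b], continuous u} ->
  {within `[a, b], continuous v} -> {within `[a, b], continuous (fun x => u x + v x)}.
Proof. by move=> cu cv x; apply: cvgD; [exact: cu|exact: cv]. Qed.

Lemma within_contZ (u : R -> R) (k : R) a b : {within `[a, b], continuous u} ->
  {within `[a, b], continuous (fun x => k * u x)}.
Proof. by move=> cu x; apply: cvgMr; exact: cu. Qed.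

Lemma eintN (u : R -> R) a b : {within `[a, b], continuous (fun x => - u x)} ->
  eint a b (fun x => - u x) = - eint a b u.
Proof.
move=> cu; apply/eqP; rewrite -eqr_oppLR; apply/eqP.
rewrite -mulN1r -eintZ //; apply: eq_eint => x _; by rewrite mulN1r opprK.
Qed.

Lemma circ_contD F G : circ_cont F -> circ_cont G -> circ_cont (fun w => F w + G w).
Proof.
move=> [f1 f2] [g1 g2]; split.
  rewrite (_ : (fun _ => _) = fun t => complex.Re (F (cis t)) + complex.Re (G (cis t))).
    exact: within_contD.
  by apply/funext => t; rewrite ReD.
rewrite (_ : (fun _ => _) = fun t => complex.Im (F (cis t)) + complex.Im (G (cis t))).
  exact: within_contD.
by apply/funext => t; rewrite ImD.
Qed.

Lemma circ_contZ k F : circ_cont F -> circ_cont (fun w => k * F w).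
Proof.
move=> [f1 f2]; split.
  rewrite (_ : (fun _ => _) = fun t => complex.Re k * complex.Re (F (cis t)) -
      complex.Im k * complex.Im (F (cis t))).
    by apply: within_contB; exact: within_contZ.
  by apply/funext => t; rewrite ReM.
rewrite (_ : (fun _ => _) = fun t => complex.Re k * complex.Im (F (cis t)) +
      complex.Im k * complex.Re (F (cis t))).
  by apply: within_contD; exact: within_contZ.
by apply/funext => t; rewrite ImM.
Qed.

Lemma circ_cont_cst k : circ_cont (fun=> k).
Proof. by split; apply: continuous_subspaceT => x; exact: cst_continuous. Qed.

Lemma circ_cont_sum (J : nat) (F : nat -> C -> C) :
  (forall j, circ_cont (F j)) -> circ_cont (fun w => \sum_(j < J) F j w).
Proof.
move=> H; elim: J => [|J IH].
  by apply: eq_circ_cont (circ_cont_cst 0) => w _; rewrite big_ord0.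
by apply: eq_circ_cont (circ_contD IH (H J)) => w _; rewrite big_ord_recr.
Qed.

Lemma cavgD F G : circ_cont F -> circ_cont G ->
  cavg (fun w => F w + G w) = cavg F + cavg G.
Proof.
move=> [f1 f2] [g1 g2]; rewrite /cavg -mulrDr; congr (_ * _).
have -> : (fun t => complex.Re (F (cis t) + G (cis t))) =
  (fun t => complex.Re (F (cis t)) + complex.Re (G (cis t))).
  by apply/funext => t; rewrite ReD.
have -> : (fun t => complex.Im (F (cis t) + G (cis t))) =
  (fun t => complex.Im (F (cis t)) + complex.Im (G (cis t))).
  by apply/funext => t; rewrite ImD.
by rewrite !eintD.
Qed.

Lemma cavgZ k F : circ_cont F -> cavg (fun w => k * F w) = k * cavg F.
Proof.
move=> [f1 f2]; rewrite /cavg mulrCA; congr (_ * _).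
have -> : (fun t => complex.Re (k * F (cis t))) =
  (fun t => complex.Re k * complex.Re (F (cis t)) - complex.Im k * complex.Im (F (cis t))).
  by apply/funext => t; rewrite ReM.
have -> : (fun t => complex.Im (k * F (cis t))) =
  (fun t => complex.Re k * complex.Im (F (cis t)) + complex.Im k * complex.Re (F (cis t))).
  by apply/funext => t; rewrite ImM.
rewrite eintB ?eintD ?eintZ //; do ?exact: within_contZ.
by case: k => a b.
Qed.

Lemma cavg_cst k : cavg (fun=> k) = k.
Proof.
rewrite /cavg !eint_cst ?(ltW tpi_gt0) // subr0.
rewrite (_ : Complex _ _ = k * tpi%:C%C); last first.
  by case: k => a b; simpc.
by rewrite mulrCA -rmorphM mulVf ?mulr1 // lt0r_neq0 // tpi_gt0.
Qed.

Lemma cavgB F G : circ_cont F -> circ_cont G ->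
  cavg (fun w => F w - G w) = cavg F - cavg G.
Proof.
move=> f g; rewrite -mulN1r -cavgZ // -cavgD //; last exact: circ_contZ.
by apply: eq_cavg => w _; rewrite mulN1r.
Qed.

Lemma cavg_sum (J : nat) (F : nat -> C -> C) : (forall j, circ_cont (F j)) ->
  cavg (fun w => \sum_(j < J) F j w) = \sum_(j < J) cavg (F j).
Proof.
move=> H; elim: J => [|J IH].
  rewrite big_ord0 -[RHS](cavg_cst 0).
  by apply: eq_cavg => w _; rewrite big_ord0.
rewrite big_ord_recr /= -IH -cavgD //; last exact: circ_cont_sum.
by apply: eq_cavg => w _; rewrite big_ord_recr.
Qed.

(** The factor 2 comes from bounding the real and imaginary parts separately; it only enlarges later
    constants. *)
Lemma normc_cavg_seg F M : circ_cont F ->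
  (forall t, 0 <= t <= tpi -> normc (F (cis t)) <= M) -> normc (cavg F) <= 2 * M.
Proof.
move=> [f1 f2] FM; rewrite /cavg normcM normcR.
have t0 := tpi_gt0.
rewrite gtr0_norm ?invr_gt0 // ler_pdivrMl //.
apply: le_trans (normc_le_ReIm _) _ => /=.
rewrite (_ : tpi * (2 * M) = M * (tpi - 0) + M * (tpi - 0)); last by ring.
apply: lerD; apply: le_abs_eint => //; try exact: ltW.
  by move=> t tI; apply: le_trans (normc_Re _) (FM _ tI).
by move=> t tI; apply: le_trans (normc_Im _) (FM _ tI).
Qed.

Lemma normc_cavg F M : circ_cont F -> (forall w, normc w = 1 -> normc (F w) <= M) ->
  normc (cavg F) <= 2 * M.
Proof.
by move=> cF FM; apply: normc_cavg_seg => // t _; apply: FM; exact: normc_cis.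
Qed.

Lemma normc_scale_cis (r t : R) : 0 <= r -> normc (r%:C%C * cis t) = r.
Proof. by move=> r0; rewrite normcM normc_cis mulr1 normcR ger0_norm. Qed.

(* Cauchy's theorem in the logarithmic coordinate: g(e^(x+iy)) d(x+iy) is a
   closed form and its circulation on [ln r1, ln r2] x [0, 2 pi] reduces, by
   periodicity, to the difference of the two circle integrals. *)
Lemma cavg_radius g r1 r2 : 0 < r1 -> r1 <= r2 ->
  (forall z, r1 <= normc z <= r2 -> cdiff g z) ->
  cavg (fun w => g (r1%:C%C * w)) = cavg (fun w => g (r2%:C%C * w)).
Proof.
move=> r10 r12 H.
have r20 : 0 < r2 by exact: lt_le_trans r12.
have lr : ln r1 <= ln r2 by rewrite ler_ln.
have t0 := ltW tpi_gt0.
pose u x y := complex.Re (g (cexp x y)).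
pose v x y := complex.Im (g (cexp x y)).
have Hp x y : ln r1 <= x <= ln r2 -> cdiff g (cexp x y).
  move=> /andP[x1 x2]; apply: H; rewrite normc_cexp.
  by rewrite -(lnK r10) -(lnK r20) !ler_expR x1.
(* With g(e^(x+iy)) = u + iv, the form is (u dx - v dy) + i (v dx + u dy). On vertical sides its
   imaginary part compares the integrals of u and its real part those of v. *)
have cl1 : closed_on u (fun x y => - v x y) (ln r1) (ln r2) 0 tpi.
  move=> x y xI yI; have [D HD] := cdiff_polar (Hp x y xI).
  exists (complex.Re D), (- complex.Im D), (- complex.Re D) => e e0.
  have [r r0 K] := HD e e0; exists r => // x' y' _ _ xr yr.
  have := K _ _ xr yr => L; split.
    apply: le_trans L; apply: le_trans (normc_Re _).
    by rewrite !(ReD, ImD, ReN, ImN, ReM, ImM) /=; rewrite le_eqVlt; apply/orP; left; apply/eqP; congr `|_|; rewrite /u; ring.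
  apply: le_trans L; apply: le_trans (normc_Im _).
  rewrite !(ReD, ImD, ReN, ImN, ReM, ImM) /= -normrN.
  by rewrite le_eqVlt; apply/orP; left; apply/eqP; congr `|_|; rewrite /v; ring.
have cl2 : closed_on v u (ln r1) (ln r2) 0 tpi.
  move=> x y xI yI; have [D HD] := cdiff_polar (Hp x y xI).
  exists (complex.Im D), (complex.Re D), (- complex.Im D) => e e0.
  have [r r0 K] := HD e e0; exists r => // x' y' _ _ xr yr.
  have := K _ _ xr yr => L; split.
    apply: le_trans L; apply: le_trans (normc_Im _).
    by rewrite !(ReD, ImD, ReN, ImN, ReM, ImM) /=; rewrite le_eqVlt; apply/orP; left; apply/eqP; congr `|_|; rewrite /v; ring.
  apply: le_trans L; apply: le_trans (normc_Re _).
  rewrite !(ReD, ImD, ReN, ImN, ReM, ImM) /=.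
  by rewrite le_eqVlt; apply/orP; left; apply/eqP; congr `|_|; rewrite /u; ring.
have l1 : ln r1 <= ln r1 <= ln r2 by rewrite lexx.
have l2 : ln r1 <= ln r2 <= ln r2 by rewrite lexx lr.
have per x : cexp x tpi = cexp x 0 by rewrite /cexp cis0 /tpi cis2pi.
have z0 : eint (ln r1) (ln r2) (fun=> (0 : R)) = 0 by rewrite eint_cst // mul0r.
have := goursat lr t0 cl2; rewrite /circulation.
rewrite (@eq_eint _ _ _ _ (fun=> 0)); last by move=> x _; rewrite /v per subrr.
rewrite z0 add0r eintB; [|exact: closed_on_contQ cl2 _..].
move=> /subr0_eq E1.
have := goursat lr t0 cl1; rewrite /circulation.
rewrite (@eq_eint _ _ _ _ (fun=> 0)); last by move=> x _; rewrite /u per subrr.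
rewrite z0 add0r eintB; [|exact: closed_on_contQ cl1 _..].
move=> /subr0_eq E2.
have cN x : ln r1 <= x <= ln r2 -> eint 0 tpi (fun y => - v x y) = - eint 0 tpi (v x).
  by move=> xI; exact: eintN (closed_on_contQ cl1 xI).
rewrite (cN _ l1) (cN _ l2) in E2; move/oppr_inj in E2.
have ce r t : 0 < r -> r%:C%C * cis t = cexp (ln r) t by move=> r0; rewrite /cexp lnK.
rewrite /cavg; congr (_ * Complex _ _).
  rewrite -(@eq_eint _ _ _ (u (ln r1))); last by move=> t _; rewrite /u ce.
  by rewrite -E1; apply: eq_eint => t _; rewrite /u ce.
rewrite -(@eq_eint _ _ _ (v (ln r1))); last by move=> t _; rewrite /v ce.
by rewrite -E2; apply: eq_eint => t _; rewrite /v ce.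
Qed.

End CircleAverage.

Arguments normc : simpl never.
Arguments cavg : simpl never.

(** * The mean value property *)

Section MeanValue.
Context {R : realType}.
Local Notation C := R[i].
Implicit Types (F G : C -> C) (g h : C -> C).

Lemma circ_cont_scale g r : 0 <= r -> (forall z, normc z = r -> ccont g z) ->
  circ_cont (fun w => g (r%:C%C * w)).
Proof.
move=> r0 H; apply: circ_cont_ccont => w w1 e e0.
have [|d d0 K] := H (r%:C%C * w) _ e e0.
  by rewrite normcM normcR w1 mulr1 ger0_norm.
exists (d / (1 + r)) => [|h]; first by rewrite divr_gt0 // ltr_pwDl.
rewrite ltr_pdivlMr ?ltr_pwDl // => hd; rewrite mulrDr; apply: K.
rewrite normcM normcR ger0_norm //; apply: le_lt_trans hd.
by rewrite mulrC ler_wpM2l ?normc_ge0 // lerDr.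
Qed.

Lemma cavg_cvg0 g : ccont g 0 -> forall e, 0 < e -> exists2 d, 0 < d & forall r,
   0 <= r < d -> (forall z, normc z = r -> ccont g z) ->
   normc (cavg (fun w => g (r%:C%C * w)) - g 0) <= e.
Proof.
move=> g0 e e0; have [d d0 H] := g0 _ (divr_gt0 e0 (ltr0n R 2)).
exists d => // r /andP[r0 rd] gr.
rewrite -[X in _ - X](cavg_cst (g 0)) -cavgB; [|exact: circ_cont_scale|exact: circ_cont_cst].
rewrite (_ : e = 2 * (e / 2)); last by field.
apply: normc_cavg => [|w w1].
  apply: (@eq_circ_cont R (fun w => g (r%:C%C * w) + (-1) * g 0)).
    by move=> w _; rewrite mulN1r.
  by apply: circ_contD; [exact: circ_cont_scale|exact: circ_cont_cst].
rewrite -[r%:C%C * w]add0r; apply: H.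
by rewrite normcM normcR ger0_norm // w1 mulr1.
Qed.

(** Continuity of g is given point by point on the circle of radius s; compactness of [0, 2 pi]
    makes it uniform in the angle. *)
Lemma cavg_cvg g s : 0 < s -> (forall z, normc z = s -> ccont g z) ->
  forall e, 0 < e -> exists2 d, 0 < d & forall r, 0 <= r -> `|r - s| < d ->
   (forall z, normc z = r -> ccont g z) ->
   normc (cavg (fun w => g (r%:C%C * w)) - cavg (fun w => g (s%:C%C * w))) <= e.
Proof.
move=> s0 gs e e0.
have : \forall r \near s, `[(0:R), tpi]%classic `<=`
   [set t | normc (g (r%:C%C * cis t) - g (s%:C%C * cis t)) <= e / 2].
  have := (@compact_near_coveringP R^o `[(0:R), tpi]%classic).1 (@segment_compact R 0 tpi).
  move=> /(_ R (nbhs s) (fun r t => normc (g (r%:C%C * cis t) - g (s%:C%C * cis t)) <= e / 2)).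
  apply => t _.
  have e4 : 0 < e / 4 by rewrite divr_gt0.
  have [|d d0 K] := gs (s%:C%C * cis t) _ _ e4; first by rewrite normc_scale_cis // ltW.
  have d4 : 0 < d / 2 / (1 + s) by rewrite !divr_gt0 // addr_gt0.
  have [d2 d20 K2] := cis_cont t d4.
  have tt : \forall x \near t, `|x - t| < d2.
    by apply/nbhs_ballP; exists d2 => //= x; rewrite /ball /= distrC.
  have rr : \forall r \near s, `|r - s| < d / 2.
    apply/nbhs_ballP; exists (d / 2) => //=; first by rewrite divr_gt0.
    by move=> x; rewrite /ball /= distrC.
  exists ([set x | `|x - t| < d2], [set r | `|r - s| < d / 2]) => //= -[x r] /= [xt rs].
  have xs : s * normc (cis x - cis t) < d / 2.
    apply: (@le_lt_trans _ _ (s * (d / 2 / (1 + s)))).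
      by rewrite ler_wpM2l ?(ltW s0) // K2.
    rewrite mulrA ltr_pdivrMr ?addr_gt0 // mulrC ltr_pM2l ?divr_gt0 //.
    by rewrite ltrDr.
  rewrite (_ : g (r%:C%C * cis x) - g (s%:C%C * cis x) =
    (g (s%:C%C * cis t + (r%:C%C * cis x - s%:C%C * cis t)) - g (s%:C%C * cis t)) -
    (g (s%:C%C * cis t + s%:C%C * (cis x - cis t)) - g (s%:C%C * cis t))); last first.
    rewrite (_ : s%:C%C * cis t + (r%:C%C * cis x - s%:C%C * cis t) = r%:C%C * cis x); last by ring.
    rewrite (_ : s%:C%C * cis t + s%:C%C * (cis x - cis t) = s%:C%C * cis x); last by ring.
    by ring.
  apply: le_trans (normcB _ _) _.
  rewrite (_ : e / 2 = e / 4 + e / 4); last by field.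
  apply: lerD; apply: K.
    rewrite (_ : _ - _ = (r - s)%:C%C * cis x + s%:C%C * (cis x - cis t)); last first.
      by rewrite rmorphB; ring.
    apply: le_lt_trans (normcD _ _) _; rewrite !normcM normc_cis mulr1 !normcR.
    by rewrite (gtr0_norm s0); move: xs; move: (s * _) => X; lra.
  rewrite normcM normcR (gtr0_norm s0); apply: lt_trans xs _.
  by rewrite ltr_pdivrMr // ltr_pMr // ltr1n.
move=> /nbhs_ballP[d d0 K]; exists d => // r r0 rs gr.
have c1 : circ_cont (fun w => g (r%:C%C * w)) by exact: circ_cont_scale.
have c2 : circ_cont (fun w => g (s%:C%C * w)) by apply: circ_cont_scale => //; exact: ltW.
rewrite -(cavgB c1 c2).
have K' t : 0 <= t <= tpi -> normc (g (r%:C%C * cis t) - g (s%:C%C * cis t)) <= e / 2.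
  by move=> tI; apply: (K r); rewrite /ball /= ?in_itv // distrC.
rewrite (_ : e = 2 * (e / 2)); last by field.
apply: normc_cavg_seg => //.
apply: (@eq_circ_cont R (fun w => g (r%:C%C * w) + (-1) * g (s%:C%C * w))).
  by move=> w _; rewrite mulN1r.
by apply: circ_contD => //; exact: circ_contZ.
Qed.

(* The exceptional set {0} and {|z| = s} only needs continuity: circle means
   depend continuously on the radius. *)
Lemma mean_value g rho s : 0 < s -> (forall z, normc z < rho -> ccont g z) ->
  (forall z, 0 < normc z < rho -> normc z != s -> cdiff g z) ->
  forall r, s < r < rho -> cavg (fun w => g (r%:C%C * w)) = g 0.
Proof.
move=> s0 gc gd r /andP[sr rr]; pose A r := cavg (fun w => g (r%:C%C * w)).
have below r1 r2 : 0 < r1 -> r1 <= r2 -> r2 < s -> A r1 = A r2.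
  move=> r10 r12 r2s; apply: cavg_radius => // z /andP[z1 z2]; apply: gd.
    by rewrite (lt_le_trans r10 z1) (le_lt_trans z2) // (lt_trans r2s) // (lt_trans sr).
  by rewrite lt_eqF // (le_lt_trans z2).
have above r1 : s < r1 -> r1 <= r -> A r1 = A r.
  move=> sr1 r1r; apply: cavg_radius => //; first exact: lt_trans sr1.
  move=> z /andP[z1 z2]; have sz := lt_le_trans sr1 z1; apply: gd.
    by rewrite (lt_trans s0) //= (le_lt_trans z2).
  by rewrite gt_eqF.
have gcs z : normc z = s -> ccont g z by move=> zs; apply: gc; rewrite zs (lt_trans sr).
suff main e : 0 < e -> normc (A r - g 0) <= e.
  apply/eqP; rewrite -subr_eq0 -normc_eq0; apply/eqP/le_anti; rewrite normc_ge0 andbT.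
  by apply/ler_addgt0Pr => e e0; rewrite add0r main.
move=> e0; have e3 : 0 < e / 3 by rewrite divr_gt0.
have [d1 d10 H1] := cavg_cvg s0 gcs e3.
have [|d2 d20 H2] := @cavg_cvg0 g _ _ e3; first by apply: gc; rewrite normc0 (lt_trans _ rr) // (lt_trans s0).
(* [A] is constant on radii below s and on radii in ]s, r]. The radii ra and rb, close to s, compare
   the two constants through A s; rc, close to 0, compares the lower constant with g 0. *)
pose ra := Num.min r (s + d1 / 2).
pose rb := Num.max (s / 2) (s - d1 / 2).
pose rc := Num.min rb (d2 / 2).
have ra1 : s < ra by rewrite lt_min sr ltrDl divr_gt0.
have ra2 : ra <= r by rewrite ge_min lexx.
have ra3 : `|ra - s| < d1.
  by rewrite gtr0_norm ?subr_gt0 // ltrBlDl /ra gt_min; apply/orP; right; lra.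
have rb0 : 0 < rb by rewrite lt_max divr_gt0.
have rb1 : rb < s by rewrite gt_max; apply/andP; split; lra.
have rb3 : `|rb - s| < d1.
  rewrite distrC gtr0_norm ?subr_gt0 // ltrBlDr addrC -ltrBlDr /rb lt_max.
  by apply/orP; right; lra.
have rc0 : 0 < rc by rewrite lt_min rb0 divr_gt0.
have rc1 : rc <= rb by rewrite ge_min lexx.
have rc2 : rc < d2 by rewrite /rc gt_min; apply/orP; right; lra.
have cc x : x <= r -> forall z, normc z = x -> ccont g z.
  by move=> xr z zx; apply: gc; rewrite zx; exact: le_lt_trans rr.
have E1 : normc (A ra - A s) <= e / 3.
  by apply: H1 => //; [rewrite ltW // (lt_trans s0)|exact: cc].
have E2 : normc (A rb - A s) <= e / 3.
  by apply: H1 => //; [exact: ltW|apply: cc; rewrite ltW // (lt_trans rb1)].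
have E3 : normc (A rc - g 0) <= e / 3.
  by apply: H2; [rewrite ltW|apply: cc; rewrite ltW // (le_lt_trans rc1) // (lt_trans rb1)].
rewrite -(above _ ra1 ra2) (_ : A ra - g 0 = (A ra - A s) - (A rb - A s) + (A rc - g 0)); last first.
  by rewrite (below rc rb) //; ring.
apply: le_trans (normcD _ _) _; have := normcB (A ra - A s) (A rb - A s).
by move: (normc _) (normc _) (normc _) (normc _) E1 E2 E3 => a b c d; lra.
Qed.

End MeanValue.

(** * Taylor expansion with an exact remainder *)

Section Expansion.
Context {R : realType}.
Local Notation C := (R[i]).
Implicit Types (F G : C -> C) (g h : C -> C).

Lemma complex_gt0P (e : C) : 0 < e -> exists2 r : R, 0 < r & e = r%:C%C.
Proof.
case: e => a b; rewrite ltcE /= => /andP[/eqP b0 a0]; exists a => //.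
by rewrite b0.
Qed.

Lemma cdiffP g z : cdiff g z <-> derivable (g : C^o -> C^o) z 1.
Proof.
split=> [[d D]|df].
  apply/cvg_ex; exists (d : C^o); apply/cvgrPdist_le => e e0.
  have [r r0 ->] := complex_gt0P e0.
  have [s s0 H] := D r r0.
  rewrite near_withinE; apply/nbhs_ballP; exists s%:C%C => /=; first by rewrite ltcR.
  move=> t; rewrite /ball /= sub0r normrN normcT ltcR => ts t0.
  rewrite normcT lecR /GRing.scale /= mulr1 (addrC t z).
  rewrite (_ : _ - _ = - (t^-1 * (g (z + t) - g z - d * t))); last by field.
  rewrite normcN normcM normcV ler_pdivrMl ?normc_gt0 // [leRHS]mulrC.
  exact: H.
exists ('D_1 (g : C^o -> C^o) z) => e e0.
move/cvgrPdist_le : df => /(_ e%:C%C).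
rewrite ltcR => /(_ e0); rewrite near_withinE => /nbhs_ballP[r' /= /complex_gt0P[r r0 ->] H].
exists r => // h hr.
have [->|h0] := eqVneq h 0; first by rewrite addr0 subrr mulr0 subrr !normc0 mulr0.
have := H h; rewrite /ball /= sub0r normrN normcT ltcR => /(_ hr h0).
rewrite normcT lecR /GRing.scale /= mulr1 (addrC h z) => L.
rewrite (_ : _ - _ = - ('D_1 (g : C^o -> C^o) z - h^-1 * (g (z + h) - g z)) * h); last by field.
by rewrite normcM normcN ler_wpM2r // normc_ge0.
Qed.

Lemma cdiff_cst (k z : C) : cdiff (fun=> k) z.
Proof. by apply/cdiffP; exact: derivable_cst. Qed.

Lemma cdiff_id (z : C) : cdiff id z.
Proof. by apply/cdiffP; exact: derivable_id. Qed.

Lemma cdiffB g h z : cdiff g z -> cdiff h z -> cdiff (fun x => g x - h x) z.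
Proof. by move=> /cdiffP dg /cdiffP dh; apply/cdiffP; exact: derivableB. Qed.

Lemma cdiffM g h z : cdiff g z -> cdiff h z -> cdiff (fun x => g x * h x) z.
Proof.
move=> /cdiffP dg /cdiffP dh; have H := @derivableM C C^o g h z 1 dg dh.
exact: (cdiffP (fun x => g x * h x) z).2 H.
Qed.

Lemma cdiffV g z : g z != 0 -> cdiff g z -> cdiff (fun x => (g x)^-1) z.
Proof.
move=> gz /cdiffP dg; have H := @derivableV C C^o g z 1 gz dg.
exact: (cdiffP (fun x => (g x)^-1) z).2 H.
Qed.

Lemma cdiffX g z k : cdiff g z -> cdiff (fun x => g x ^+ k) z.
Proof.
move=> dg; elim: k => [|k IH]; first exact: cdiff_cst.
rewrite (_ : (fun _ => _) = fun x => g x * g x ^+ k); first exact: cdiffM.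
by apply/funext => x; rewrite exprS.
Qed.

Lemma eq_near_cdiff g h z (r : R) : 0 < r -> (forall x, normc (x - z) < r -> g x = h x) ->
  cdiff g z -> cdiff h z.
Proof.
move=> r0 gh [d D]; exists d => e /D[s s0 H].
exists (Num.min r s) => [|x]; first by rewrite lt_min r0.
rewrite lt_min => /andP[xr xs]; rewrite -!gh ?subrr ?normc0 //; first exact: H.
by rewrite addrAC subrr add0r.
Qed.

(* Mean value property of z (h(z) - h(z0)) / (z - z0), extended by
   continuity at z0; the factor z makes the value at 0 vanish. *)
Lemma cavg_cauchy h (rho r : R) z0 : (forall z, normc z < rho -> cdiff h z) ->
  0 < r < rho -> normc z0 < r ->
  cavg (fun w => (h (r%:C%C * w) - h z0) * (r%:C%C * w) / (r%:C%C * w - z0)) = 0.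
Proof.
move=> hd /andP[r0 rr] z0r.
have [d D] := hd z0 (lt_trans z0r rr).
pose g z := if z == z0 then z0 * d else (h z - h z0) * z / (z - z0).
have g0 : g 0 = 0.
  by rewrite /g; case: eqP => [<-|]; rewrite ?mul0r ?mulr0 ?mul0r.
have gd z : normc z < rho -> z != z0 -> cdiff g z.
  move=> zr zz; have n0 : 0 < normc (z - z0) by rewrite normc_gt0 subr_eq0.
  apply: (@eq_near_cdiff (fun z => (h z - h z0) * z / (z - z0)) _ z _ n0).
    move=> x xz; rewrite /g; case: eqP => // xz0; move: xz.
    by rewrite xz0 normc_distC ltxx.
  apply: cdiffM; last first.
    apply: cdiffV; first by rewrite subr_eq0.
    by apply: cdiffB; [exact: cdiff_id|exact: cdiff_cst].
  apply: cdiffM; last exact: cdiff_id.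
  by apply: cdiffB; [exact: hd|exact: cdiff_cst].
have gc z : normc z < rho -> ccont g z.
  move=> zr; have [->|zz] := eqVneq z z0; last by apply: cdiff_cont; exact: gd.
  have : ccont (fun x => x * d) z0.
    by apply: cdiff_cont; apply: cdiffM; [exact: cdiff_id|exact: cdiff_cst].
  move=> lc e e0; have [s1 s10 H1] := lc (e / 2) (divr_gt0 e0 (ltr0n R 2)).
  pose m := 1 + normc z0 + 1.
  have m0 : 0 < m by rewrite /m; have := normc_ge0 z0; lra.
  have [s2 s20 H2] := D (e / 2 / m) (divr_gt0 (divr_gt0 e0 (ltr0n R 2)) m0).
  exists (Num.min 1 (Num.min s1 s2)) => [|x]; first by rewrite !lt_min s10 s20 ltr01.
  rewrite !lt_min => /and3P[x1 xs1 xs2].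
  have [->|x0] := eqVneq x 0; first by rewrite addr0 subrr normc0 ltW.
  have xz : z0 + x == z0 = false by rewrite -subr_eq0 addrAC subrr add0r (negbTE x0).
  rewrite /g xz eqxx.
  rewrite (_ : _ - _ = (h (z0 + x) - h z0 - d * x) * ((z0 + x) / x) +
     ((z0 + x) * d - z0 * d)); last first.
    by field; rewrite ?x0.
  apply: le_trans (normcD _ _) _.
  rewrite (_ : e = e / 2 + e / 2); last by field.
  apply: lerD; last exact: H1.
  rewrite normcM.
  have zx : normc ((z0 + x) / x) <= m / normc x.
    rewrite normcM normcV ler_pM2r ?invr_gt0 ?normc_gt0 //.
    apply: le_trans (normcD _ _) _; rewrite /m; lra.
  apply: le_trans (ler_pM (normc_ge0 _) (normc_ge0 _) (H2 _ xs2) zx) _.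
  rewrite le_eqVlt; apply/orP; left; apply/eqP; field.
  by rewrite (lt0r_neq0 m0) normc_eq0 x0.
(* The exceptional circle of [mean_value] has to pass through z0. If z0 = 0, the exceptional point
   is the centre already and any radius below r serves. *)
pose s := if z0 == 0 then r / 2 else normc z0.
have s0 : 0 < s by rewrite /s; case: ifP => [_|/negbT]; rewrite ?normc_gt0 ?divr_gt0.
have sr : s < r by rewrite /s; case: ifP => // _; rewrite ltr_pdivrMr // ltr_pMr // ltr1n.
rewrite -g0 -(@mean_value R g rho s s0 gc _ r); last by rewrite sr.
  apply: eq_cavg => w w1; rewrite /g; case: eqP => // rw.
  by move: z0r; rewrite -rw normcM normcR w1 mulr1 gtr0_norm // ltxx.
move=> z /andP[z1 z2] zs; apply: gd => //.
apply: contra zs => /eqP zz; rewrite /s; case: (z0 =P 0) => [z00|_]; last by rewrite zz eqxx.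
by move: z1; rewrite zz z00 normc0 ltxx.
Qed.

(* The j-th Taylor coefficient of h, times r ^ j. *)
Definition ccoef h (r : R) (j : nat) : C := cavg (fun w => h (r%:C%C * w) * w^-1 ^+ j).

Lemma circ_contM F G : circ_cont F -> circ_cont G -> circ_cont (fun w => F w * G w).
Proof.
move=> [f1 f2] [g1 g2].
have M (u v : R -> R) : {within `[0, tpi], continuous u} -> {within `[0, tpi], continuous v} ->
   {within `[0, tpi], continuous (fun x => u x * v x)}.
  by move=> cu cv x; apply: cvgM; [exact: cu|exact: cv].
split.
  rewrite (_ : (fun _ => _) = fun t => complex.Re (F (cis t)) * complex.Re (G (cis t)) -
      complex.Im (F (cis t)) * complex.Im (G (cis t))).
    by apply: within_contB; exact: M.
  by apply/funext => t; rewrite ReM.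
rewrite (_ : (fun _ => _) = fun t => complex.Re (F (cis t)) * complex.Im (G (cis t)) +
      complex.Im (F (cis t)) * complex.Re (G (cis t))).
  by apply: within_contD; exact: M.
by apply/funext => t; rewrite ImM.
Qed.

Lemma circ_cont_Vexp j : circ_cont (fun w : C => w^-1 ^+ j).
Proof.
apply: circ_cont_ccont => w w1; apply: cdiff_cont; apply: cdiffX; apply: cdiffV.
  by rewrite -normc_eq0 w1 oner_eq0.
exact: cdiff_id.
Qed.

Lemma circ_cont_cdiff g : (forall w, normc w = 1 -> cdiff g w) -> circ_cont g.
Proof. by move=> H; apply: circ_cont_ccont => w w1; apply: cdiff_cont; exact: H. Qed.

Lemma cavg_Vexp j : (0 < j)%N -> cavg (fun w : C => w^-1 ^+ j) = 0.
Proof.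
(* [x |-> (1 / x) ^ j] has the same mean on every circle of radius >= 1, while
   it is multiplied by 2 ^- j on the circle of radius 2 *)
move=> j0.
have : cavg (fun w => (1%:C%C * w)^-1 ^+ j) = cavg (fun w : C => (2%:C%C * w)^-1 ^+ j).
  apply: (@cavg_radius R (fun x => x^-1 ^+ j)) => [//||z /andP[z1 _]]; first exact: ler1n.
  apply: cdiffX; apply: cdiffV; last exact: cdiff_id.
  by rewrite -normc_gt0 (lt_le_trans ltr01).
rewrite (_ : (fun w => (2%:C%C * w)^-1 ^+ j) = fun w => (2%:C%C)^-1 ^+ j * w^-1 ^+ j); last first.
  by apply/funext => w; rewrite invfM exprMn.
rewrite cavgZ; last exact: circ_cont_Vexp.
rewrite (@eq_cavg _ (fun w => (1%:C%C * w)^-1 ^+ j) (fun w => w^-1 ^+ j)); last first.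
  by move=> w _; rewrite mul1r.
move/eqP; rewrite -subr_eq0 -{1}[cavg _]mul1r -mulrBl mulf_eq0 => /orP[|/eqP //].
rewrite subr_eq0 => /eqP /(congr1 (@normc R)).
rewrite normc1 normcX normcV normcR ger0_norm // => /esym/eqP.
by rewrite lt_eqF // exprn_ilt1 ?invr_ge0 // ?invf_lt1 ?ltr1n // -lt0n.
Qed.

(** In the vanishing mean of [cavg_cauchy], write 1 / (1 - q) as the sum of q ^ j for j < J plus q ^
    J / (1 - q), with q = z0 / (r w). By [cavg_Vexp] the constant h z0 contributes to the term j = 0
    alone; J is a successor so that this term can be split off. *)
Lemma ccoef_expansion h (rho r : R) z0 J0 (J := J0.+1) : (forall z, normc z < rho -> cdiff h z) ->
  0 < r < rho -> normc z0 < r ->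
  h z0 - \sum_(j < J) (z0 / r%:C%C) ^+ j * ccoef h r j =
  cavg (fun w => (h (r%:C%C * w) - h z0) * ((z0 / (r%:C%C * w)) ^+ J *
     ((r%:C%C * w) / (r%:C%C * w - z0)))).
Proof.
move=> hd rr z0r; have /andP[r0 r1] := rr.
have rC : (r%:C%C : C) != 0 by rewrite -normc_gt0 normcR normr_gt0 lt0r_neq0.
have hc : circ_cont (fun w => h (r%:C%C * w)).
  apply: circ_cont_scale; first exact: ltW.
  by move=> z zr; apply: cdiff_cont; apply: hd; rewrite zr.
have ne w : normc w = 1 -> r%:C%C * w - z0 != 0.
  move=> w1; rewrite subr_eq0; apply: contraTneq z0r => <-.
  by rewrite normcM normcR w1 mulr1 gtr0_norm // ltxx.
have w0 (w : C) : normc w = 1 -> w != 0 by move=> w1; rewrite -normc_eq0 w1 oner_eq0.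
have cq : circ_cont (fun w => (r%:C%C * w) / (r%:C%C * w - z0)).
  apply: circ_cont_cdiff => w w1.
  have dl : cdiff (fun w => r%:C%C * w) w by apply: cdiffM; [exact: cdiff_cst|exact: cdiff_id].
  apply: cdiffM => //; apply: cdiffV; first exact: ne.
  by apply: cdiffB => //; exact: cdiff_cst.
have cz j : circ_cont (fun w => (z0 / (r%:C%C * w)) ^+ j).
  apply: (eq_circ_cont _ (circ_contZ ((z0 / r%:C%C) ^+ j) (circ_cont_Vexp j))).
  by move=> w w1; rewrite -exprMn invfM mulrA.
have hz : circ_cont (fun w => h (r%:C%C * w) - h z0).
  by apply: (eq_circ_cont _ (circ_contD hc (circ_cont_cst (- h z0)))).
have cS : circ_cont (fun w => \sum_(j < J) (h (r%:C%C * w) - h z0) * (z0 / (r%:C%C * w)) ^+ j).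
  apply: (@circ_cont_sum R J (fun j w => (h (r%:C%C * w) - h z0) * (z0 / (r%:C%C * w)) ^+ j)).
  by move=> j; exact: circ_contM.
have := cavg_cauchy hd rr z0r.
rewrite (@eq_cavg _ _ (fun w => \sum_(j < J) (h (r%:C%C * w) - h z0) * (z0 / (r%:C%C * w)) ^+ j +
  (h (r%:C%C * w) - h z0) * ((z0 / (r%:C%C * w)) ^+ J * ((r%:C%C * w) / (r%:C%C * w - z0))))); last first.
  move=> w w1; rewrite -mulr_sumr -mulrDr -mulrA; congr (_ * _).
  have rw : r%:C%C * w != 0 by rewrite mulf_neq0 // w0.
  pose q := z0 / (r%:C%C * w).
  have q1 : 1 - q != 0.
    rewrite subr_eq0 eq_sym; apply: contra (ne w w1) => /eqP; rewrite /q => /divr1_eq ->.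
    by rewrite subrr.
  have -> : r%:C%C * w / (r%:C%C * w - z0) = (1 - q)^-1.
    by rewrite /q; field; apply/and3P; split; [exact: w0|exact: rC|exact: ne].
  rewrite -/q; apply: (mulfI q1).
  have E : (1 - q) * \sum_(j < J) q ^+ j = 1 - q ^+ J.
    by rewrite -(opprB q 1) mulNr -subrX1 opprB.
  by rewrite mulrDr E mulrCA mulfV // mulr1 subrK.
rewrite cavgD //; last by apply: circ_contM => //; exact: circ_contM.
move=> /eqP; rewrite addrC addr_eq0 => /eqP ->.
rewrite (@cavg_sum R J (fun j w => (h (r%:C%C * w) - h z0) * (z0 / (r%:C%C * w)) ^+ j)); last first.
  by move=> j; exact: circ_contM.
rewrite big_ord_recl /= [in RHS]big_ord_recl /=.
have Sj j : (0 < j)%N -> cavg (fun w => (h (r%:C%C * w) - h z0) * (z0 / (r%:C%C * w)) ^+ j) =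
   (z0 / r%:C%C) ^+ j * ccoef h r j.
  move=> j0; rewrite (@eq_cavg _ _ (fun w => (z0 / r%:C%C) ^+ j * (h (r%:C%C * w) * w^-1 ^+ j) -
     (h z0 * (z0 / r%:C%C) ^+ j) * w^-1 ^+ j)); last first.
    move=> w w1; rewrite (_ : z0 / (r%:C%C * w) = z0 / r%:C%C * w^-1); last by rewrite invfM mulrA.
    by rewrite [(_ * w^-1) ^+ j]exprMn; ring.
  have c2 := circ_cont_Vexp j.
  have c1 : circ_cont (fun w => h (r%:C%C * w) * w^-1 ^+ j) by apply: circ_contM.
  rewrite cavgB; [|exact: circ_contZ..].
  by rewrite !cavgZ // cavg_Vexp // mulr0 subr0.
rewrite [X in _ = - (_ + X)](eq_bigr (fun j : 'I_J0 => (z0 / r%:C%C) ^+ j.+1 * ccoef h r j.+1)); last first.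
  by move=> j _; exact: (Sj j.+1).
rewrite expr0 mul1r !opprD addrA; congr (_ - _).
rewrite (@eq_cavg _ _ (fun w => h (r%:C%C * w) - h z0)); last first.
  by move=> w _; rewrite expr0 mulr1.
rewrite cavgB //; last exact: circ_cont_cst.
rewrite cavg_cst opprB; congr (_ - _); apply: eq_cavg => w _.
by rewrite expr0 mulr1.
Qed.

End Expansion.

(** * Estimates drawn from the Taylor expansion *)

Section SecondOrder.
Context {R : realType}.
Local Notation C := (R[i]).
Implicit Types (F G : C -> C) (g h : C -> C).

Lemma circ_bounded F : circ_cont F -> exists M, forall t, 0 <= t <= tpi -> normc (F (cis t)) <= M.
Proof.
move=> [f1 f2]; have t0 := ltW (@tpi_gt0 R).
have [c1 c1I M1] := EVT_max t0 f1.
have [c2 c2I M2] := EVT_min t0 f1.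
have [c3 c3I M3] := EVT_max t0 f2.
have [c4 c4I M4] := EVT_min t0 f2.
exists (`|complex.Re (F (cis c1))| + `|complex.Re (F (cis c2))| +
  (`|complex.Im (F (cis c3))| + `|complex.Im (F (cis c4))|)) => t tI.
have bnd (a b x : R) : b <= x -> x <= a -> `|x| <= `|a| + `|b|.
  move=> bx xa; rewrite ler_norml; apply/andP; split.
    by have := ler_norm (- b); rewrite normrN; have := normr_ge0 a; lra.
  by have := ler_norm a; have := normr_ge0 b; lra.
have tI' : t \in `[0, tpi] by rewrite in_itv.
apply: le_trans (normc_le_ReIm _) _; apply: lerD; apply: bnd; by [apply: M1|apply: M2|apply: M3|apply: M4].
Qed.

Lemma ccoef_expansion_bound h (rho r M : R) z0 J0 (J := J0.+1) :
  (forall z, normc z < rho -> cdiff h z) -> 0 < r < rho -> normc z0 < r ->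
  (forall t, 0 <= t <= tpi -> normc (h (r%:C%C * cis t) - h z0) <= M) ->
  normc (h z0 - \sum_(j < J) (z0 / r%:C%C) ^+ j * ccoef h r j) <=
  2 * (M * ((normc z0 / r) ^+ J * (r / (r - normc z0)))).
Proof.
move=> hd rr z0r hM; have /andP[r0 r1] := rr.
rewrite (ccoef_expansion _ hd rr z0r).
have ne w : normc w = 1 -> r%:C%C * w - z0 != 0.
  move=> w1; rewrite subr_eq0; apply: contraTneq z0r => <-.
  by rewrite normcM normcR w1 mulr1 gtr0_norm // ltxx.
have w0 (w : C) : normc w = 1 -> w != 0 by move=> w1; rewrite -normc_eq0 w1 oner_eq0.
have rC : (r%:C%C : C) != 0 by rewrite -normc_gt0 normcR normr_gt0 lt0r_neq0.
apply: normc_cavg_seg => [|t tI].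
  have cl w : cdiff (fun w => r%:C%C * w) w by apply: cdiffM; [exact: cdiff_cst|exact: cdiff_id].
  apply: circ_contM.
    apply: (eq_circ_cont _ (circ_contD _ (circ_cont_cst (- h z0)))) => //.
    apply: circ_cont_scale; first exact: ltW.
    by move=> z zr; apply: cdiff_cont; apply: hd; rewrite zr.
  apply: circ_cont_cdiff => w w1; apply: cdiffM.
    apply: cdiffX; apply: cdiffM; first exact: cdiff_cst.
    by apply: cdiffV; [apply: mulf_neq0 => //; exact: w0|exact: cl].
  apply: cdiffM; first exact: cl.
  apply: cdiffV; first exact: ne.
  by apply: cdiffB; [exact: cl|exact: cdiff_cst].
have n1 : normc (r%:C%C * cis t) = r by rewrite normc_scale_cis // ltW.
rewrite normcM; apply: ler_pM; rewrite ?normc_ge0 //; first exact: hM.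
rewrite !normcM normcX normcM !normcV n1.
have rz : r - normc z0 <= normc (r%:C%C * cis t - z0).
  rewrite lerBlDr -{1}n1.
  by apply: le_trans (normcD _ _); rewrite subrK.
apply: ler_wpM2l; first by rewrite exprn_ge0 // divr_ge0 ?normc_ge0 // ltW.
rewrite normcR normc_cis mulr1 gtr0_norm //; apply: ler_wpM2l; first exact: ltW.
have rz0 : 0 < r - normc z0 by rewrite subr_gt0.
by rewrite lef_pV2 ?posrE // (lt_le_trans rz0).
Qed.

(** The Taylor coefficient computed on the unit circle, where the normalizing factor r ^ j is 1. *)
Definition ucoef h j := cavg (fun w => h w * w^-1 ^+ j).

Lemma ccoef1 h j : ccoef h 1 j = ucoef h j.
Proof. by apply: eq_cavg => w _; rewrite mul1r. Qed.

Lemma ucoef0 h (rho : R) : 1 < rho -> (forall z, normc z < rho -> cdiff h z) -> ucoef h 0 = h 0.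
Proof.
move=> r1 hd; have rr : 0 < (1 : R) < rho by rewrite ltr01 r1.
have := @ccoef_expansion R h rho 1 0 0 hd rr; rewrite normc0 => /(_ ltr01).
rewrite big_ord1 expr0 mul1r ccoef1.
rewrite (@eq_cavg _ _ (fun=> 0)) ?cavg_cst; first by move/subr0_eq.
by move=> w _; rewrite mul0r expr1 mul0r mulr0.
Qed.

Lemma second_order h (M : R) : (forall z, normc z < 2 -> cdiff h z) ->
  (forall z, normc z <= 1 -> normc (h z) <= M) -> forall z, normc z <= 1 / 2 ->
  normc (h z - h 0 - z * ucoef h 1) <= 8 * M * normc z ^+ 2.
Proof.
move=> hd hM z z2.
have rr : 0 < (1 : R) < 2 by rewrite ltr01 ltr1n.
have z1 : normc z < 1 by lra.
(* Two terms of the series on the unit circle: the remainder is at most 2 * 2M * |z|^2 / (1 - |z|),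
   and |z| <= 1/2 gives the constant 8. *)
have := @ccoef_expansion_bound h 2 1 (2 * M) z 1 hd rr z1.
rewrite !big_ord_recl big_ord0 addr0 /= expr0 expr1 mul1r !ccoef1 (ucoef0 _ hd) ?ltr1n //.
rewrite divr1 opprD addrA /bump /= addn0 => H.
apply: le_trans (H _) _ => [t tI|].
  apply: le_trans (normcB _ _) _; rewrite mulr_natl mulr2n; apply: lerD.
    by apply: hM; rewrite mul1r normc_cis.
  by apply: hM; exact: ltW.
have M0 : 0 <= M by apply: le_trans (hM 0 _); rewrite ?normc_ge0 ?normc0.
rewrite divr1 (_ : 8 * M * _ = 2 * (2 * M * (normc z ^+ 2 * 2))); last by ring.
rewrite ler_pM2l //.
have [->|Mn0] := eqVneq M 0; first by rewrite !mulr0 !mul0r.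
have M2 : 0 < 2 * M by rewrite mulr_gt0 // lt_def Mn0.
rewrite ler_pM2l //.
apply: ler_wpM2l; first by rewrite exprn_ge0 ?normc_ge0.
by rewrite ler_pdivrMr; lra.
Qed.

(** Both numbers are slopes of an affine approximation of h at 0 with error o(|x|); comparing them
    at a small positive real t shows that they agree. *)
Lemma ucoef1_deriv h (M : R) d : (forall z, normc z < 2 -> cdiff h z) ->
  (forall z, normc z <= 1 -> normc (h z) <= M) ->
  (forall e, 0 < e -> exists2 r, 0 < r & forall x, normc x < r ->
    normc (h x - h 0 - d * x) <= e * normc x) -> d = ucoef h 1.
Proof.
move=> hd hM hD.
have M0 : 0 <= M by apply: le_trans (hM 0 _); rewrite ?normc_ge0 ?normc0.
suff main e : 0 < e -> normc (d - ucoef h 1) <= e.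
  apply/eqP; rewrite -subr_eq0 -normc_eq0; apply/eqP/le_anti; rewrite normc_ge0 andbT.
  by apply/ler_addgt0Pr => e e0; rewrite add0r main.
move=> e0; have [r r0 K] := hD (e / 2) (divr_gt0 e0 (ltr0n R 2)).
have q0 : 0 < 16 * (1 + M) by rewrite mulr_gt0 // ltr_pwDl.
pose t := Num.min (1 / 2) (Num.min (r / 2) (e / (16 * (1 + M)))).
have t0 : 0 < t by rewrite !lt_min !divr_gt0.
have tC : normc (t%:C%C : C) = t by rewrite normcR gtr0_norm.
have t1 : t <= 1 / 2 by rewrite ge_min lexx.
have t2 : t < r.
  have : t <= r / 2 by rewrite !ge_min lexx orbT.
  by lra.
have t3 : 8 * M * t <= e / 2.
  have : t <= e / (16 * (1 + M)) by rewrite !ge_min lexx !orbT.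
  rewrite ler_pdivlMr // => H; have := mulr_ge0 M0 (ltW t0); lra.
have A : normc (h t%:C%C - h 0 - t%:C%C * ucoef h 1) <= 8 * M * normc (t%:C%C : C) ^+ 2.
  by apply: second_order => //; rewrite tC.
have B := K t%:C%C; rewrite tC in A B; have {}B := B t2.
rewrite -(ler_pM2r t0) -{1}tC -normcM.
rewrite (_ : _ * _ = (h t%:C%C - h 0 - t%:C%C * ucoef h 1) - (h t%:C%C - h 0 - d * t%:C%C)); last by ring.
apply: le_trans (normcB _ _) _.
rewrite (_ : e * t = e / 2 * t + e / 2 * t); last by field.
apply: lerD => //; apply: le_trans A _.
by rewrite expr2 mulrA ler_wpM2r // ltW.
Qed.

Lemma normc_ucoef h M j : circ_cont h -> (forall w, normc w = 1 -> normc (h w) <= M) ->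
  normc (ucoef h j) <= 2 * M.
Proof.
move=> hc hM; apply: normc_cavg => [|w w1].
  by apply: circ_contM => //; exact: circ_cont_Vexp.
by rewrite normcM normcX normcV w1 invr1 expr1n mulr1 hM.
Qed.

Lemma ucoefB h g j : circ_cont h -> circ_cont g ->
  ucoef (fun x => h x - g x) j = ucoef h j - ucoef g j.
Proof.
move=> hc gc; rewrite /ucoef -cavgB; [|apply: circ_contM => //; exact: circ_cont_Vexp..].
by apply: eq_cavg => w _; rewrite mulrBl.
Qed.

(** The point 1 lies inside a circle of radius r with 1 < r < rho, where the expansion converges at
    the rate q = 1 / r; [cavg_radius] moves the coefficients back to the unit circle. *)
Lemma unit_expansion h (rho : R) : 1 < rho -> (forall z, normc z < rho -> cdiff h z) ->
  exists (K q : R), [/\ 0 <= q, q < 1 &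
   forall J, normc (h 1 - \sum_(j < J.+1) ucoef h j) <= K * q ^+ J].
Proof.
move=> rho1 hd.
pose r := (1 + rho) / 2.
have r1 : 1 < r by rewrite /r; lra.
have r0 : 0 < r by lra.
have rr : 0 < r < rho by apply/andP; split; rewrite /r; lra.
have cr z : normc z = r -> cdiff h z by move=> zr; apply: hd; rewrite zr /r; lra.
have hc : circ_cont (fun w => h (r%:C%C * w) - h 1).
  apply: (eq_circ_cont _ (circ_contD _ (circ_cont_cst (- h 1)))) => //.
  apply: circ_cont_scale; first exact: ltW.
  by move=> z /cr; exact: cdiff_cont.
have [M HM] := circ_bounded hc.
exists (2 * (M * (r^-1 * (r / (r - 1))))), r^-1; split=> [||J].
- by rewrite invr_ge0 ltW.
- by rewrite invf_lt1.
have n1 : normc (1 : C) < r by rewrite normc1.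
have := ccoef_expansion_bound J hd rr n1 HM.
rewrite normc1 (div1r r) (exprS r^-1) => H.
rewrite (_ : 2 * _ * _ = 2 * (M * (r^-1 * r^-1 ^+ J * (r / (r - 1))))); last by ring.
apply: le_trans H; rewrite le_eqVlt; apply/orP; left; apply/eqP; congr (normc (_ - _)).
apply: eq_bigr => j _; rewrite -ccoef1 /ccoef -cavgZ; last first.
  apply: circ_contM; last exact: circ_cont_Vexp.
  by apply: circ_cont_scale; [exact: ltW|move=> z /cr; exact: cdiff_cont].
have rC : (r%:C%C : C) != 0 by rewrite -normc_gt0 normcR normr_gt0 lt0r_neq0.
transitivity (cavg (fun w => h (1%:C%C * w) * (1%:C%C * w)^-1 ^+ j)).
  by apply: eq_cavg => w _; rewrite mul1r.
rewrite (@cavg_radius R (fun x => h x * x^-1 ^+ j) 1 r ltr01 (ltW r1)) => [|z /andP[z1 z2]].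
  by apply: eq_cavg => w _; rewrite invfM [(_ * w^-1) ^+ j]exprMn div1r; ring.
apply: cdiffM; first by apply: hd; apply: le_lt_trans z2 _; rewrite /r; lra.
apply: cdiffX; apply: cdiffV; last exact: cdiff_id.
by rewrite -normc_gt0 (lt_le_trans ltr01).
Qed.
End SecondOrder.

(** * Holomorphic functions on the ball *)

Section SeveralVariables.
Context {R : realType} {n : nat}.
Local Notation C := (R[i]).
Local Notation V := ('rV[R[i]]_n).
Local Notation VC := ('rV[(C : numFieldType)]_n).
Implicit Types (f g : V -> C) (z v x : V).

(** A real-valued l^1 norm; [norm_le_nrm] and [nrm_le_norm] compare it with the sup norm of row
    vectors, whose values lie in R[i]. *)
Definition nrm v : R := \sum_i normc (v 0 i).

Definition lin (l : 'I_n -> C) v : C := \sum_i l i * v 0 i.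

Definition hol_at f z := exists l, forall e, 0 < e -> exists2 r, 0 < r &
  forall h, nrm h < r -> normc (f (z + h) - f z - lin l h) <= e * nrm h.

Lemma nrm_ge0 v : 0 <= nrm v.
Proof. by apply: sumr_ge0 => i _; exact: normc_ge0. Qed.

Lemma nrm0 : nrm 0 = 0.
Proof. by rewrite /nrm big1 // => i _; rewrite mxE normc0. Qed.

Lemma nrmZ c v : nrm (c *: v) = normc c * nrm v.
Proof. by rewrite /nrm mulr_sumr; apply: eq_bigr => i _; rewrite mxE normcM. Qed.

Lemma nrmD u v : nrm (u + v) <= nrm u + nrm v.
Proof.
by rewrite /nrm -big_split; apply: ler_sum => i _; rewrite mxE /= normcD.
Qed.

Lemma normc_le_nrm v i : normc (v 0 i) <= nrm v.
Proof. by rewrite /nrm (bigD1 i) //= lerDl sumr_ge0 // => j _; exact: normc_ge0. Qed.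

Lemma nrm_eq0 v : nrm v = 0 -> v = 0.
Proof.
move=> v0; apply/rowP => i; rewrite mxE; apply/eqP; rewrite -normc_eq0.
by apply/eqP/le_anti; rewrite normc_ge0 -{1}v0 normc_le_nrm.
Qed.

Lemma linZ l c v : lin l (c *: v) = c * lin l v.
Proof. by rewrite /lin mulr_sumr; apply: eq_bigr => i _; rewrite mxE mulrCA. Qed.

Lemma linD l u v : lin l (u + v) = lin l u + lin l v.
Proof. by rewrite /lin -big_split; apply: eq_bigr => i _; rewrite mxE mulrDr. Qed.

Lemma normc_lin l v : normc (lin l v) <= (\sum_i normc (l i)) * nrm v.
Proof.
rewrite /lin mulr_suml.
have : normc (\sum_i l i * v 0 i) <= \sum_i normc (l i * v 0 i).
  elim/big_ind2: _ => [||i _]; [by rewrite normc0| |by []].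
  by move=> a b c d ab cd; apply: le_trans (normcD _ _) _; exact: lerD.
move/le_trans; apply; apply: ler_sum => i _; rewrite normcM.
by rewrite ler_wpM2l ?normc_ge0 // normc_le_nrm.
Qed.

Lemma norm_le_nrm v : `|v| <= (nrm v)%:C%C.
Proof.
have n0 : 0 <= (nrm v)%:C%C :> C by rewrite ler0c nrm_ge0.
rewrite /Num.Def.normr /= mx_normE.
rewrite -[leRHS]/((NngNum n0)%:num) num_le; apply/bigmax_leP; split.
  by rewrite -num_le.
by move=> [i j] _; rewrite -num_le /= ord1 normcT lecR normc_le_nrm.
Qed.

Lemma nrm_le_norm v : (nrm v)%:C%C <= n%:R * `|v|.
Proof.
have -> : n%:R * `|v| = \sum_(i < n) `|v| :> C by rewrite sumr_const card_ord mulr_natl.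
rewrite /nrm rmorph_sum /=; apply: ler_sum => i _; rewrite -normcT.
rewrite {2}/Num.Def.normr /= mx_normE.
have -> : `|v 0 i| = (`|v 0 i|%:nng)%:num :> C by [].
rewrite num_le.
by apply: le_trans (le_bigmax _ _ (0, i)).
Qed.

Definition linC (l : 'I_n -> C) : VC -> C^o := lin l.

Lemma linC_is_linear l : linear (linC l).
Proof. by move=> c u v; rewrite /linC linD linZ. Qed.

HB.instance Definition _ l := GRing.isLinear.Build C VC C^o _
  (linC l) (linC_is_linear l).

Lemma near_nrm (P : V -> Prop) (z : VC) :
  (\forall x \near z, P x) <-> exists2 r, 0 < r & forall h, nrm h < r -> P (z + h).
Proof.
split=> [/nbhs_normP[e /= /complex_gt0P[r r0 ->]] H|[r r0 H]].
  exists r => // h hr; apply: H; rewrite /ball_ /=.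
  rewrite opprD addNKr normrN; apply: le_lt_trans (norm_le_nrm _) _.
  by rewrite ltcR.
have q0 : 0 < r / (1 + n%:R) by rewrite divr_gt0 // ltr_pwDl.
apply/nbhs_normP; exists (r / (1 + n%:R))%:C%C => /=; first by rewrite ltcR.
move=> x; rewrite /ball_ /= => xz.
rewrite (_ : x = z + (x - z)); last by rewrite addrC subrK.
apply: H; rewrite -ltcR; apply: le_lt_trans (nrm_le_norm _) _.
rewrite distrC; apply: (@le_lt_trans _ _ ((1 + n%:R) * `|z - x|)).
  by rewrite ler_wpM2r // lerDr.
rewrite -ltr_pdivlMl; last by rewrite ltr_pwDl.
move: xz; rewrite mulrC rmorphM fmorphV rmorphD rmorph1 rmorph_nat.
by [].
Qed.

Lemma hol_differentiable f z : hol_at f z ->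
  differentiable (f : VC -> C^o) (z : VC).
Proof.
move=> [l H].
have lc : continuous (linC l).
  move=> x; have FF : Filter (nbhs x) by exact: nbhs_filter.
  apply/cvgrPdist_le => e /complex_gt0P[r r0 ->].
  pose K := 1 + \sum_i normc (l i).
  have K0 : 0 < K by rewrite ltr_pwDl // sumr_ge0 // => i _; exact: normc_ge0.
  apply/near_nrm; exists (r / K); first by rewrite divr_gt0.
  move=> h; rewrite ltr_pdivlMr // => hr.
  rewrite -linearB /= opprD addNKr linearN normrN normcT lecR.
  apply: le_trans (normc_lin _ _) _; apply/ltW/(le_lt_trans _ hr).
  by rewrite mulrC ler_wpM2l ?nrm_ge0 // /K lerDr.
have lo : (f : VC -> C^o) \o shift (z : VC) = cst (f z : C^o) + (linC l : VC -> C^o) +o_ (0 : VC) (@id VC).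
  apply/eqaddoP => e /complex_gt0P[r r0 ->].
  apply/near_nrm.
  have q0 : 0 < r / (1 + n%:R) by rewrite divr_gt0 // ltr_pwDl.
  have [s s0 K] := H _ q0.
  exists s => // h /K; rewrite add0r => L.
  apply: (@le_trans _ _ (r / (1 + n%:R) * nrm h)%:C%C).
    rewrite [X in `|X| <= _](_ : _ = f (z + h) - f z - lin l h); last first.
      transitivity (f (h + z) - (f z + lin l h)); first by [].
      by rewrite (addrC h z) opprD addrA.
    by rewrite normcT lecR.
  rewrite rmorphM.
  apply: le_trans (ler_wpM2l _ (nrm_le_norm h)) _; first by rewrite ler0c ltW.
  rewrite mulrA; apply: ler_wpM2r => //.
  have -> : (n%:R : C) = (n%:R : R)%:C%C by rewrite rmorph_nat.
  rewrite -rmorphM lecR.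
  rewrite mulrAC ler_pdivrMr; last by rewrite ltr_pwDl.
  by rewrite ler_pM2l // lerDr.
apply/diff_locallyP; rewrite (diff_unique lc lo); split => //.
Qed.

Lemma differentiable_hol f z :
  differentiable (f : VC -> C^o) (z : VC) ->
  hol_at f z.
Proof.
pose f' : VC -> C^o := f; pose z' : VC := z.
rewrite -/f' -/z' => /diff_locallyP[_ /eqaddoP H].
exists (fun i => 'd f' z' (delta_mx 0 i)) => e e0.
have := H e%:C%C; rewrite ltcR => /(_ e0) /near_nrm[r r0 K].
exists r => // h hr; have := K h hr; rewrite add0r /= => L.
rewrite -lecR -normcT rmorphM; apply: le_trans _ (le_trans L _).
  rewrite le_eqVlt; apply/orP; left; apply/eqP; congr `|_|.
  transitivity (f (h + z) - (f z + 'd f' z' h)); last by [].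
  rewrite (addrC h z) opprD addrA; congr (_ - _ - _).
  rewrite /lin [in RHS](row_sum_delta h) linear_sum; apply: eq_bigr => i _.
  by rewrite linearZ /= mulrC.
by rewrite ler_wpM2l ?ler0c ?(ltW e0) // norm_le_nrm.
Qed.

End SeveralVariables.

(** * Locally uniform limits of holomorphic functions *)

Section Weierstrass.
Context {R : realType} {n : nat}.
Local Notation C := (R[i]).
Local Notation V := ('rV[R[i]]_n).
Implicit Types (f g : V -> C) (z v x u : V).

Definition diff_at f z (l : 'I_n -> C) := forall e, 0 < e -> exists2 r, 0 < r &
  forall h, nrm h < r -> normc (f (z + h) - f z - lin l h) <= e * nrm h.

Lemma slice_deriv f x v a l : diff_at f (x + a *: v) l -> forall e, 0 < e ->
  exists2 r, 0 < r & forall b, normc b < r ->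
  normc (f (x + (a + b) *: v) - f (x + a *: v) - lin l v * b) <= e * normc b.
Proof.
move=> H e e0; have q0 : 0 < 1 + nrm v by rewrite ltr_pwDl // nrm_ge0.
have [r r0 K] := H (e / (1 + nrm v)) (divr_gt0 e0 q0).
exists (r / (1 + nrm v)) => [|b]; first by rewrite divr_gt0.
rewrite ltr_pdivlMr // => br.
have vq : nrm v <= 1 + nrm v by rewrite lerDr.
have hr : nrm (b *: v) < r.
  by rewrite nrmZ; apply: le_lt_trans br; rewrite ler_wpM2l // normc_ge0.
have := K _ hr; rewrite -(addrA x) -scalerDl linZ (mulrC b) => /le_trans; apply.
rewrite nrmZ mulrAC -mulrA ler_pM2l // ler_pdivrMr //.
by rewrite ler_wpM2l // normc_ge0.
Qed.

Lemma slice_cdiff f x v a : hol_at f (x + a *: v) -> cdiff (fun c => f (x + c *: v)) a.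
Proof. by move=> [l H]; exists (lin l v) => e e0; exact: (slice_deriv H). Qed.

Lemma hol_at_bounded f z : hol_at f z -> exists2 r, 0 < r &
  forall h, nrm h < r -> normc (f (z + h)) <= normc (f z) + 1.
Proof.
move=> [l H]; have [r r0 K] := H 1 ltr01.
pose L := 1 + \sum_i normc (l i).
have L0 : 0 < L by rewrite ltr_pwDl // sumr_ge0 // => i _; exact: normc_ge0.
exists (Num.min r (1 / (1 + L))) => [|h]; first by rewrite lt_min r0 divr_gt0 // ltr_pwDl // ltW.
rewrite lt_min ltr_pdivlMr ?(addr_gt0 ltr01 L0) // => /andP[/K K1 h1].
rewrite (_ : f (z + h) = f z + ((f (z + h) - f z - lin l h) + lin l h)); last by ring.
apply: le_trans (normcD _ _) _; rewrite lerD2l.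
apply: le_trans (normcD _ _) _; have := normc_lin l h.
have h0 := nrm_ge0 h.
have LL : (\sum_i normc (l i)) * nrm h <= L * nrm h by rewrite ler_wpM2r // /L lerDr.
by move: K1 h1 LL; rewrite mulrDr (mulrC (nrm h) L) /L; move: (L * nrm h) (\sum_i _) => ? ?; lra.
Qed.

(* u small is a multiple a *: v of a vector of norm r / 2 with |a| <= 1/2,
   so the one-variable second order estimate applies to c |-> f (x + c *: v). *)
Lemma second_order_dir f x (M : R) v l : (forall c, normc c < 2 -> hol_at f (x + c *: v)) ->
  (forall c, normc c <= 1 -> normc (f (x + c *: v)) <= M) -> diff_at f x l ->
  lin l v = ucoef (fun c => f (x + c *: v)) 1 /\
  forall c, normc c <= 1 / 2 -> normc (f (x + c *: v) - f x - c * lin l v) <= 8 * M * normc c ^+ 2.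
Proof.
move=> hd hM dl.
have hd' c : normc c < 2 -> cdiff (fun c => f (x + c *: v)) c.
  by move=> /hd; exact: slice_cdiff.
have E : lin l v = ucoef (fun c => f (x + c *: v)) 1.
  apply: (ucoef1_deriv hd' hM) => e e0.
  rewrite -[x]addr0 -(scale0r v) in dl.
  have [r r0 K] := slice_deriv dl e0; exists r => // b /K.
  by rewrite add0r.
split=> // c c2; rewrite E.
by have := second_order hd' hM c2; rewrite scale0r addr0.
Qed.

Lemma diff_at_quadratic f x (K r : R) l : 0 < r ->
  (forall u, nrm u < r -> normc (f (x + u) - f x - lin l u) <= K * nrm u ^+ 2) ->
  diff_at f x l.
Proof.
move=> r0 H e e0.
have q0 : 0 < 1 + `|K| by rewrite ltr_pwDl.
exists (Num.min r (e / (1 + `|K|))) => [|u]; first by rewrite lt_min r0 divr_gt0.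
rewrite lt_min ltr_pdivlMr // => /andP[/H L ue].
apply: le_trans L _; rewrite expr2 mulrA ler_wpM2r ?nrm_ge0 //.
apply: le_trans (ltW ue); rewrite mulrC ler_wpM2l ?nrm_ge0 //.
by apply: le_trans (ler_norm _) _; rewrite lerDr.
Qed.

Lemma small_multiple (r : R) u : 0 < r -> nrm u < r / 4 -> exists v c,
  [/\ u = c *: v, nrm v <= r / 2, normc c <= 1 / 2 & normc c = nrm u * (2 / r)].
Proof.
move=> r0 ur; have [->|u0] := eqVneq u 0.
  by exists 0, 0; rewrite scale0r nrm0 normc0 mul0r; split=> //; lra.
have nu : 0 < nrm u.
  by rewrite lt_def nrm_ge0 andbT; apply: contra u0 => /eqP /nrm_eq0 ->.
have c0 : 0 < nrm u * (2 / r) by rewrite mulr_gt0 // divr_gt0.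
have cC : ((nrm u * (2 / r))%:C%C : C) != 0.
  by rewrite -normc_gt0 normcR normr_gt0 lt0r_neq0.
exists ((nrm u * (2 / r))%:C%C^-1 *: u), (nrm u * (2 / r))%:C%C.
rewrite scalerA mulfV // scale1r nrmZ normcV normcR gtr0_norm //; split => //.
  by rewrite le_eqVlt; apply/orP; left; apply/eqP; field; rewrite !lt0r_neq0.
by rewrite mulrA ler_pdivrMr //; lra.
Qed.

(** The differential of f is found from the first Cauchy coefficients of f on the complex lines
    through z, which make sense because f inherits continuity along lines. The quadratic error
    bounds of the approximants have a common constant, so they pass to f. *)
Lemma weierstrass f z (r : R) : 0 < r ->
  (forall e, 0 < e -> exists2 g, (forall h, nrm h < r -> hol_at g (z + h)) &
     (forall h, nrm h < r -> normc (g (z + h) - f (z + h)) <= e)) ->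
  hol_at f z.
Proof.
move=> r0 H.
have fc h : nrm h < r -> forall v, ccont (fun c => f (z + h + c *: v)) 0.
  move=> hr v e e0.
  have e3 : 0 < e / 3 by rewrite divr_gt0.
  have [g gh gf] := H _ e3.
  have gd : cdiff (fun c => g (z + h + c *: v)) 0.
    by apply: slice_cdiff; rewrite scale0r addr0; exact: gh.
  have [d d0 K] := cdiff_cont gd e3.
  have s0 : 0 < (r - nrm h) / (1 + nrm v).
    by rewrite divr_gt0 ?subr_gt0 // ltr_pwDl // nrm_ge0.
  exists (Num.min d ((r - nrm h) / (1 + nrm v))) => [|b]; first by rewrite lt_min d0.
  rewrite lt_min ltr_pdivlMr; last by rewrite ltr_pwDl // nrm_ge0.
  move=> /andP[/K]; rewrite !add0r !scale0r !addr0 => K1 bv.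
  have hb : nrm (h + b *: v) < r.
    apply: le_lt_trans (nrmD _ _) _; rewrite nrmZ.
    by have := normc_ge0 b; move: bv; rewrite mulrDr; lra.
  have A := gf _ hb; have B := gf _ hr; rewrite addrA in A.
  rewrite (_ : _ - _ = (g (z + h + b *: v) - g (z + h)) -
    (g (z + h + b *: v) - f (z + h + b *: v)) + (g (z + h) - f (z + h))); last by ring.
  apply: le_trans (normcD _ _) _; have := normcB (g (z + h + b *: v) - g (z + h))
    (g (z + h + b *: v) - f (z + h + b *: v)).
  by move: K1 A B; move: (normc _) (normc _) (normc _) (normc _) => *; lra.
have fcc v : nrm v < r -> circ_cont (fun c => f (z + c *: v)).
  move=> vr; apply: circ_cont_ccont => w w1 e e0.
  have wv : nrm (w *: v) < r by rewrite nrmZ w1 mul1r.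
  have [d d0 K] := fc _ wv v e e0; exists d => // h /K.
  by rewrite add0r scale0r addr0 -addrA -scalerDl.
have [g0 g0h g0f] := H 1 ltr01.
have [s1 s10 B1] : exists2 s, 0 < s & forall h, nrm h < s ->
    normc (g0 (z + h)) <= normc (g0 z) + 1.
  by apply: hol_at_bounded; rewrite -[z]addr0; apply: g0h; rewrite nrm0.
(* A bound for every approximant g with tolerance e <= 1: |g| <= |g - f| + |g0 - f| + |g0| <= 1 + 1
   + (|g0 z| + 1), with g0 a fixed approximant of tolerance 1. *)
pose M := normc (g0 z) + 3.
pose s := Num.min s1 r.
have s0 : 0 < s by rewrite lt_min s10.
have sr : s <= r by rewrite ge_min lexx orbT.
have ss1 : s <= s1 by rewrite ge_min lexx.
pose L v := ucoef (fun c => f (z + c *: v)) 1.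
(* an admissible approximation has differential at z close to L *)
have app e : 0 < e -> e <= 1 -> exists l, exists2 g, diff_at g z l &
   (forall h, nrm h < r -> normc (g (z + h) - f (z + h)) <= e) /\
   (forall v, nrm v <= s / 2 -> normc (lin l v - L v) <= 2 * e /\
     forall c, normc c <= 1 / 2 -> normc (g (z + c *: v) - g z - c * lin l v) <= 8 * M * normc c ^+ 2).
  move=> e0 e1; have [g gh gf] := H e e0.
  have [l dl] : exists l, diff_at g z l.
    by have := gh 0; rewrite nrm0 addr0 => /(_ r0).
  exists l; exists g => //; split => // v vs.
  have vr c : normc c < 2 -> nrm (c *: v) < r.
    move=> c2; rewrite nrmZ; apply: lt_le_trans sr.
    have := nrm_ge0 v; have := normc_ge0 c => ? ?.
    have : normc c * nrm v <= normc c * (s / 2) by rewrite ler_wpM2l.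
    have : normc c * (s / 2) < 2 * (s / 2) by rewrite ltr_pM2r // divr_gt0.
    by lra.
  have vs1 c : normc c <= 1 -> nrm (c *: v) < s1.
    move=> c1; rewrite nrmZ; apply: lt_le_trans ss1.
    have : normc c * nrm v <= 1 * nrm v by rewrite ler_wpM2r // nrm_ge0.
    by lra.
  have [|c c1|E Q] := @second_order_dir g z M v l _ _ dl.
  - by move=> c /vr; exact: gh.
  - have cr : nrm (c *: v) < r by apply: vr; apply: le_lt_trans c1 _; rewrite ltr1n.
    have b1 := gf _ cr; have b2 := g0f _ cr; have b3 := B1 _ (vs1 _ c1).
    rewrite (_ : g (z + c *: v) = (g (z + c *: v) - f (z + c *: v)) -
      (g0 (z + c *: v) - f (z + c *: v)) + g0 (z + c *: v)); last by ring.
    apply: le_trans (normcD _ _) _; rewrite /M.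
    have := normcB (g (z + c *: v) - f (z + c *: v)) (g0 (z + c *: v) - f (z + c *: v)).
    by move: b1 b2 b3 e1; clear; lra.
  split=> //; rewrite E /L -ucoefB; last first.
  - by apply: fcc; have := vr 1; rewrite normc1 scale1r ltr1n; apply.
  - apply: circ_cont_cdiff => w w1; apply: slice_cdiff; apply: gh; apply: vr.
    by rewrite w1 ltr1n.
  apply: normc_ucoef => [|w w1].
    apply: (eq_circ_cont _ (circ_contD _ (circ_contZ (-1) _))).
    - by move=> w _; rewrite mulN1r.
    - apply: circ_cont_cdiff => w w1; apply: slice_cdiff; apply: gh; apply: vr.
      by rewrite w1 ltr1n.
    - by apply: fcc; have := vr 1; rewrite normc1 scale1r ltr1n; apply.
  by apply: gf; apply: vr; rewrite w1 ltr1n.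
(* L is the restriction of a linear form, with components L (s/2 e_i) / (s/2) *)
have s2 : 0 < s / 2 by rewrite divr_gt0.
have sC : ((s / 2)%:C%C : C) != 0.
  by rewrite -normc_gt0 normcR normr_gt0 lt0r_neq0.
pose l i := L ((s / 2)%:C%C *: delta_mx 0 i) / (s / 2)%:C%C.
have ei (i : 'I_n) : nrm ((s / 2)%:C%C *: (delta_mx 0 i : V)) <= s / 2.
  rewrite nrmZ normcR gtr0_norm ?divr_gt0 // /nrm (bigD1 i) //= big1 => [|j ji].
    by rewrite mxE !eqxx normc1 addr0 mulr1.
  by rewrite mxE eqxx (negbTE ji) normc0.
have li e l' : 0 < e -> (forall v, nrm v <= s / 2 -> normc (lin l' v - L v) <= 2 * e) ->
   forall i, normc (l' i - l i) <= e * (4 / s).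
  move=> e0 Q i; have := Q _ (ei i).
  rewrite linZ (_ : lin l' _ = l' i); last first.
    rewrite /lin (bigD1 i) //= big1 => [|j ji].
      by rewrite mxE !eqxx mulr1 addr0.
    by rewrite mxE eqxx (negbTE ji) mulr0.
  rewrite (_ : _ - _ = (s / 2)%:C%C * (l' i - l i)); last first.
    by rewrite mulrBr /l mulrCA mulfV // mulr1.
  rewrite normcM normcR gtr0_norm // => q.
  have s4 : 0 < 4 / s by rewrite divr_gt0.
  rewrite -(ler_pM2l (divr_gt0 s0 (ltr0n R 2) : 0 < s / 2)).
  apply: le_trans q _; rewrite le_eqVlt; apply/orP; left; apply/eqP; field.
  by rewrite lt0r_neq0.
(* Writing u = c *: v with |c| = nrm u * (2 / s) turns the bound 8 * M * |c|^2 into the stated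
   multiple of nrm u ^ 2. *)
exists l; apply: (@diff_at_quadratic f z (8 * M * (2 / s) ^+ 2) (s / 4)); first by rewrite divr_gt0.
move=> u us; have [v [c [uE vs c2 cE]]] := small_multiple s0 us.
apply/ler_addgt0Pr => e e0.
have nn0 : 0 <= n%:R * (4 / s) :> R by rewrite mulr_ge0 // divr_ge0 // ltW.
(* Here u is fixed before the approximant is chosen, so the tolerance e' may depend on u: 2 e' pays
   for g - f at two points, the rest for the difference of the linear forms. *)
pose K := 2 + n%:R * (4 / s) * nrm u.
have K0 : 0 < K by rewrite ltr_pwDl // mulr_ge0 // nrm_ge0.
pose e' := Num.min 1 (e / K).
have e'0 : 0 < e' by rewrite lt_min ltr01 divr_gt0.
have e'1 : e' <= 1 by rewrite ge_min lexx.
have e'K : e' * K <= e by rewrite -ler_pdivlMr // ge_min lexx orbT.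
have [l' [g dg [gf gq]]] := app e' e'0 e'1.
have [_ Q] := gq v vs; have {Q} := Q c c2.
have lu : normc (lin l' u - lin l u) <= e' * (n%:R * (4 / s) * nrm u).
  rewrite (_ : lin l' u - lin l u = lin (fun i => l' i - l i) u); last first.
    by rewrite /lin -sumrB; apply: eq_bigr => i _; rewrite mulrBl.
  apply: le_trans (normc_lin _ _) _; rewrite (mulrA e') ler_wpM2r ?nrm_ge0 //.
  have -> : e' * (n%:R * (4 / s)) = \sum_(i < n) e' * (4 / s).
    by rewrite sumr_const card_ord -mulr_natl; ring.
  by apply: ler_sum => i _; apply: li => // v' /gq[].
have ur : nrm u < r.
  by apply: lt_le_trans sr; have := s0; move: us; lra.
rewrite -linZ -uE => Q.
rewrite cE in Q.
have A := gf u ur; have := gf 0; rewrite nrm0 addr0 => /(_ r0) B.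
rewrite (_ : _ - _ = (g (z + u) - g z - lin l' u) - (g (z + u) - f (z + u)) +
   (g z - f z) + (lin l' u - lin l u)); last by ring.
apply: le_trans (normcD _ _) _.
have := normcD ((g (z + u) - g z - lin l' u) - (g (z + u) - f (z + u))) (g z - f z).
have := normcB (g (z + u) - g z - lin l' u) (g (z + u) - f (z + u)).
have -> : 8 * M * (2 / s) ^+ 2 * nrm u ^+ 2 = 8 * M * (nrm u * (2 / s)) ^+ 2.
  by rewrite exprMn; ring.
move: e'K; rewrite /K mulrDr.
move: (8 * M * _) Q A B lu; do 6 move: (normc _).
by move: (e' * (_ * _)) => *; lra.
Qed.

End Weierstrass.

(** * Cauchy coefficients of a derivative *)

Section CircleFTC.
Context {R : realType}.
Local Notation C := (R[i]).
Implicit Types (g : C -> C).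

Definition cder g (z d : C) := forall e, 0 < e -> exists2 r, 0 < r &
  forall x, normc x < r -> normc (g (z + x) - g z - d * x) <= e * normc x.

Lemma derive_cder g z : derivable (g : C^o -> C^o) z 1 ->
  cder g z ('D_1 (g : C^o -> C^o) z).
Proof.
move=> df e e0; move/cvgrPdist_le : df => /(_ e%:C%C).
rewrite ltcR => /(_ e0); rewrite near_withinE => /nbhs_ballP[r' /= /complex_gt0P[r r0 ->] H].
exists r => // h hr.
have [->|h0] := eqVneq h 0; first by rewrite addr0 subrr mulr0 subrr !normc0 mulr0.
have := H h; rewrite /ball /= sub0r normrN normcT ltcR => /(_ hr h0).
rewrite normcT lecR /GRing.scale /= mulr1 (addrC h z) => L.
rewrite (_ : _ - _ = - ('D_1 (g : C^o -> C^o) z - h^-1 * (g (z + h) - g z)) * h); last by field.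
by rewrite normcM normcN ler_wpM2r // normc_ge0.
Qed.

Lemma cder_unique g z d d' : cder g z d -> cder g z d' -> d = d'.
Proof.
move=> D D'; suff main e : 0 < e -> normc (d - d') <= e.
  apply/eqP; rewrite -subr_eq0 -normc_eq0; apply/eqP/le_anti; rewrite normc_ge0 andbT.
  by apply/ler_addgt0Pr => e e0; rewrite add0r main.
move=> e0; have e2 : 0 < e / 2 by rewrite divr_gt0.
have [r r0 H] := D _ e2; have [s s0 K] := D' _ e2.
pose t := Num.min r s / 2.
have m0 : 0 < Num.min r s by rewrite lt_min r0.
have t0 : 0 < t by rewrite divr_gt0.
have tm : t < Num.min r s by rewrite /t; lra.
have tC : normc (t%:C%C : C) = t by rewrite normcR gtr0_norm.
have tr : normc (t%:C%C : C) < r by rewrite tC (lt_le_trans tm) // ge_min lexx.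
have ts : normc (t%:C%C : C) < s by rewrite tC (lt_le_trans tm) // ge_min lexx orbT.
rewrite -(ler_pM2r t0) -{1}tC -normcM.
rewrite (_ : _ * _ = (g (z + t%:C%C) - g z - d' * t%:C%C) - (g (z + t%:C%C) - g z - d * t%:C%C)); last by ring.
apply: le_trans (normcB _ _) _.
rewrite (_ : e * t = e / 2 * t + e / 2 * t); last by field.
by apply: lerD; rewrite -[in leRHS]tC; [exact: K|exact: H].
Qed.

Lemma cderP g (z d : C) : cder g z d <-> is_derive (z : C^o) (1 : C^o) (g : C^o -> C^o) d.
Proof.
split=> [D|[df <-]]; last exact: derive_cder.
have dg : derivable (g : C^o -> C^o) z 1 by apply/cdiffP; exists d.
by split=> //; apply: cder_unique (derive_cder dg) D.
Qed.

Lemma cderM g (h : C -> C) z d d' : cder g z d -> cder h z d' ->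
  cder (fun x => g x * h x) z (g z * d' + h z * d).
Proof.
move=> /cderP dg /cderP dh; have H := @is_deriveM C C^o g h z 1 d d' dg dh.
exact: (cderP (fun x => g x * h x) z _).2 H.
Qed.

Lemma cderV (z : C) : z != 0 -> cder (fun x => x^-1) z (- z^-1 ^+ 2).
Proof.
move=> z0 e e0.
have nz : 0 < normc z by rewrite normc_gt0.
have q0 : 0 < e * normc z ^+ 3 / 2 by rewrite divr_gt0 // mulr_gt0 // exprn_gt0.
exists (Num.min (normc z / 2) (e * normc z ^+ 3 / 2)) => [|h].
  by rewrite lt_min q0 divr_gt0.
rewrite lt_min => /andP[h1 h2].
have hz : normc z / 2 <= normc (z + h).
  have := normcB (z + h) h; rewrite addrK; lra.
have zh : z + h != 0.
  by rewrite -normc_gt0; apply: lt_le_trans hz; rewrite divr_gt0.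
rewrite (_ : _ - _ = h ^+ 2 * (z^-1 ^+ 2 * (z + h)^-1)); last first.
  by field; rewrite zh z0.
rewrite normcM normcX expr2 mulrAC ler_wpM2r ?normc_ge0 //.
rewrite normcM normcX !normcV.
have zh' : (normc (z + h))^-1 <= 2 / normc z.
  by rewrite -[leRHS]invf_div lef_pV2 // posrE ?divr_gt0 // (lt_le_trans _ hz) ?divr_gt0.
apply: (@le_trans _ _ (e * normc z ^+ 3 / 2 * ((normc z)^-1 ^+ 2 * (2 / normc z)))); last first.
  by rewrite le_eqVlt; apply/orP; left; apply/eqP; field; rewrite lt0r_neq0.
apply: ler_pM; rewrite ?normc_ge0 //; last 1 first.
- by rewrite ler_wpM2l // exprn_ge0 // invr_ge0 normc_ge0.
- by rewrite mulr_ge0 ?exprn_ge0 ?invr_ge0 ?normc_ge0.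
- exact: ltW.
Qed.

Lemma cder_VX (z : C) k : z != 0 ->
  cder (fun x => x^-1 ^+ k) z (- (k%:R * z^-1 ^+ k.+1)).
Proof.
move=> z0; elim: k => [|k IH].
  move=> e e0; exists 1 => // x _.
  by rewrite !expr0 subrr mul0r oppr0 mul0r subr0 normc0 mulr_ge0 ?(ltW e0) ?normc_ge0.
have := cderM (cderV z0) IH.
rewrite (_ : (fun x => _) = fun x => x^-1 ^+ k.+1); last first.
  by apply/funext => x; rewrite exprS.
by congr cder; rewrite -natr1 !exprS; ring.
Qed.

Lemma eps_is_derive (f : R -> R) (x d : R) :
  (forall e, 0 < e -> exists2 r, 0 < r & forall h, `|h| < r ->
    `|f (x + h) - f x - d * h| <= e * `|h|) -> is_derive x (1 : R) f d.
Proof.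
move=> D.
have H : (fun h : R => h^-1 *: (f (h *: (1 : R) + x) - f x)) @ (0 : R)^' --> d.
  apply/cvgrPdist_le => e e0.
  have [s s0 H] := D e e0.
  rewrite near_withinE; apply/nbhs_ballP; exists s => //=.
  move=> t; rewrite /ball /= sub0r normrN => ts t0.
  rewrite /GRing.scale /= mulr1 (addrC t x).
  rewrite (_ : _ - _ = - (t^-1 * (f (x + t) - f x - d * t))); last by field.
  rewrite normrN normrM normfV ler_pdivrMl ?normr_gt0 // [leRHS]mulrC.
  exact: H.
by split; [apply/cvg_ex; exists d|apply: cvg_lim].
Qed.

(** The function -i g(e^(it)) is a primitive of e^(it) g'(e^(it)) and takes the same value at 0 and
    at 2 pi. *)
Lemma cavg_cder g d : (forall w, normc w = 1 -> cder g w (d w)) -> circ_cont d ->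
  cavg (fun w => w * d w) = 0.
Proof.
move=> gd dc.
have t0 := @tpi_gt0 R.
pose F t := - ('i%C : C) * g (cis t).
have FD t e : 0 < e -> exists2 r, 0 < r & forall h, `|h| < r ->
   normc (F (t + h) - F t - (cis t * d (cis t)) * h%:C%C) <= e * `|h|.
  move=> e0.
  have ni : normc (- ('i%C : C)) = 1.
    by rewrite normcN /normc /= expr0n expr1n add0r sqrtr1.
  pose D := 1 + normc (d (cis t)).
  have D0 : 0 < D by rewrite ltr_pwDl // normc_ge0.
  have e4 : 0 < e / 4 by rewrite divr_gt0.
  have [r1 r10 H1] := gd _ (normc_cis t) _ e4.
  have e2 : 0 < Num.min 1 (e / (2 * D)) by rewrite lt_min ltr01 divr_gt0 // mulr_gt0.
  have [r2 r20 H2] := cexp_small e2.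
  exists (Num.min r2 (r1 / 2)) => [|h]; first by rewrite lt_min r20 divr_gt0.
  rewrite lt_min => /andP[h1 h2].
  have := H2 0 h; rewrite normr0 add0r => /(_ r20 h1).
  rewrite {1}/cexp expR0 mul1r => K.
  have hC : normc (0 +i* h)%C <= `|h|.
    by apply: le_trans (normc_le_ReIm _) _; rewrite /= normr0 add0r.
  pose x := cis t * (cis h - 1).
  have nx : normc (cis h - 1) <= 2 * `|h|.
    rewrite (_ : cis h - 1 = (cis h - 1 - (0 +i* h)%C) + (0 +i* h)%C); last by ring.
    apply: le_trans (normcD _ _) _.
    have : Num.min 1 (e / (2 * D)) * `|h| <= `|h| by rewrite ler_piMl // ge_min lexx.
    by move: K; move: (normc _) => a; lra.
  have nx' : normc x <= 2 * `|h| by rewrite normcM normc_cis mul1r.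
  have xr : normc x < r1.
    by apply: le_lt_trans nx' _; move: h2; lra.
  have L := H1 _ xr.
  rewrite /F cisD (_ : cis t * cis h = cis t + x); last by rewrite /x; ring.
  have -> : h%:C%C = - ('i%C : C) * (0 +i* h)%C by simpc.
  rewrite (_ : _ - _ - _ = - ('i%C : C) * ((g (cis t + x) - g (cis t) - d (cis t) * x)
     + cis t * d (cis t) * (cis h - 1 - (0 +i* h)%C))); last by rewrite /x; ring.
  rewrite normcM ni mul1r; apply: le_trans (normcD _ _) _.
  rewrite (_ : e * `|h| = e / 4 * (2 * `|h|) + e / 2 * `|h|); last by field.
  apply: lerD; first by apply: le_trans L _; rewrite ler_pM2l.
  rewrite !normcM normc_cis mul1r.
  apply: le_trans (ler_wpM2l (normc_ge0 _) K) _.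
  rewrite mulrA ler_wpM2r //.
  apply: (@le_trans _ _ (D * (e / (2 * D)))).
    by apply: ler_pM; rewrite ?normc_ge0 ?(ltW e2) // ?ge_min ?lexx ?orbT // /D lerDr.
  by rewrite le_eqVlt; apply/orP; left; apply/eqP; field; rewrite lt0r_neq0.
have wd : circ_cont (fun w => w * d w).
  by apply: circ_contM => //; apply: circ_cont_cdiff => w _; exact: cdiff_id.
have ftc (u : R -> R) (U : R -> R) : {within `[0, tpi], continuous u} ->
   (forall t, is_derive t (1 : R) U (u t)) -> U 0 = U tpi -> eint 0 tpi u = 0.
  move=> uc dU UU; rewrite /eint /Rintegral.
  have cU : continuous U.
    by move=> t; apply/differentiable_continuous/derivable1_diffP; have [] := dU t.
  rewrite (@continuous_FTC2 _ u U) //.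
  - by rewrite UU subee.
  - split=> [t _||]; first by have [] := dU t.
    + by apply: cvg_at_right_filter; exact: cU.
    + by apply: cvg_at_left_filter; exact: cU.
  - by move=> t _; rewrite derive1E; have [] := dU t.
have FF : F 0 = F tpi by rewrite /F /tpi cis2pi cis0.
have E1 : eint 0 tpi (fun t => complex.Re (cis t * d (cis t))) = 0.
  apply: (ftc _ (fun t => complex.Re (F t)) wd.1); last by rewrite FF.
  move=> t; apply: eps_is_derive => e /(FD t)[r r0 H]; exists r => // h /H.
  apply: le_trans; apply: le_trans (normc_Re _).
  by rewrite !(ReD, ReN, ReM _ h%:C%C) /= mulr0 subr0.
have E2 : eint 0 tpi (fun t => complex.Im (cis t * d (cis t))) = 0.
  apply: (ftc _ (fun t => complex.Im (F t)) wd.2); last by rewrite FF.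
  move=> t; apply: eps_is_derive => e /(FD t)[r r0 H]; exists r => // h /H.
  apply: le_trans; apply: le_trans (normc_Im _).
  by rewrite !(ImD, ImN, ImM _ h%:C%C) /= mulr0 add0r.
rewrite /cavg E1 E2.
by rewrite (_ : Complex 0 0 = 0) // mulr0.
Qed.

(** Integration by parts on the circle: [cavg_cder] applied to h(w) w^-(k+1). *)
Lemma ucoef_deriv (h : C -> C) (h' : C -> C) k : (forall w, normc w = 1 -> cder h w (h' w)) ->
  circ_cont h -> circ_cont h' -> k.+1%:R * ucoef h k.+1 = ucoef h' k.
Proof.
move=> hd hc hc'; have c1 := @circ_cont_Vexp R k.+1; have c0 := @circ_cont_Vexp R k.
have ci : circ_cont (fun w : C => w^-1 ^+ k.+2) by exact: circ_cont_Vexp.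
have := @cavg_cder (fun w => h w * w^-1 ^+ k.+1)
  (fun w => h w * (- (k.+1%:R * w^-1 ^+ k.+2)) + w^-1 ^+ k.+1 * h' w).
have w0 (w : C) : normc w = 1 -> w != 0 by move=> w1; rewrite -normc_eq0 w1 oner_eq0.
move=> H; have {}H := H _ _.
rewrite (@eq_cavg _ _ (fun w => h' w * w^-1 ^+ k - k.+1%:R * (h w * w^-1 ^+ k.+1))) in H; last first.
  move=> w w1; rewrite !(exprS w^-1).
  by field; exact: w0.
rewrite cavgB in H; [|exact: circ_contM|by apply: circ_contZ; exact: circ_contM].
rewrite cavgZ in H; last exact: circ_contM.
apply/esym/eqP; rewrite -subr_eq0; apply/eqP; apply: H.
  by move=> w w1; apply: cderM; [exact: hd|apply: cder_VX; exact: w0].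
apply: circ_contD; apply: circ_contM => //.
apply: (eq_circ_cont _ (circ_contZ (- k.+1%:R) ci)) => w _.
by rewrite mulNr.
Qed.

End CircleFTC.

(** * Calculus on the ball and homogeneous components *)

Section Ball.
Context {R : realType} {n : nat}.
Local Notation C := (R[i]).
Local Notation V := ('rV[R[i]]_n).
Local Notation VC := ('rV[(C : numFieldType)]_n).
Implicit Types (f g : V -> C) (z v x u : V).

Lemma circ_cont_big (I : Type) (s : seq I) (F : I -> C -> C) : (forall i, circ_cont (F i)) ->
  circ_cont (fun w => \sum_(i <- s) F i w).
Proof.
move=> cF; elim: s => [|i s IH].
  by apply: eq_circ_cont (circ_cont_cst 0) => w _; rewrite big_nil.
by apply: (eq_circ_cont _ (circ_contD (cF i) IH)) => w _; rewrite big_cons.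
Qed.

Lemma cavg_big (I : Type) (s : seq I) (F : I -> C -> C) : (forall i, circ_cont (F i)) ->
  cavg (fun w => \sum_(i <- s) F i w) = \sum_(i <- s) cavg (F i).
Proof.
move=> cF; elim: s => [|i s IH].
  by rewrite big_nil -[RHS](cavg_cst 0); apply: eq_cavg => w _; rewrite big_nil.
rewrite big_cons -IH -cavgD //; last exact: circ_cont_big.
by apply: eq_cavg => w _; rewrite big_cons.
Qed.

Definition hol_ball f := forall z, uball z -> hol_at f z.

Lemma normsq_ge0 z : 0 <= normsq z.
Proof. by apply: sumr_ge0 => i _; rewrite sqr_ge0. Qed.

Lemma normc_le_normsq z i : normc (z 0 i) ^+ 2 <= normsq z.
Proof. by rewrite /normsq (bigD1 i) //= lerDl sumr_ge0 // => j _; rewrite sqr_ge0. Qed.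

Lemma normsqZ (c : C) z : normsq (c *: z) = normc c ^+ 2 * normsq z.
Proof.
by rewrite /normsq mulr_sumr; apply: eq_bigr => i _; rewrite mxE normcM exprMn.
Qed.

Lemma uballE z : uball z = (normsq z < 1) :> Prop.
Proof. by []. Qed.

Lemma normc_coord_lt1 z i : uball z -> normc (z 0 i) < 1.
Proof.
rewrite uballE => z1; rewrite -(@ltr_pXn2r _ 2) ?nnegrE ?normc_ge0 //.
by rewrite expr1n; apply: le_lt_trans z1; exact: normc_le_normsq.
Qed.

Lemma uball_open z : uball z -> exists2 r, 0 < r & forall h, nrm h < r -> uball (z + h).
Proof.
move=> zb; pose d := (1 - normsq z) / 3.
have d0 : 0 < d by rewrite /d; move: zb; rewrite uballE; lra.
exists (Num.min 1 d) => [|h]; first by rewrite lt_min ltr01.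
rewrite lt_min => /andP[h1 hd]; rewrite uballE.
(* In each coordinate, (a + b)^2 <= a^2 + 3 b for a and b in [0, 1]. *)
have : normsq (z + h) <= normsq z + 3 * nrm h.
  rewrite /normsq /nrm mulr_sumr -big_split; apply: ler_sum => i _ /=.
  rewrite mxE; have a1 := ltW (normc_coord_lt1 i zb); have a0 := normc_ge0 (z 0 i).
  have b0 := normc_ge0 (h 0 i).
  have b1 : normc (h 0 i) <= 1 by apply/ltW/(le_lt_trans _ h1); exact: normc_le_nrm.
  apply: (@le_trans _ _ ((normc (z 0 i) + normc (h 0 i)) ^+ 2)).
    by rewrite ler_pXn2r ?nnegrE ?normc_ge0 ?addr_ge0 ?normc_ge0 // normcD.
  move: a1 a0 b0 b1; move: (normc (z 0 i)) (normc (h 0 i)) => a b a1 a0 b0 b1.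
  rewrite sqrrD -addrA lerD2l mulr2n expr2.
  have : a * b <= 1 * b by rewrite ler_wpM2r.
  have : b * b <= 1 * b by rewrite ler_wpM2r.
  by lra.
by move: hd; rewrite /d; lra.
Qed.

Lemma uball_scale z : uball z -> exists2 rho : R, 1 < rho &
  forall c : C, normc c < rho -> uball (c *: z).
Proof.
rewrite uballE => z1; have z0 := normsq_ge0 z.
have q0 : 0 < 1 + normsq z by rewrite ltr_pwDl.
(* With s = normsq z, the requirement rho^2 s < 1 reads 4 s < (1 + s)^2, that is (1 - s)^2 > 0. *)
exists (2 / (1 + normsq z)) => [|c cr].
  by rewrite ltr_pdivlMr // mul1r -[2]/(1 + 1) ltrD2l.
rewrite uballE normsqZ.
have [->|zn0] := eqVneq (normsq z) 0; first by rewrite mulr0.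
have zp : 0 < normsq z by rewrite lt_def zn0.
apply: (@lt_trans _ _ ((2 / (1 + normsq z)) ^+ 2 * normsq z)).
  by rewrite ltr_pM2r // ltr_pXn2r // nnegrE ?normc_ge0 // divr_ge0 // ltW.
rewrite expr_div_n mulrAC ltr_pdivrMr ?exprn_gt0 //.
have : 0 < (1 - normsq z) ^+ 2 by rewrite exprn_gt0 // subr_gt0.
by rewrite !expr2; lra.
Qed.

Lemma uball_shrink (c : C) z : normc c <= 1 -> uball z -> uball (c *: z).
Proof.
rewrite !uballE normsqZ => c1; apply: le_lt_trans.
by rewrite ler_piMl ?normsq_ge0 // exprn_ile1 ?normc_ge0.
Qed.

Lemma hol_at_shift f a z : hol_at f (z + a) -> hol_at (fun x => f (x + a)) z.
Proof.
move=> [l H]; exists l => e /H[r r0 K]; exists r => // h /K.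
by rewrite (addrAC z h a).
Qed.

Lemma hol_at_cst (c : C) z : hol_at (fun=> c) z.
Proof.
exists (fun=> 0) => e e0; exists 1 => // h _.
rewrite /lin big1 => [|i _]; last by rewrite mul0r.
by rewrite subrr subr0 normc0 mulr_ge0 ?nrm_ge0 // ltW.
Qed.

Lemma hol_at_coord i z : hol_at (fun x => x 0 i) z.
Proof.
exists (fun j => (j == i)%:R) => e e0; exists 1 => // h _.
rewrite /lin (bigD1 i) //= big1 => [|j ji]; last by rewrite (negbTE ji) mul0r.
rewrite eqxx mul1r addr0 mxE (_ : _ - _ - _ = 0); last by ring.
rewrite normc0.
by rewrite mulr_ge0 ?nrm_ge0 // ltW.
Qed.

Lemma hol_atM f g z : hol_at f z -> hol_at g z -> hol_at (fun x => f x * g x) z.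
Proof.
move=> /hol_differentiable df /hol_differentiable dg; apply: differentiable_hol.
exact: (@differentiableM C VC f g z df dg).
Qed.

Lemma hol_atD f g z : hol_at f z -> hol_at g z -> hol_at (fun x => f x + g x) z.
Proof.
move=> [l H] [m K]; exists (fun i => l i + m i) => e e0.
have e2 : 0 < e / 2 by rewrite divr_gt0.
have [r r0 H'] := H _ e2; have [s s0 K'] := K _ e2.
exists (Num.min r s) => [|h]; first by rewrite lt_min r0.
rewrite lt_min => /andP[/H' A /K' B].
rewrite (_ : _ - _ = (f (z + h) - f z - lin l h) + (g (z + h) - g z - lin m h)); last first.
  have -> : lin (fun i => l i + m i) h = lin l h + lin m h.
    by rewrite /lin -big_split; apply: eq_bigr => i _; rewrite mulrDl.
  by ring.
apply: le_trans (normcD _ _) _.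
by rewrite (_ : e * _ = e / 2 * nrm h + e / 2 * nrm h); [exact: lerD|field].
Qed.

Lemma hol_atZ (c : C) f z : hol_at f z -> hol_at (fun x => c * f x) z.
Proof. by move=> H; apply: hol_atM => //; exact: hol_at_cst. Qed.

Lemma hol_atB f g z : hol_at f z -> hol_at g z -> hol_at (fun x => f x - g x) z.
Proof.
move=> hf hg; rewrite (_ : (fun x => _) = fun x => f x + (-1) * g x).
  by apply: hol_atD => //; exact: hol_atZ.
by apply/funext => x; rewrite mulN1r.
Qed.

Lemma eq_near_hol_at f g z (r : R) : 0 < r -> (forall h, nrm h < r -> f (z + h) = g (z + h)) ->
  hol_at f z -> hol_at g z.
Proof.
move=> r0 fg [l H]; exists l => e /H[s s0 K]; exists (Num.min r s) => [|h]; first by rewrite lt_min r0.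
have fz : f z = g z by have := fg 0; rewrite nrm0 addr0 => /(_ r0).
by rewrite lt_min -fz => /andP[hr hs]; rewrite -fg //; exact: K.
Qed.

Lemma hol_ball_monomial m : hol_ball (@monomial R n m).
Proof.
move=> z zb; have [r r0 H] := uball_open zb.
apply: (@eq_near_hol_at (fun x => \prod_(i < n) x 0 i ^+ m i) _ z r) => //.
  by move=> h /H; rewrite uballE /monomial => ->.
elim: (index_enum _) => [|i s IH].
  rewrite (_ : (fun x => _) = fun=> 1); first exact: hol_at_cst.
  by apply/funext => x; rewrite big_nil.
rewrite (_ : (fun x => _) = fun x => x 0 i ^+ m i * \prod_(j <- s) x 0 j ^+ m j).
  apply: hol_atM => //; elim: (m i) => [|k IHk].
    by rewrite (_ : (fun x => _) = fun=> 1); [exact: hol_at_cst|apply/funext => x].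
  rewrite (_ : (fun x => _) = fun x => x 0 i * x 0 i ^+ k).
    by apply: hol_atM => //; exact: hol_at_coord.
  by apply/funext => x; rewrite exprS.
by apply/funext => x; rewrite big_cons.
Qed.

Definition dif f z : 'I_n -> C := xget (fun=> 0) [set l | diff_at f z l].

Lemma difP f z : hol_at f z -> diff_at f z (dif f z).
Proof. by move=> [l H]; rewrite /dif; case: xgetP => [_ -> //|/(_ l)]. Qed.

Definition pd i f z : C := dif f z i.

(** Near z, the difference quotients of f with a fixed step t are holomorphic and, by the second
    order estimate, within t * K of the partial derivative, uniformly in the point; so [weierstrass]
    applies. *)
Lemma pd_hol i f : hol_ball f -> hol_ball (pd i f).
Proof.
move=> hf z zb.
have [r1 r10 H1] := uball_open zb.
have [r2 r20 H2] := hol_at_bounded (hf _ zb).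
pose r := Num.min r1 r2; pose M := normc (f z) + 1.
have r0 : 0 < r by rewrite lt_min r10.
have hb h : nrm h < r -> uball (z + h) by rewrite lt_min => /andP[/H1].
have hM h : nrm h < r -> normc (f (z + h)) <= M by rewrite lt_min => /andP[_ /H2].
have r4 : 0 < r / 4 by rewrite divr_gt0.
apply: (@weierstrass _ _ _ z (r / 4)) => // e e0.
pose K := 8 * M * (4 / r) ^+ 2.
have M0 : 0 <= M by rewrite addr_ge0 ?normc_ge0.
have K0 : 0 <= K by apply: mulr_ge0; [exact: mulr_ge0|exact: sqr_ge0].
pose t := Num.min (r / 8) (e / (1 + K)).
have q0 : 0 < 1 + K by rewrite ltr_pwDl.
have t0 : 0 < t by rewrite lt_min !divr_gt0.
have tC : normc (t%:C%C : C) = t by rewrite normcR gtr0_norm.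
have tn0 : (t%:C%C : C) != 0 by rewrite -normc_gt0 tC.
have tr : t <= r / 8 by rewrite ge_min lexx.
have te : t * K <= e.
  have : t <= e / (1 + K) by rewrite ge_min lexx orbT.
  by rewrite ler_pdivlMr // mulrDr mulr1; lra.
pose ei : V := delta_mx 0 i.
have nei : nrm ei = 1.
  rewrite /nrm (bigD1 i) //= big1 => [|j ji]; first by rewrite mxE !eqxx normc1 addr0.
  by rewrite mxE eqxx (negbTE ji) normc0.
exists (fun x => t%:C%C^-1 * (f (x + t%:C%C *: ei) - f x)) => h hr.
  apply: hol_atZ; apply: hol_atB; last by apply/hf/hb; lra.
  apply: hol_at_shift; apply: hf; rewrite -addrA; apply: hb.
  by apply: le_lt_trans (nrmD _ _) _; rewrite nrmZ tC nei mulr1; lra.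
have s0 : (4 / r)%:C%C != 0 :> C by rewrite -normc_gt0 normcR normr_gt0 lt0r_neq0 // divr_gt0.
(* The direction has length r / 4 so that the disc |c| < 2 required by [second_order_dir] stays in
   range: r / 4 + 2 * (r / 4) < r. *)
have dn c : normc c < 2 -> nrm (h + c *: ((r / 4)%:C%C *: ei)) < r.
  move=> c2; apply: le_lt_trans (nrmD _ _) _; rewrite !nrmZ normcR nei mulr1 gtr0_norm //.
  have : normc c * (r / 4) < 2 * (r / 4) by rewrite ltr_pM2r.
  by lra.
have zh : uball (z + h) by apply: hb; lra.
have [c /dn c2|c c1|_ Q] := @second_order_dir _ _ f (z + h) M ((r / 4)%:C%C *: ei) _ _ _ (difP (hf _ zh)).
- by apply: hf; rewrite -addrA; exact: hb.
- by rewrite -addrA; apply: hM; apply: dn; apply: le_lt_trans c1 _; rewrite ltr1n.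
have c0 : normc ((t * (4 / r))%:C%C : C) = t * (4 / r).
  by rewrite normcR gtr0_norm // mulr_gt0 // divr_gt0.
have := Q (t * (4 / r))%:C%C; rewrite c0 scalerA -rmorphM => /(_ _).
have -> : t * (4 / r) * (r / 4) = t by field; rewrite lt0r_neq0.
have -> : (t * (4 / r))%:C%C * lin (dif f (z + h)) ((r / 4)%:C%C *: ei) = t%:C%C * pd i f (z + h).
  rewrite linZ mulrA -rmorphM (_ : t * (4 / r) * (r / 4) = t); last by field; rewrite lt0r_neq0.
  congr (_ * _); rewrite /lin (bigD1 i) //= big1 => [|j ji].
    by rewrite mxE !eqxx mulr1 addr0.
  by rewrite mxE eqxx (negbTE ji) mulr0.
move=> B; rewrite -(ler_pM2l t0) -{1}tC -normcM mulrBr mulrA mulfV // mul1r.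
apply: le_trans (B _) _.
  by rewrite mulrA ler_pdivrMr //; lra.
rewrite exprMn (_ : _ * _ = t * (t * K)); last by rewrite /K; ring.
by rewrite ler_pM2l.
Qed.

(* The homogeneous component of degree k. *)
Definition hp f (k : nat) z : C := ucoef (fun c => f (c *: z)) k.

Lemma slice0_cdiff f z c : hol_ball f -> uball (c *: z) -> cdiff (fun c => f (c *: z)) c.
Proof.
move=> hf cb; have := @slice_cdiff _ _ f 0 z c; rewrite add0r => /(_ (hf _ cb)).
by rewrite (_ : (fun c => f (0 + c *: z)) = fun c => f (c *: z)) //; apply/funext => d; rewrite add0r.
Qed.

Lemma slice0_circ_cont f z : hol_ball f -> uball z -> circ_cont (fun c => f (c *: z)).
Proof.
move=> hf zb; apply: circ_cont_cdiff => w w1; apply: slice0_cdiff => //.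
by apply: uball_shrink; rewrite ?w1.
Qed.

Lemma hp0 f z : hol_ball f -> uball z -> hp f 0 z = f 0.
Proof.
move=> hf zb; have [rho r1 H] := uball_scale zb.
rewrite /hp (@ucoef0 _ _ rho r1) ?scale0r // => c /H; exact: slice0_cdiff.
Qed.

(** This is [ucoef_deriv] on the complex line through z: the derivative of c |-> f (c *: z) is the
    sum of the z_i times the partial derivatives at c *: z. *)
Lemma hp_succ f z k : hol_ball f -> uball z ->
  k.+1%:R * hp f k.+1 z = \sum_(i < n) z 0 i * hp (pd i f) k z.
Proof.
move=> hf zb.
have ws w : normc w = 1 -> uball (w *: z) by move=> w1; apply: uball_shrink; rewrite ?w1.
have cpd i : circ_cont (fun w => pd i f (w *: z)) by apply: slice0_circ_cont => //; exact: pd_hol.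
have cV := @circ_cont_Vexp R k.
rewrite /hp (@ucoef_deriv _ _ (fun w => lin (dif f (w *: z)) z)).
- have cs i : circ_cont (fun w => z 0 i * (pd i f (w *: z) * w^-1 ^+ k)).
    by apply: circ_contZ; exact: circ_contM.
  rewrite /ucoef.
  rewrite (@eq_cavg _ _ (fun w => \sum_(i < n) z 0 i * (pd i f (w *: z) * w^-1 ^+ k))); last first.
    by move=> w w1; rewrite /lin mulr_suml; apply: eq_bigr => i _; rewrite /pd; ring.
  rewrite cavg_big //.
  by apply: eq_bigr => i _; rewrite cavgZ //; exact: circ_contM.
- move=> w w1; have D := difP (hf _ (ws _ w1)) => e e0.
  have := @slice_deriv _ _ f 0 z w (dif f (w *: z)); rewrite add0r => /(_ D e e0)[r r0 K].
  by exists r => // h /K; rewrite !add0r.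
- exact: slice0_circ_cont.
- apply: (eq_circ_cont _ (circ_cont_big (index_enum _) (fun i => circ_contZ (z 0 i) (cpd i)))).
  by move=> w _; apply: eq_bigr => i _; rewrite mulrC.
Qed.

Lemma hp_expansion f z : hol_ball f -> uball z -> exists (K q : R), [/\ 0 <= q, q < 1 &
  forall J, normc (f z - \sum_(j < J.+1) hp f j z) <= K * q ^+ J].
Proof.
move=> hf zb; have [rho r1 H] := uball_scale zb.
have := @unit_expansion R (fun c => f (c *: z)) rho r1.
by rewrite scale1r; apply => c /H; exact: slice0_cdiff.
Qed.

Definition incr_index (m : mindex n) i : mindex n := [ffun j => (m j + (j == i))%N].

Lemma mdegS (m : mindex n) i : mdeg (incr_index m i) = (mdeg m).+1.
Proof.
rewrite /mdeg (eq_bigr (fun j => m j + (j == i))%N) => [|j _]; last by rewrite ffunE.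
rewrite big_split /= -addn1; congr (_ + _)%N.
by rewrite (bigD1 i) //= big1 ?eqxx // => j /negbTE ->.
Qed.

Lemma monomialS (m : mindex n) i z : uball z ->
  monomial (incr_index m i) z = z 0 i * monomial m z.
Proof.
rewrite uballE /monomial => ->.
rewrite (eq_bigr (fun j => z 0 j ^+ m j * z 0 j ^+ (j == i))) => [|j _].
  rewrite big_split /= mulrC; congr (_ * _).
  by rewrite (bigD1 i) //= big1 ?eqxx ?mulr1 // => j /negbTE ->.
by rewrite ffunE exprD.
Qed.

(** Induction on k for all f at once, since the step applies the hypothesis to the partial
    derivatives. The list may repeat an exponent; [hp_psum] merges the repetitions. *)
Lemma hp_polynomial k f : hol_ball f -> exists s : seq (C * mindex n),
  (forall p, p \in s -> mdeg p.2 = k) /\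
  forall z, uball z -> hp f k z = \sum_(p <- s) p.1 * monomial p.2 z.
Proof.
elim: k f => [|k IH] f hf.
  exists [:: (f 0, [ffun=> 0%N])]; split=> [p|z zb].
    rewrite inE => /eqP -> /=; rewrite /mdeg big1 // => i _; by rewrite ffunE.
  rewrite hp0 // big_seq1 /monomial; move: zb; rewrite uballE => -> /=.
  by rewrite big1 ?mulr1 // => i _; rewrite ffunE expr0.
have /choice[s Hs] : forall i, exists s : seq (C * mindex n),
  (forall p, p \in s -> mdeg p.2 = k) /\
  forall z, uball z -> hp (pd i f) k z = \sum_(p <- s) p.1 * monomial p.2 z.
  by move=> i; apply: IH; exact: pd_hol.
exists (flatten [seq [seq (k.+1%:R^-1 * p.1, incr_index p.2 i) | p <- s i] | i <- enum 'I_n]); split=> [p /flatten_mapP[i _ /mapP[q qs ->]]|z zb] /=.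
  by rewrite mdegS; congr _.+1; apply: (Hs i).1.
rewrite big_flatten big_map.
have k0 : k.+1%:R != 0 :> C by rewrite pnatr_eq0.
apply: (mulfI k0); rewrite hp_succ // mulr_sumr big_enum /=.
apply: eq_bigr => i _; rewrite big_map (Hs i).2 // !mulr_sumr.
apply: eq_bigr => p _ /=; rewrite monomialS //.
by rewrite !mulrA mulfV // mul1r; ring.
Qed.

End Ball.

(** * Lebesgue measure and moments *)

Section Scaling.
Local Open Scope ereal_scope.

(* The image of mu under phi is k * mu. *)
Definition scales d (T : measurableType d) (R : realType) (mu : set T -> \bar R)
    (phi : T -> T) (k : R) :=
  forall F : T -> \bar R, measurable_fun setT F -> (forall x, 0 <= F x) ->
    \int[mu]_x F (phi x) = k%:E * \int[mu]_x F x.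

Lemma scales_comp d (T : measurableType d) (R : realType)
    (mu : {measure set T -> \bar R}) (phi psi : T -> T) (k l : R) :
  measurable_fun setT phi -> scales mu phi k -> scales mu psi l ->
  scales mu (phi \o psi) (l * k)%R.
Proof.
move=> mphi sk sl F mF F0 /=.
rewrite (sl (F \o phi)); [|exact: measurableT_comp|by move=> x; exact: F0].
by rewrite sk // EFinM muleA.
Qed.

Section Line.
Context {R : realType}.
Let T : measurableType _ := measurableTypeR R.
Let leb : {measure set T -> \bar R} := @lebesgue_measure R.

Let lebE (i : interval R) : leb [set` i] = lebesgue_measure [set` i].
Proof. by []. Qed.

(** The image measure divided by k agrees with Lebesgue measure on half-open intervals, hence
    everywhere by uniqueness. *)
Lemma scales_line (phi : T -> T) (k : R) : (0 < k)%R -> measurable_fun setT phi ->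
  (forall a b : R, (a <= b)%R -> leb (phi @^-1` `]a, b]) = (k * (b - a))%:E) ->
  scales leb phi k.
Proof.
move=> k0 mphi H F mF F0.
have ki0 : (0 <= k^-1)%R by rewrite invr_ge0 ltW.
pose kn := NngNum ki0.
pose nu1 : {measure set T -> \bar R} :=
  measure_function_pushforward__canonical__measure_function_Measure leb mphi.
pose nu : {measure set T -> \bar R} := mscale kn nu1.
have E A : measurable A -> leb A = nu A.
  move=> mA; apply: lebesgue_measure_unique => // X [[a b] _ <-] /=.
  rewrite /nu /mscale /= /pushforward.
  have [ab|/ltW ba] := leP a b.
    rewrite H // -EFinM mulrA mulVf ?mul1r ?lt0r_neq0 // lebesgue_measure_itv /= lte_fin.
    case: ltP => // ba; rewrite (@le_anti _ _ a b) ?subrr // ab.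
    by rewrite ba.
  rewrite set_itv_ge ?preimage_set0 ?measure0 ?mule0 //.
  by rewrite bnd_simp -leNgt.
have -> : \int[leb]_x F x = \int[nu]_x F x.
  by apply: eq_measure_integral => A mA _; exact: E.
rewrite ge0_integral_mscale // /= ge0_integral_pushforward //.
by rewrite preimage_setT muleA -EFinM mulfV ?mul1e // lt0r_neq0.
Qed.

Lemma scales_shift (a : R) : scales leb (fun x : R => (x + a)%R) 1.
Proof.
apply: scales_line => //.
  by apply: measurable_funD => //; exact: measurable_cst.
move=> b c bc.
rewrite (_ : _ @^-1` _ = `]b - a, c - a]%classic)%R; last first.
  by apply/seteqP; split=> x /=; rewrite !in_itv /= ltrBlDr lerBrDr.
rewrite lebE lebesgue_measure_itv /= lte_fin mul1r ltrD2r.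
case: ltP => [_|cb]; first by rewrite -EFinD; congr (_%:E); ring.
by rewrite (@le_anti _ _ b c) ?subrr // bc.
Qed.

Lemma scales_mul (c : R) : (0 < c)%R -> scales leb (fun x : R => (c * x)%R) c^-1.
Proof.
move=> c0; apply: scales_line; first by rewrite invr_gt0.
  by apply: measurable_funM => //; exact: measurable_cst.
move=> a b ab.
rewrite (_ : _ @^-1` _ = `]a / c, b / c]%classic)%R; last first.
  by apply/seteqP; split=> x /=; rewrite !in_itv /= ltr_pdivrMr // ler_pdivlMr // (mulrC x).
rewrite lebE lebesgue_measure_itv /= lte_fin ltr_pM2r ?invr_gt0 //.
case: ltP => [_|cb]; first by rewrite -EFinD; congr (_%:E); ring.
by rewrite (@le_anti _ _ a b) ?subrr ?mulr0 // ab.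
Qed.

End Line.

(** * Plane Lebesgue measure under shears, rotations and dilations *)

Section Plane.
Context {R : realType}.
Let T : measurableType _ := measurableTypeR R.

Definition leb2 : {sigma_finite_measure set (plane R) -> \bar R} :=
  prod_measure (@lebesgue_measure R) (@lebesgue_measure R).

Lemma leb2_tonelli (F : plane R -> \bar R) : measurable_fun setT F -> (forall x, 0 <= F x) ->
  \int[leb2]_z F z = \int[lebesgue_measure]_x \int[lebesgue_measure]_y F (x, y).
Proof. by move=> mF F0; apply: fubini_tonelli1. Qed.

Lemma leb2_tonelli' (F : plane R -> \bar R) : measurable_fun setT F -> (forall x, 0 <= F x) ->
  \int[leb2]_z F z = \int[lebesgue_measure]_y \int[lebesgue_measure]_x F (x, y).
Proof. by move=> mF F0; rewrite leb2_tonelli // fubini_tonelli. Qed.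

Lemma measurable_shear1 (a : R) : measurable_fun setT (fun z : plane R => ((z.1 + a * z.2)%R, z.2) : plane R).
Proof.
apply/measurable_fun_pair => /=; last exact: measurable_snd.
apply: measurable_funD; first exact: measurable_fst.
by apply: measurable_funM; [exact: measurable_cst|exact: measurable_snd].
Qed.

Lemma measurable_shear2 (a : R) : measurable_fun setT (fun z : plane R => (z.1, (z.2 + a * z.1)%R) : plane R).
Proof.
apply/measurable_fun_pair => /=; first exact: measurable_fst.
apply: measurable_funD; first exact: measurable_snd.
by apply: measurable_funM; [exact: measurable_cst|exact: measurable_fst].
Qed.

(** By Tonelli, integrating first in the sheared coordinate, in which the shear is a translation. *)
Lemma scales_shear1 (a : R) : scales leb2 (fun z : plane R => ((z.1 + a * z.2)%R, z.2)) 1.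
Proof.
move=> F mF F0; rewrite mul1e !leb2_tonelli' //; last first.
  exact: (measurableT_comp mF (measurable_shear1 a)).
apply: eq_integral => y _ /=.
rewrite (@scales_shift R (a * y)%R (fun x => F (x, y))) ?mul1e //.
exact: measurableT_comp mF (measurable_pair2 y).
Qed.

Lemma scales_shear2 (a : R) : scales leb2 (fun z : plane R => (z.1, (z.2 + a * z.1)%R)) 1.
Proof.
move=> F mF F0; rewrite mul1e !leb2_tonelli //; last first.
  exact: (measurableT_comp mF (measurable_shear2 a)).
apply: eq_integral => x _ /=.
rewrite (@scales_shift R (a * x)%R (fun y => F (x, y))) ?mul1e //.
exact: measurableT_comp mF (measurable_pair1 x).
Qed.

Definition rot (c s : R) (z : plane R) : plane R :=
  ((c * z.1 - s * z.2)%R, (s * z.1 + c * z.2)%R).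

Lemma measurable_rot c s : measurable_fun setT (rot c s).
Proof.
apply/measurable_fun_pair => /=.
  by apply: measurable_funB; apply: measurable_funM;
    [exact: measurable_cst|exact: measurable_fst|exact: measurable_cst|exact: measurable_snd].
by apply: measurable_funD; apply: measurable_funM;
    [exact: measurable_cst|exact: measurable_fst|exact: measurable_cst|exact: measurable_snd].
Qed.

(* For c <> -1 the rotation is a product of three shears; the half turn is the
   square of a quarter turn. *)
Lemma scales_rot c s : (c ^+ 2 + s ^+ 2 = 1)%R -> scales leb2 (rot c s) 1.
Proof.
have main (c' s' : R) : (c' ^+ 2 + s' ^+ 2 = 1)%R -> (c' != -1)%R -> scales leb2 (rot c' s') 1.
  (* For c' and s' the cosine and sine of an angle, this is minus the tangent of half of it. *)
  move=> cs c1; pose a := (- s' / (1 + c'))%R.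
  have c10 : (1 + c' != 0)%R by rewrite addrC -[1%R]opprK subr_eq0.
  have := scales_comp (measurable_shear1 a) (@scales_shear1 a)
    (scales_comp (measurable_shear2 s') (@scales_shear2 s') (@scales_shear1 a)).
  rewrite !mul1r; congr (scales _ _ _); apply/funext => -[x y] /=.
  have sa : (1 + s' * a = c')%R.
    apply: (mulIf c10); transitivity (1 + c' - s' ^+ 2)%R; first by rewrite /a; field.
    by rewrite (_ : (s' ^+ 2 = 1 - c' ^+ 2)%R); [ring|rewrite -cs; ring].
  rewrite /rot /=; congr pair; last first.
    transitivity (s' * x + (1 + s' * a) * y)%R; first by ring.
    by rewrite sa.
  have aa : (a + a * (1 + s' * a) = - s')%R.
    by rewrite sa /a; field.
  transitivity ((1 + s' * a) * x + (a + a * (1 + s' * a)) * y)%R; first by ring.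
  by rewrite aa sa; ring.
move=> cs; have [c1|] := eqVneq c (-1)%R; last exact: main.
have s0 : s = 0%R.
  apply/eqP; rewrite -sqrf_eq0; apply/eqP.
  by move: cs; rewrite c1 sqrrN expr1n; lra.
have q : scales leb2 (rot 0 1) 1.
  apply: main; first by rewrite expr0n expr1n add0r.
  by rewrite eq_sym oppr_eq0 oner_eq0.
have := scales_comp (@measurable_rot 0 1) q q.
rewrite mul1r; congr (scales _ _ _); apply/funext => -[x y].
by rewrite /rot c1 s0 /=; congr pair; ring.
Qed.

Lemma measurable_dil (c : R) : measurable_fun setT (fun z : plane R => ((c * z.1)%R, (c * z.2)%R) : plane R).
Proof.
by apply/measurable_fun_pair => /=; apply: measurable_funM;
    [exact: measurable_cst|exact: measurable_fst|exact: measurable_cst|exact: measurable_snd].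
Qed.

Lemma scales_dil (c : R) : (0 < c)%R ->
  scales leb2 (fun z : plane R => ((c * z.1)%R, (c * z.2)%R)) (c ^- 2).
Proof.
move=> c0 F mF F0; rewrite !leb2_tonelli //; last first.
  exact: (measurableT_comp mF (measurable_dil c)).
transitivity (\int[lebesgue_measure]_x ((c^-1)%:E * \int[lebesgue_measure]_y F ((c * x)%R, y))).
  apply: eq_integral => x _ /=.
  rewrite (scales_mul c0 (F := fun y => F ((c * x)%R, y))) //.
  exact: measurableT_comp mF (measurable_pair1 _).
have mG : measurable_fun setT (fun x => \int[lebesgue_measure]_y F (x, y)).
  exact: measurable_fun_fubini_tonelli_F.
have G0 x : 0 <= \int[lebesgue_measure]_y F (x, y) by apply: integral_ge0.
rewrite ge0_integralZl_EFin //.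
- rewrite (scales_mul c0 (F := fun x => \int[lebesgue_measure]_y F (x, y))) //.
  by rewrite muleA -EFinM -invfM -expr2.
- apply: (measurableT_comp mG); apply: measurable_funM => //; exact: measurable_cst.
- by rewrite invr_ge0 ltW.
Qed.

End Plane.
End Scaling.

(** * Integration over C^n one coordinate at a time *)

Section TupleIntegral.
Local Open Scope ereal_scope.
Context {R : realType}.
Local Notation pl := (plane R).

Lemma lebesgueC_int0 (F : 0.-tuple pl -> \bar R) : measurable_fun setT F ->
  \int[lebesgueC R 0]_w F w = F [tuple].
Proof.
move=> mF; rewrite /lebesgueC /=.
by rewrite (integral_dirac _ measurableT mF) diracT mul1e.
Qed.

Lemma measurable_cons_tuple n :
  measurable_fun setT (fun p : pl * n.-tuple pl => [tuple of p.1 :: p.2]).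
Proof. exact: measurable_cons. Qed.

Lemma lebesgueC_intS n (F : n.+1.-tuple pl -> \bar R) : measurable_fun setT F ->
  (forall w, 0 <= F w) ->
  \int[lebesgueC R n.+1]_w F w = \int[@leb2 R]_z \int[lebesgueC R n]_w F [tuple of z :: w].
Proof.
move=> mF F0; rewrite /lebesgueC /=.
rewrite ge0_integral_pushforward //; last exact: measurable_cons_tuple.
rewrite preimage_setT.
have mF' := measurableT_comp mF (@measurable_cons_tuple n).
apply: (@fubini_tonelli1 _ _ _ _ _ leb2 (lebesgueC R n) (fun p => F [tuple of p.1 :: p.2]) mF') => p. exact: F0.
Qed.

Definition tmap n (phi : 'I_n -> pl -> pl) (w : n.-tuple pl) : n.-tuple pl :=
  [tuple phi i (tnth w i) | i < n].

Lemma measurable_tmap n (phi : 'I_n -> pl -> pl) :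
  (forall i, measurable_fun setT (phi i)) -> measurable_fun setT (tmap phi).
Proof.
move=> mphi; apply/measurable_fun_tnthP => i.
rewrite (_ : _ \o _ = phi i \o (@tnth _ pl ^~ i)); last first.
  by apply/funext => w /=; rewrite tnth_mktuple.
apply: measurableT_comp; [exact: mphi|exact: measurable_tnth].
Qed.

Lemma tmap_cons n (phi : 'I_n.+1 -> pl -> pl) z (w : n.-tuple pl) :
  tmap phi [tuple of z :: w] = [tuple of phi ord0 z :: tmap (phi \o lift ord0) w].
Proof.
apply: eq_from_tnth => i; rewrite tnth_mktuple.
case: (unliftP ord0 i) => [j|] ->; last by rewrite !tnth0.
by rewrite !tnthS tnth_mktuple.
Qed.

Lemma measurable_cons1 n (z : pl) : measurable_fun setT (fun w : n.-tuple pl => [tuple of z :: w]).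
Proof. by apply: measurable_cons => //; exact: measurable_cst. Qed.

Lemma measurable_lebesgueC_slice n (F : n.+1.-tuple pl -> \bar R) : measurable_fun setT F ->
  (forall w, 0 <= F w) ->
  measurable_fun setT (fun z => \int[lebesgueC R n]_w F [tuple of z :: w]).
Proof.
move=> mF F0; have mF' := measurableT_comp mF (@measurable_cons_tuple n).
exact: (@measurable_fun_fubini_tonelli_F _ _ _ _ _ (lebesgueC R n) (fun p => F [tuple of p.1 :: p.2]) mF' (fun p => F0 _)).
Qed.

Lemma scales_tmap n (phi : 'I_n -> pl -> pl) (k : 'I_n -> R) :
  (forall i, measurable_fun setT (phi i)) -> (forall i, (0 <= k i)%R) ->
  (forall i, scales (@leb2 R) (phi i) (k i)) ->
  scales (lebesgueC R n) (tmap phi) (\prod_i k i)%R.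
Proof.
elim: n phi k => [|n IH] phi k mphi k0 sphi F mF F0.
  rewrite big_ord0 mul1e !lebesgueC_int0 //; last first.
    exact: (measurableT_comp mF (measurable_tmap mphi)).
  by congr F; rewrite !tuple0.
have mt := measurable_tmap mphi.
rewrite lebesgueC_intS //; last exact: (measurableT_comp mF mt).
transitivity (\int[@leb2 R]_z ((\prod_i k (lift ord0 i))%R%:E *
   \int[lebesgueC R n]_w F [tuple of phi ord0 z :: w])).
  apply: eq_integral => z _.
  rewrite -(IH (phi \o lift ord0) (k \o lift ord0) _ _ _ (fun w => F [tuple of phi ord0 z :: w])) //=.
  - by apply: eq_integral => w _; rewrite tmap_cons.
  - exact: (measurableT_comp mF (@measurable_cons1 _ _)).
have mS := measurable_lebesgueC_slice mF F0.
rewrite ge0_integralZl_EFin //; last first.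
- by apply: prodr_ge0 => i _.
- exact: (measurableT_comp mS (mphi ord0)).
- by move=> z _; exact: integral_ge0.
rewrite (sphi ord0 (fun z => \int[lebesgueC R n]_w F [tuple of z :: w])) //; last first.
  by move=> z; exact: integral_ge0.
by rewrite -lebesgueC_intS // muleA -EFinM big_ord_recl mulrC.
Qed.

Lemma measurable_tprod n (g : 'I_n -> pl -> R) : (forall i, measurable_fun setT (g i)) ->
  measurable_fun setT (fun w : n.-tuple pl => \prod_i g i (tnth w i))%R.
Proof.
move=> mg; elim: (index_enum _) => [|i s IH].
  by under eq_fun do rewrite big_nil; exact: measurable_cst.
under eq_fun do rewrite big_cons; apply: measurable_funM => //.
exact: (measurableT_comp (mg i) (measurable_tnth i)).
Qed.

Lemma lebesgueC_prod n (g : 'I_n -> pl -> R) (c : 'I_n -> R) :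
  (forall i, measurable_fun setT (g i)) -> (forall i z, (0 <= g i z)%R) ->
  (forall i, (0 <= c i)%R) ->
  (forall i, \int[@leb2 R]_z (g i z)%:E = (c i)%:E) ->
  \int[lebesgueC R n]_w (\prod_i g i (tnth w i))%R%:E = (\prod_i c i)%R%:E.
Proof.
elim: n g c => [|n IH] g c mg g0 c0 gc.
  rewrite lebesgueC_int0; first by rewrite !big_ord0.
  by apply/measurable_EFinP; exact: measurable_tprod.
rewrite lebesgueC_intS; last 2 first.
- by apply/measurable_EFinP; exact: measurable_tprod.
- by move=> w; rewrite lee_fin prodr_ge0.
transitivity (\int[@leb2 R]_z ((g ord0 z)%:E * (\prod_i c (lift ord0 i))%R%:E)).
  apply: eq_integral => z _.
  rewrite -(IH (fun i => g (lift ord0 i))) //.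
  rewrite -ge0_integralZl_EFin //; last 2 first.
  - by move=> w _; rewrite lee_fin prodr_ge0.
  - by apply/measurable_EFinP; exact: (@measurable_tprod n (fun i => g (lift ord0 i)) (fun i => mg _)).
  apply: eq_integral => w _; rewrite -EFinM big_ord_recl tnth0; congr (_ * _)%R%:E.
  by apply: eq_bigr => i _; rewrite tnthS.
rewrite ge0_integralZr //; last 3 first.
- exact/measurable_EFinP.
- by move=> z _; rewrite lee_fin.
- by rewrite lee_fin prodr_ge0.
by rewrite gc -EFinM [in RHS]big_ord_recl.
Qed.

End TupleIntegral.

(** * The Gamma function *)

Section GammaFunction.
Local Open Scope ereal_scope.
Context {R : realType}.
Local Notation leb := (@lebesgue_measure R).

(** The Gamma integral as an extended real, so that Tonelli applies before finiteness is known;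
    [GammaE] returns to [Gamma]. *)
Definition egamma (x : R) : \bar R :=
  \int[leb]_(t in `]0%R, +oo[) (t `^ (x - 1) * expR (- t))%R%:E.

Lemma measurable_fun_pow (p : R) (D : set (measurableTypeR R)) : measurable_fun D (fun t : measurableTypeR R => t `^ p)%R.
Proof. by apply: measurable_funTS; exact: measurable_powR. Qed.

Lemma measurable_expN (D : set (measurableTypeR R)) : measurable_fun D (fun t : measurableTypeR R => expR (- t))%R.
Proof.
by apply: measurable_funTS; apply: measurableT_comp => //; exact: measurable_funN.
Qed.

Lemma int_powR_itv (x a t : R) : (0 < x)%R -> (0 < a)%R -> (a < t)%R ->
  \int[leb]_(s in `[a, t]) (s `^ (x - 1))%:E = ((t `^ x - a `^ x) / x)%:E.
Proof.
move=> x0 a0 at0.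
have d (s : R) : (0 < s)%R -> is_derive s (1%R : R) (fun s : R => s `^ x / x)%R (s `^ (x - 1))%R.
  move=> s0; have D := @is_derive1_powR R x s s0.
  have := @is_deriveZ R _ _ (fun s => s `^ x)%R x^-1%R s 1%R _ D.
  rewrite /GRing.scale /= mulrA mulVf ?mul1r ?lt0r_neq0 //.
  congr is_derive; apply/funext => u; exact: mulrC.
have cF (s : R) : (0 < s)%R -> {for s, continuous (fun s : R => s `^ x / x)%R}.
  by move=> /d [D _]; exact/differentiable_continuous/derivable1_diffP.
rewrite (@continuous_FTC2 _ (fun s => s `^ (x - 1))%R (fun s => s `^ x / x)%R) //.
- by rewrite -EFinB -mulrBl.
- apply: continuous_in_subspaceT => s; rewrite inE /= in_itv /= => /andP[s1 _].
  have s0 := lt_le_trans a0 s1.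
  have [D _] := @is_derive1_powR R (x - 1) s s0.
  exact/differentiable_continuous/derivable1_diffP.
- split.
  + by move=> s; rewrite in_itv /= => /andP[s1 _]; have [] := d s (lt_trans a0 s1).
  + by apply: cvg_at_right_filter; exact: cF.
  + by apply: cvg_at_left_filter; apply: cF; exact: lt_trans at0.
- move=> s; rewrite in_itv /= => /andP[s1 _]; rewrite derive1E.
  by have [] := d s (lt_trans a0 s1).
Qed.

(** For x < 1 the integrand is unbounded at 0, so the interval is exhausted by the segments
    [t / (k + 2), t]; the shift by 2 keeps them nondegenerate. *)
Lemma int_powR0 (x t : R) : (0 < x)%R -> (0 < t)%R ->
  \int[leb]_(s in `]0%R, t]) (s `^ (x - 1))%:E = (t `^ x / x)%:E.
Proof.
move=> x0 t0.
pose F k := `[(t / k.+2%:R)%R, t]%classic : set (measurableTypeR R).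
have -> : `]0%R, t]%classic = \bigcup_k F k.
  apply/seteqP; split=> s; rewrite /= in_itv /=.
    move=> /andP[s0 st].
    have [k ks] : exists k : nat, (t / s < k%:R)%R.
      by exists (Num.trunc (t / s)).+1; exact: truncnS_gt.
    exists k => //; rewrite /F /= in_itv /= st andbT ler_pdivrMr //.
    rewrite ltr_pdivrMr // mulrC in ks; apply/ltW/(lt_le_trans ks).
    by rewrite ler_pM2l // ler_nat -addn2 leq_addr.
  move=> [k _]; rewrite /F /= in_itv /= => /andP[s0 ->]; rewrite andbT.
  by apply: lt_le_trans s0; rewrite divr_gt0.
have mono : nondecreasing_seq F.
  move=> i j ij; rewrite subsetEset => s; rewrite /F /= !in_itv /= => /andP[s1 ->].
  rewrite andbT; apply: le_trans s1; rewrite ler_pM2l // lef_pV2 ?posrE //.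
  by rewrite ler_nat !ltnS.
have mf i : measurable_fun (F i) (fun s => (s `^ (x - 1))%:E).
  by apply/measurable_EFinP; exact: measurable_fun_pow.
have f0 i s : F i s -> 0 <= (s `^ (x - 1))%:E by rewrite lee_fin powR_ge0.
have H := @ge0_nondecreasing_set_cvg_integral _ _ _ F (fun s => (s `^ (x - 1))%:E) leb
  mono (fun i => measurable_itv _) mf f0.
rewrite -(cvg_lim _ H) //.
have Fk k : \int[leb]_(s in F k) (s `^ (x - 1))%:E =
   ((t `^ x - (t / k.+2%:R) `^ x) / x)%:E.
  apply: int_powR_itv => //; first by rewrite divr_gt0.
  by rewrite ltr_pdivrMr // ltr_pMr // ltr1n.
under eq_fun do rewrite Fk.
apply: cvg_lim => //; apply: cvg_EFin; first by near=> k.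
rewrite [X in _ --> X](_ : _ = (t `^ x - 0) / x)%R; last by rewrite subr0.
apply: cvgMl; apply: cvgB; first exact: cvg_cst.
apply: (@cvg_comp _ _ _ (fun k : nat => t / k.+2%:R)%R (fun a => a `^ x)%R _ (0%R^'+)); last exact: powR_cvg0.
move=> P [e /= e0 HP].
have [N HN] : exists N : nat, (t / e < N%:R)%R.
  by exists (Num.trunc (t / e)).+1; exact: truncnS_gt.
exists N => // k /= Nk; apply: HP => /=; last by rewrite divr_gt0.
rewrite sub0r normrN gtr0_norm ?divr_gt0 // ltr_pdivrMr // mulrC.
rewrite -ltr_pdivrMr //; apply: lt_le_trans HN _; rewrite ler_nat.
by apply: leq_trans Nk _; rewrite -addn2 leq_addr.
Unshelve. all: by end_near. Qed.

Lemma int_expN (s : R) : \int[leb]_(t in `[s, +oo[) (expR (- t))%:E = (expR (- s))%:E.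
Proof.
have d (t : R) : is_derive t (1%R : R) (fun t : R => - expR (- t))%R (expR (- t))%R.
  by apply: trigger_derive; rewrite mulrN1 opprK.
rewrite (@ge0_continuous_FTC2y _ (fun t => expR (- t))%R (fun t => - expR (- t))%R s 0) //.
- by rewrite EFinN oppeK add0e.
- apply: continuous_subspaceT => t.
  by apply: continuous_comp; [exact: continuousN|exact: continuous_expR].
- rewrite -oppr0; apply: cvgN; exact: cvgr_expR.
- apply: cvg_at_right_filter.
  have C : {for s, continuous (fun t : R => - expR (- t))%R}.
    by have [D _] := d s; exact/differentiable_continuous/derivable1_diffP.
  exact: C.
- by move=> t _; rewrite derive1E; have [] := d t.
Qed.

Lemma egamma_ge0 x : 0 <= egamma x.
Proof.
by apply: integral_ge0 => t _; rewrite lee_fin mulr_ge0 ?powR_ge0 ?expR_ge0.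
Qed.

(** Write e^(-s) as the integral of e^(-t) over t >= s and exchange the order in the integral of
    s^(x-1) e^(-t) over 0 < s <= t. This Tonelli argument takes the place of an improper integration
    by parts and allows infinite values. *)
Lemma egammaS (x : R) : (0 < x)%R -> egamma (x + 1) = x%:E * egamma x.
Proof.
move=> x0; suff -> : egamma x = x^-1%:E * egamma (x + 1).
  by rewrite muleA -EFinM mulfV ?mul1e // lt0r_neq0.
pose T := measurableTypeR R.
pose f (p : T * T) : \bar R := (if (0 < p.1) && (p.1 <= p.2) then p.1 `^ (x - 1) * expR (- p.2) else 0)%R%:E.
have f0 p : 0 <= f p by rewrite /f lee_fin; case: ifP => // _; rewrite mulr_ge0 ?powR_ge0 ?expR_ge0.
have mf : measurable_fun setT f.
  apply/measurable_EFinP; apply: measurable_fun_ifT.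
  - apply: measurable_and.
      by apply: measurable_fun_ltr; [exact: measurable_cst|exact: measurable_fst].
    by apply: measurable_fun_ler; [exact: measurable_fst|exact: measurable_snd].
  - apply: measurable_funM.
      exact: (measurableT_comp (measurable_fun_pow (x - 1) (D := setT)) measurable_fst).
    exact: (measurableT_comp (measurable_expN (D := setT)) measurable_snd).
  - exact: measurable_cst.
transitivity (\int[leb]_s \int[leb]_t f (s, t)).
  rewrite /egamma integral_mkcond; apply: eq_integral => s _.
  rewrite patchE mem_setE in_itv /= andbT.
  case: ifPn => s0; last first.
    rewrite [RHS](eq_integral (fun=> 0)) ?integral0 // => t _.
    by rewrite /f /= (negbTE s0).
  transitivity ((s `^ (x - 1))%:E * \int[leb]_(t in `[s, +oo[) (expR (- t))%:E).
    by rewrite int_expN.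
  rewrite -ge0_integralZl_EFin ?powR_ge0 //; last first.
    by apply/measurable_EFinP; exact: measurable_expN.
  rewrite integral_mkcond; apply: eq_integral => t _.
  rewrite patchE mem_setE in_itv /= andbT /f /= s0 /=.
  by case: ifP.
rewrite (@fubini_tonelli _ _ T T R leb leb f mf f0).
rewrite /egamma -ge0_integralZl_EFin ?invr_ge0 ?(ltW x0) //; last 2 first.
- by move=> t _; rewrite lee_fin mulr_ge0 ?powR_ge0 ?expR_ge0.
- by apply/measurable_EFinP; apply: measurable_funM; [exact: measurable_fun_pow|exact: measurable_expN].
rewrite integral_mkcond; apply: eq_integral => t _.
rewrite patchE mem_setE in_itv /= andbT addrK.
case: ifPn => t0; last first.
  rewrite (eq_integral (fun=> 0)) ?integral0 // => s _.
  rewrite /f /=; case: ifP => // /andP[s0 st].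
  by rewrite (lt_le_trans s0 st) in t0.
transitivity ((expR (- t))%:E * \int[leb]_(s in `]0%R, t]) (s `^ (x - 1))%:E).
  rewrite -ge0_integralZl_EFin ?expR_ge0 //; last 2 first.
  - by move=> s _; rewrite lee_fin powR_ge0.
  - by apply/measurable_EFinP; exact: measurable_fun_pow.
  rewrite [RHS]integral_mkcond; apply: eq_integral => s _.
  rewrite patchE mem_setE in_itv /= /f /=.
  by case: ifP => // _; rewrite -EFinM mulrC.
by rewrite int_powR0 // -!EFinM; congr (_%:E); field; rewrite lt0r_neq0.
Qed.

Lemma egamma1 : egamma 1 = 1.
Proof.
rewrite /egamma integral_itv_obnd_cbnd.
  transitivity (\int[leb]_(t in `[0%R, +oo[) (expR (- t))%:E).
    by apply: eq_integral => t _; rewrite subrr powRr0 mul1r.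
  by rewrite int_expN oppr0 expR0.
by apply/measurable_EFinP; apply: measurable_funM; [exact: measurable_fun_pow|exact: measurable_expN].
Qed.

(** For x <= 1 the integrand is dominated by t^(x-1) on ]0, 1] and by e^(-t) beyond; larger x are
    reached by the functional equation. *)
Lemma egamma_lt0 x : (0 < x)%R -> egamma x < +oo.
Proof.
have small y : (0 < y)%R -> (y <= 1)%R -> egamma y < +oo.
  move=> y0 y1.
  apply: (@le_lt_trans _ _ (\int[leb]_(s in `]0%R, 1%R]) (s `^ (y - 1))%:E + \int[leb]_(t in `[0%R, +oo[) (expR (- t))%:E)).
    rewrite /egamma integral_mkcond [in leRHS]integral_mkcond [X in _ + X]integral_mkcond.
    have mr (D : set (measurableTypeR R)) (g : R -> R) : measurable D -> measurable_fun D g ->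
      measurable_fun setT ((fun t => (g t)%:E) \_ D).
      by move=> mD mg; apply/(measurable_restrictT _ mD); exact/measurable_EFinP.
    rewrite -ge0_integralD //; last 4 first.
    - by move=> t _; apply: erestrict_ge0 => s _; rewrite lee_fin powR_ge0.
    - by apply: mr => //; exact: measurable_fun_pow.
    - by move=> t _; apply: erestrict_ge0 => s _; rewrite lee_fin expR_ge0.
    - by apply: mr => //; exact: measurable_expN.
    apply: ge0_le_integral => //.
    - by move=> t _; apply: erestrict_ge0 => s _; rewrite lee_fin mulr_ge0 ?powR_ge0 ?expR_ge0.
    - by apply: mr => //; apply: measurable_funM; [exact: measurable_fun_pow|exact: measurable_expN].
    - apply: emeasurable_funD; apply: mr => //; [exact: measurable_fun_pow|exact: measurable_expN].
    - move=> t _; rewrite !patchE !mem_setE !in_itv /= !andbT.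
      have [t0|t0] := ltP 0%R t; last first.
        by case: ifP => _; rewrite ?adde_ge0 ?add0e // lee_fin expR_ge0.
      rewrite (ltW t0) /=; case: ifPn => [t1|].
        rewrite lee_fin; apply: (@le_trans _ _ (t `^ (y - 1))%R); last by rewrite lerDl expR_ge0.
        by rewrite ler_piMr ?powR_ge0 // -expR0 ler_expR oppr_le0 ltW.
      rewrite -ltNge => t1; rewrite add0e lee_fin ler_piMl ?expR_ge0 //.
      by rewrite -[leRHS](powRr0 t) ler_powR ?(ltW t1) // subr_le0.
  by rewrite int_powR0 // int_expN -EFinD ltry.
have step k y : (0 < y)%R -> (y <= k.+1%:R)%R -> egamma y < +oo.
  elim: k y => [|k IH] y y0 yk; first exact: small.
  have [y1|y1] := leP y 1%R; first exact: small.
  have -> : y = (y - 1 + 1)%R by rewrite subrK.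
  rewrite egammaS ?subr_gt0 //.
  have : egamma (y - 1)%R < +oo.
    by apply: IH; [rewrite subr_gt0|rewrite lerBlDr natr1].
  have := egamma_ge0 (y - 1)%R.
  by case: (egamma _) => // r _ _; rewrite -EFinM ltry.
move=> x0; apply: (step (Num.trunc x)) => //.
exact/ltW/truncnS_gt.
Qed.

Lemma egamma_gt0 x : (0 < x)%R -> 0 < egamma x.
Proof.
move=> x0; apply: (@lt_le_trans _ _ ((expR (- 1)%R)%:E * \int[leb]_(s in `]0%R, 1%R]) (s `^ (x - 1))%:E)).
  by rewrite int_powR0 // -EFinM lte_fin mulr_gt0 ?expR_gt0 // divr_gt0 // powR_gt0.
rewrite -ge0_integralZl_EFin ?expR_ge0 //; last 2 first.
- by move=> s _; rewrite lee_fin powR_ge0.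
- by apply/measurable_EFinP; exact: measurable_fun_pow.
apply: (@le_trans _ _ (\int[leb]_(t in `]0%R, 1%R]) (t `^ (x - 1) * expR (- t))%R%:E)).
  apply: ge0_le_integral => //.
  - by move=> t _; rewrite -EFinM lee_fin mulr_ge0 ?powR_ge0 ?expR_ge0.
  - apply/measurable_EFinP; apply: measurable_funM; [exact: measurable_cst|exact: measurable_fun_pow].
  - apply/measurable_EFinP; apply: measurable_funM; [exact: measurable_fun_pow|exact: measurable_expN].
  - move=> t; rewrite /= in_itv /= => /andP[_ t1].
    by rewrite lee_fin mulrC ler_wpM2l ?powR_ge0 // ler_expR lerN2.
apply: ge0_subset_integral => //.
- by apply/measurable_EFinP; apply: measurable_funM; [exact: measurable_fun_pow|exact: measurable_expN].
- by move=> t _; rewrite lee_fin mulr_ge0 ?powR_ge0 ?expR_ge0.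
- by move=> t /=; rewrite !in_itv /= => /andP[->].
Qed.

Lemma GammaE x : (0 < x)%R -> egamma x = (Gamma x)%:E.
Proof.
move=> x0; have [g1 g2] := (egamma_ge0 x, egamma_lt0 x0).
by rewrite /Gamma /Rintegral fineK // ge0_fin_numE.
Qed.

Lemma Gamma_gt0 (x : R) : (0 < x)%R -> (0 < Gamma x)%R.
Proof. by move=> x0; rewrite -lte_fin -GammaE //; exact: egamma_gt0. Qed.

Lemma GammaS (x : R) : (0 < x)%R -> Gamma (x + 1) = (x * Gamma x)%R.
Proof.
move=> x0; apply: EFin_inj; rewrite -GammaE; last by rewrite addr_gt0.
by rewrite egammaS // GammaE // EFinM.
Qed.

Lemma Gamma1 : Gamma (1%R : R) = 1%R.
Proof. by apply: EFin_inj; rewrite -GammaE // egamma1. Qed.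

End GammaFunction.

(** * Moments of the ball and of the Gaussian *)

Section Moments.
Local Open Scope ereal_scope.
Context {R : realType}.
Local Notation leb := (@lebesgue_measure R).
Local Notation pl := (plane R).

Definition psq (z : pl) : R := (z.1 ^+ 2 + z.2 ^+ 2)%R.

Lemma psq_ge0 z : (0 <= psq z)%R.
Proof. by rewrite addr_ge0 ?sqr_ge0. Qed.

Lemma measurable_psq : measurable_fun setT psq.
Proof.
by apply: measurable_funD; apply: measurable_funX; [exact: measurable_fst|exact: measurable_snd].
Qed.

Definition tsq n (w : n.-tuple pl) : R := (\sum_i psq (tnth w i))%R.

Lemma tsq_ge0 n (w : n.-tuple pl) : (0 <= tsq w)%R.
Proof. by apply: sumr_ge0 => i _; exact: psq_ge0. Qed.

Lemma measurable_tsq n : measurable_fun setT (@tsq n).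
Proof.
rewrite /tsq; elim: (index_enum _) => [|i s IH].
  by under eq_fun do rewrite big_nil; exact: measurable_cst.
under eq_fun do rewrite big_cons; apply: measurable_funD => //.
exact: (measurableT_comp measurable_psq (measurable_tnth i)).
Qed.

(** With z = [vecC w], this is |z^m|^2. *)
Definition tpw n (m : mindex n) (w : n.-tuple pl) : R := (\prod_i psq (tnth w i) ^+ m i)%R.

Lemma tpw_ge0 n (m : mindex n) (w : n.-tuple pl) : (0 <= tpw m w)%R.
Proof. by apply: prodr_ge0 => i _; rewrite exprn_ge0 // psq_ge0. Qed.

Lemma measurable_tpw n (m : mindex n) : measurable_fun setT (tpw m).
Proof.
apply: (@measurable_tprod R n (fun i z => psq z ^+ m i)%R) => i.
by apply: measurable_funX; exact: measurable_psq.
Qed.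

Definition kmom (j : nat) : \bar R := \int[@leb2 R]_z (psq z ^+ j * expR (- psq z))%R%:E.

(** The integral runs over all of C^n with a cut-off integrand, the form to which Tonelli and
    [scales_tmap] apply directly. *)
Definition Imom n (m : mindex n) (a : R) : \bar R :=
  \int[lebesgueC R n]_w (if (tsq w < 1)%R then tpw m w * (1 - tsq w) `^ a else 0)%R%:E.

(* Both sides are the integral over w in C^n and u > 0 of
   prod |w_i|^(2 m_i) u^a e^(-|w|^2 - u): integrate first over u, or
   substitute u = s - |w|^2 and then w = sqrt s * w'. *)
Lemma Imom_egamma_int n (m : mindex n) (a : R) : (-1 < a)%R ->
  Imom m a * egamma (n%:R + (mdeg m)%:R + a + 1)%R =
  egamma (a + 1)%R * \int[lebesgueC R n]_w (tpw m w * expR (- tsq w))%R%:E.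
Proof.
move=> a1.
pose T := measurableTypeR R.
have ea0 : (0 < a + 1)%R by lra.
pose f (p : n.-tuple pl * T) : \bar R :=
  (if (tsq p.1 < p.2)%R then tpw m p.1 * (p.2 - tsq p.1) `^ a * expR (- p.2) else 0)%R%:E.
have f0 p : 0 <= f p.
  by rewrite /f lee_fin; case: ifP => // _; rewrite !mulr_ge0 ?tpw_ge0 ?powR_ge0 ?expR_ge0.
have mtsq1 : measurable_fun setT (fun p : n.-tuple pl * T => tsq p.1).
  exact: (measurableT_comp (@measurable_tsq n) measurable_fst).
have mf : measurable_fun setT f.
  apply/measurable_EFinP; apply: measurable_fun_ifT.
  - by apply: measurable_fun_ltr => //; exact: measurable_snd.
  - apply: measurable_funM; last exact: (measurableT_comp (measurable_expN (D := setT)) measurable_snd).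
    apply: measurable_funM.
      exact: (measurableT_comp (measurable_tpw m) measurable_fst).
    apply: (measurableT_comp (measurable_fun_pow a (D := setT))).
    by apply: measurable_funB => //; exact: measurable_snd.
  - exact: measurable_cst.
have mg (p : R) : measurable_fun setT (fun t : T => (if (0 < t)%R then t `^ p * expR (- t) else 0)%R).
  apply: measurable_fun_ifT.
  - by apply: measurable_fun_ltr; [exact: measurable_cst|exact: measurable_id].
  - by apply: measurable_funM; [exact: measurable_fun_pow|exact: measurable_expN].
  - exact: measurable_cst.
have g0 (p t : R) : (0 <= (if (0 < t)%R then t `^ p * expR (- t) else 0))%R.
  by case: ifP => // _; rewrite mulr_ge0 ?powR_ge0 ?expR_ge0.
have gE (p : R) : \int[leb]_t (if (0 < t)%R then t `^ p * expR (- t) else 0)%R%:E = egamma (p + 1)%R.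
  rewrite /egamma addrK [RHS]integral_mkcond; apply: eq_integral => t _.
  by rewrite patchE mem_setE in_itv /= andbT; case: ifP.
transitivity (\int[lebesgueC R n]_w \int[leb]_s f (w, s)); last first.
  transitivity (\int[lebesgueC R n]_w ((tpw m w * expR (- tsq w))%R%:E * egamma (a + 1)%R)).
    apply: eq_integral => w _.
    have c0 : (0 <= tpw m w * expR (- tsq w))%R by rewrite mulr_ge0 ?tpw_ge0 ?expR_ge0.
    rewrite -gE -ge0_integralZl_EFin //; last 2 first.
    - by move=> t _; rewrite lee_fin.
    - exact/measurable_EFinP.
    (* The substitution of s - |w|^2 for u in the inner integral. *)
    rewrite -[RHS]mul1e -(@scales_shift R (- tsq w)%R); last 2 first.
    - by apply/measurable_EFinP; apply: measurable_funM; [exact: measurable_cst|exact: mg].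
    - by move=> t; rewrite -EFinM lee_fin mulr_ge0.
    apply: eq_integral => s _; rewrite /f /= subr_gt0 -EFinM; congr _%:E.
    case: ifP => _; last by rewrite mulr0.
    by rewrite mulrACA -expRD; congr (_ * expR _)%R; ring.
  rewrite ge0_integralZr // 1?muleC //; last 3 first.
  - apply/measurable_EFinP; apply: measurable_funM; first exact: measurable_tpw.
    exact: (measurableT_comp (measurable_expN (D := setT)) (@measurable_tsq n)).
  - by move=> w _; rewrite lee_fin mulr_ge0 ?expR_ge0 ?tpw_ge0.
  - exact: egamma_ge0.
rewrite (@fubini_tonelli _ _ _ T R (lebesgueC R n) leb f mf f0).
have I0 : 0 <= Imom m a.
  by apply: integral_ge0 => w _; rewrite lee_fin; case: ifP => // _; rewrite mulr_ge0 ?tpw_ge0 ?powR_ge0.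
pose p := (n%:R + (mdeg m)%:R + a)%R.
rewrite -(gE p) -ge0_integralZl //; last 2 first.
- exact/measurable_EFinP.
- by move=> t _; rewrite lee_fin.
apply: eq_integral => s _; case: ifPn => s0; last first.
  rewrite mule0 [RHS](eq_integral (fun=> 0)) ?integral0 // => w _.
  by rewrite /f /=; case: ifP => // ws; rewrite (le_lt_trans (tsq_ge0 w) ws) in s0.
pose c := Num.sqrt s.
have c0 : (0 < c)%R by rewrite sqrtr_gt0.
have cc : (c ^+ 2 = s)%R by rewrite sqr_sqrtr // ltW.
pose phi (i : 'I_n) (z : pl) : pl := ((c * z.1)%R, (c * z.2)%R).
have ci0 : (0 <= c ^- 2)%R by rewrite invr_ge0 exprn_ge0 // ltW.
have S := @scales_tmap R n phi (fun=> (c ^- 2)%R) (fun i => measurable_dil c)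
  (fun i => ci0) (fun i => scales_dil c0) (fun w => f (w, s))
  (measurableT_comp mf (measurable_pair2 s)) (fun w => f0 (w, s)).
have psqc i z : psq (phi i z) = (s * psq z)%R by rewrite /psq /= -cc; ring.
have tsqc w : tsq (tmap phi w) = (s * tsq w)%R.
  by rewrite /tsq mulr_sumr; apply: eq_bigr => i _; rewrite tnth_mktuple psqc.
have tpwc w : tpw m (tmap phi w) = (s ^+ mdeg m * tpw m w)%R.
  rewrite /tpw /mdeg -prodrXr -big_split; apply: eq_bigr => i _ /=.
  by rewrite tnth_mktuple psqc exprMn.
have fI : \int[lebesgueC R n]_w f (tmap phi w, s) = (s ^+ mdeg m * s `^ a * expR (- s))%R%:E * Imom m a.
  rewrite /Imom -ge0_integralZl_EFin; last 4 first.
  - exact: measurableT.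
  - by move=> w _; rewrite lee_fin; case: ifP => // _; rewrite mulr_ge0 ?tpw_ge0 ?powR_ge0.
  - apply/measurable_EFinP; apply: measurable_fun_ifT.
    + by apply: measurable_fun_ltr; [exact: measurable_tsq|exact: measurable_cst].
    + apply: measurable_funM; first exact: measurable_tpw.
      apply: (measurableT_comp (measurable_fun_pow a (D := setT))).
      by apply: measurable_funB; [exact: measurable_cst|exact: measurable_tsq].
    + exact: measurable_cst.
  - by rewrite !mulr_ge0 ?exprn_ge0 ?powR_ge0 ?expR_ge0 // ltW.
  apply: eq_integral => w _; rewrite /f /= tsqc tpwc.
  have -> : (s * tsq w < s)%R = (tsq w < 1)%R by rewrite -[X in (_ < X)%R]mulr1 ltr_pM2l.
  case: ifPn => w1; last by rewrite mule0.
  rewrite -EFinM; congr _%:E.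
  rewrite (_ : (s - s * tsq w = s * (1 - tsq w))%R); last by ring.
  by rewrite powRM ?subr_ge0 ?(ltW w1) ?(ltW s0) //; ring.
have kE : (\prod_(i < n) c ^- 2 = s ^- n)%R.
  by rewrite prodr_const card_ord cc exprVn.
move: S; rewrite fI kE => S.
have sn0 : (s ^+ n != 0)%R by rewrite lt0r_neq0 // exprn_gt0.
have -> : \int[lebesgueC R n]_w f (w, s) = (s ^+ n)%:E * ((s ^- n)%:E * \int[lebesgueC R n]_w f (w, s)).
  by rewrite muleA -EFinM mulfV // mul1e.
rewrite -S [LHS]muleC muleA -EFinM; congr (_%:E * _).
rewrite /p !powRD; try by rewrite (lt0r_neq0 s0) implybT.
by rewrite !powR_mulrn ?(ltW s0) // !mulrA.
Qed.

Lemma Imom_egamma n (m : mindex n) (a : R) (k : 'I_n -> R) : (-1 < a)%R ->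
  (forall i, (0 <= k i)%R) -> (forall i, kmom (m i) = (k i)%:E) ->
  Imom m a * egamma (n%:R + (mdeg m)%:R + a + 1)%R =
  egamma (a + 1)%R * (\prod_i k i)%R%:E.
Proof.
move=> a1 k0 km; rewrite Imom_egamma_int //; congr (_ * _).
rewrite -(@lebesgueC_prod R n (fun i z => psq z ^+ m i * expR (- psq z))%R k) //.
- apply: eq_integral => w _; congr (_%:E).
  by rewrite big_split /= /tsq -sumrN expR_sum.
- move=> i; apply: measurable_funM; first by apply: measurable_funX; exact: measurable_psq.
  exact: (measurableT_comp (measurable_expN (D := setT)) measurable_psq).
- by move=> i z; rewrite mulr_ge0 ?expR_ge0 ?exprn_ge0 ?psq_ge0.
Qed.

Definition lbase (m : nat) : mindex 1 := [ffun=> m].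

Lemma Imom1_egamma j (a : R) : (-1 < a)%R ->
  Imom (lbase j) a * egamma (j.+1%:R + a + 1)%R = egamma (a + 1)%R * kmom j.
Proof.
move=> a1; have := @Imom_egamma_int 1 (lbase j) a a1.
rewrite /mdeg big_ord1 ffunE (_ : 1%:R + j%:R = j.+1%:R)%R; last by rewrite -natrD add1n.
move=> ->; congr (_ * _); rewrite lebesgueC_intS; last 2 first.
- apply/measurable_EFinP; apply: measurable_funM; first exact: measurable_tpw.
  exact: (measurableT_comp (measurable_expN (D := setT)) (@measurable_tsq 1)).
- by move=> w; rewrite lee_fin mulr_ge0 ?expR_ge0 ?tpw_ge0.
apply: eq_integral => z _; rewrite lebesgueC_int0.
  by rewrite /tpw /tsq !big_ord1 ffunE tnth0.
apply: (@measurableT_comp _ _ _ _ _ _ (fun w => (tpw (lbase j) w * expR (- tsq w))%R%:E)); last exact: measurable_cons1.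
apply/measurable_EFinP; apply: measurable_funM; first exact: measurable_tpw.
exact: (measurableT_comp (measurable_expN (D := setT)) (@measurable_tsq 1)).
Qed.

Lemma kmom0 : kmom 0 = (pi : R)%:E.
Proof.
rewrite /kmom leb2_tonelli; last 2 first.
- apply/measurable_EFinP; apply: measurable_funM; first by apply: measurable_funX; exact: measurable_psq.
  exact: (measurableT_comp (measurable_expN (D := setT)) measurable_psq).
- by move=> z; rewrite lee_fin mulr_ge0 ?expR_ge0 ?exprn_ge0 ?psq_ge0.
have mG : measurable_fun setT (fun x : measurableTypeR R => gauss_fun x).
  exact: measurable_gauss_fun.
transitivity (\int[leb]_x ((gauss_fun x)%:E * (Num.sqrt (pi : R))%:E)).
  apply: eq_integral => x _; rewrite -integralT_gauss -ge0_integralZl_EFin ?gauss_fun_ge0 //.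
  - apply: eq_integral => y _; rewrite expr0 mul1r /psq /= opprD expRD.
    by rewrite /gauss_fun EFinM.
  - by move=> y _; rewrite lee_fin gauss_fun_ge0.
  - exact/measurable_EFinP.
rewrite ge0_integralZr //; last 2 first.
- exact/measurable_EFinP.
- by move=> y _; rewrite lee_fin gauss_fun_ge0.
by rewrite integralT_gauss -EFinM -expr2 sqr_sqrtr // pi_ge0.
Qed.

Lemma Gamma_nat (k : nat) : Gamma (k.+1%:R : R) = k`!%:R%R.
Proof.
elim: k => [|k IH]; first by rewrite Gamma1.
rewrite -natr1 GammaS ?ltr0n // IH factS natrM; congr (_ * _)%R.
Qed.

(** Let I(j, a) be the moment [Imom] for n = 1. By [Imom1_egamma], the value of kmom j determines
    I(j, 0) and I(j, 1). Since (1 - u) + u = 1 with u = |w|^2, I(j, 0) = I(j, 1) + I(j + 1, 0),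
    which yields I(j + 1, 0) and so kmom (j + 1). *)
Lemma kmomE j : kmom j = (j`!%:R * pi : R)%R%:E.
Proof.
elim: j => [|j IH]; first by rewrite kmom0 mul1r.
have div (X : \bar R) (r v : R) : (0 < r)%R -> X * r%:E = v%:E -> X = (v / r)%R%:E.
  by move=> r0 E; rewrite EFinM -E -muleA -EFinM mulfV ?mule1 // lt0r_neq0.
have I0 : Imom (lbase j) 0 = (pi / j.+1%:R)%R%:E.
  have := @Imom1_egamma j 0 (ltrN10 _).
  rewrite !addr0 add0r egamma1 mul1e IH natr1 GammaE ?ltr0n // Gamma_nat => /div -> //.
  congr _%:E; rewrite factS natrM; field.
  do ?[apply/andP; split]; rewrite ?pnatr_eq0 -?lt0n ?fact_gt0 //;
    apply: lt0r_neq0; have := ler0n R j; lra.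
have I1 : Imom (lbase j) 1 = (pi / (j.+1%:R * j.+2%:R))%R%:E.
  have := @Imom1_egamma j 1 (lt_trans (ltrN10 _) ltr01).
  rewrite IH !natr1 GammaE ?ltr0n // GammaE; last by rewrite addr_gt0.
  rewrite GammaS // Gamma1 !mul1r mul1e Gamma_nat => /div -> //.
  congr _%:E; rewrite !factS !natrM; field.
  do ?[apply/andP; split]; rewrite ?pnatr_eq0 -?lt0n ?fact_gt0 //;
    apply: lt0r_neq0; have := ler0n R j; lra.
have tE i (w : 1.-tuple pl) : tpw (lbase i) w = (tsq w ^+ i)%R by rewrite /tpw /tsq !big_ord1 ffunE.
have mi i (a : R) : measurable_fun setT (fun w : 1.-tuple pl => (if (tsq w < 1)%R then tpw (lbase i) w * (1 - tsq w) `^ a else 0)%R%:E).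
  apply/measurable_EFinP; apply: measurable_fun_ifT.
  - by apply: measurable_fun_ltr; [exact: measurable_tsq|exact: measurable_cst].
  - apply: measurable_funM; first exact: measurable_tpw.
    apply: (measurableT_comp (measurable_fun_pow a (D := setT))).
    by apply: measurable_funB; [exact: measurable_cst|exact: measurable_tsq].
  - exact: measurable_cst.
have p0 i (a : R) (w : 1.-tuple pl) : 0 <= (if (tsq w < 1)%R then tpw (lbase i) w * (1 - tsq w) `^ a else 0)%R%:E.
  by rewrite lee_fin; case: ifP => // _; rewrite mulr_ge0 ?tpw_ge0 ?powR_ge0.
have add : Imom (lbase j) 0 = Imom (lbase j) 1 + Imom (lbase j.+1) 0.
  rewrite /Imom -ge0_integralD //; apply: eq_integral => w _.
  rewrite -EFinD; congr _%:E; case: ifPn => w1; last by rewrite addr0.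
  rewrite !tE !powRr0 powRr1 ?subr_ge0 ?(ltW w1) // exprS; ring.
have I2 : Imom (lbase j.+1) 0 = (pi / j.+2%:R)%R%:E.
  have : (pi / j.+1%:R)%R%:E = (pi / (j.+1%:R * j.+2%:R))%R%:E + Imom (lbase j.+1) 0.
    by rewrite -I0 -I1.
  case: (Imom _ _) => // r; rewrite -EFinD => -[E]; congr _%:E.
  have -> : (r = pi / j.+1%:R - pi / (j.+1%:R * j.+2%:R))%R by rewrite E; ring.
  field.
  do ?[apply/andP; split]; rewrite ?pnatr_eq0 -?lt0n ?fact_gt0 //;
    apply: lt0r_neq0; have := ler0n R j; lra.
have := @Imom1_egamma j.+1 0 (ltrN10 _).
rewrite I2 !addr0 add0r egamma1 mul1e natr1 GammaE ?ltr0n // Gamma_nat => <-.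
rewrite -EFinM; congr _%:E; rewrite factS natrM; field.
do ?[apply/andP; split]; rewrite ?pnatr_eq0 -?lt0n ?fact_gt0 //;
    apply: lt0r_neq0; have := ler0n R j; lra.
Qed.

Theorem ImomE n (m : mindex n) (a : R) : (-1 < a)%R ->
  Imom m a = (pi ^+ n * (mfact m)%:R * Gamma (a + 1) / Gamma (n%:R + (mdeg m)%:R + a + 1))%R%:E.
Proof.
move=> a1; have a10 : (0 < a + 1)%R by lra.
have g0 : (0 < n%:R + (mdeg m)%:R + a + 1)%R by rewrite -addrA ltr_wpDl // addr_ge0.
have := @Imom_egamma n m a (fun i => (m i)`!%:R * pi)%R a1 _ (fun i => kmomE (m i)).
move=> /(_ _)/wrap[|E]; first by move=> i; rewrite mulr_ge0 ?pi_ge0.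
rewrite !GammaE // in E.
have G0 := Gamma_gt0 g0.
have -> : Imom m a = Imom m a * (Gamma (n%:R + (mdeg m)%:R + a + 1))%:E * (Gamma (n%:R + (mdeg m)%:R + a + 1))^-1%:E.
  by rewrite -muleA -EFinM mulfV ?mule1 // lt0r_neq0.
rewrite E -!EFinM; congr _%:E; rewrite big_split /= prodr_const card_ord.
have -> : (\prod_(i < n) (m i)`!%:R = (mfact m)%:R :> R)%R by rewrite /mfact natr_prod.
by ring.
Qed.

End Moments.

(** * Inner products *)

Section WeightedL2.
Context d (T : measurableType d) (R : realType).
Variables (mu : {measure set T -> \bar R}) (D : set T) (W : T -> R).
Hypothesis mD : measurable D.
Hypothesis mW : measurable_fun D W.
Hypothesis W0 : forall x, D x -> 0 <= W x.
Local Notation C := (R[i]).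
Implicit Types (G H : T -> C).

Definition cm G := measurable_fun D (fun x => complex.Re (G x)) /\
  measurable_fun D (fun x => complex.Im (G x)).

Definition l2 G : \bar R := (\int[mu]_(x in D) (normc (G x) ^+ 2 * W x)%:E)%E.

Definition cint G : C := ((\int[mu]_(x in D) (complex.Re (G x) * W x))
  +i* (\int[mu]_(x in D) (complex.Im (G x) * W x)))%C.

Definition cip G H : C := cint (fun x => G x * conjc (H x)).

Definition inL2 G := cm G /\ (l2 G < +oo)%E.

Lemma cm_cst (c : C) : cm (fun=> c).
Proof. by split; exact: measurable_cst. Qed.

Lemma cmD G H : cm G -> cm H -> cm (fun x => G x + H x).
Proof.
move=> [Gr Gi] [Hr Hi]; split.
  by under eq_fun do rewrite ReD; exact: measurable_funD.
by under eq_fun do rewrite ImD; exact: measurable_funD.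
Qed.

Lemma cmM G H : cm G -> cm H -> cm (fun x => G x * H x).
Proof.
move=> [Gr Gi] [Hr Hi]; split.
  by under eq_fun do rewrite ReM; apply: measurable_funB; exact: measurable_funM.
by under eq_fun do rewrite ImM; apply: measurable_funD; exact: measurable_funM.
Qed.

Lemma cm_conj G : cm G -> cm (fun x => conjc (G x)).
Proof.
move=> [Gr Gi]; split.
  by apply: eq_measurable_fun Gr => x _; case: (G x).
apply: (@eq_measurable_fun _ _ _ _ _ (fun x => - complex.Im (G x))) => [x _|].
  by case: (G x).
exact: measurable_funN.
Qed.

Lemma cm_sum (I : Type) (s : seq I) (F : I -> T -> C) : (forall i, cm (F i)) ->
  cm (fun x => \sum_(i <- s) F i x).
Proof.
move=> cF; elim: s => [|i s IH].
  by under eq_fun do rewrite big_nil; exact: cm_cst.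
by under eq_fun do rewrite big_cons; exact: cmD.
Qed.

Lemma cm_prod (I : Type) (s : seq I) (F : I -> T -> C) : (forall i, cm (F i)) ->
  cm (fun x => \prod_(i <- s) F i x).
Proof.
move=> cF; elim: s => [|i s IH].
  by under eq_fun do rewrite big_nil; exact: cm_cst.
by under eq_fun do rewrite big_cons; exact: cmM.
Qed.

Lemma cmX G k : cm G -> cm (fun x => G x ^+ k).
Proof.
move=> cG; elim: k => [|k IH]; first by under eq_fun do rewrite expr0; exact: cm_cst.
by under eq_fun do rewrite exprS; exact: cmM.
Qed.

Lemma eq_cm G H : (forall x, D x -> G x = H x) -> cm G -> cm H.
Proof.
move=> GH [Gr Gi]; split.
  by apply: eq_measurable_fun Gr => x /set_mem /GH ->.
by apply: eq_measurable_fun Gi => x /set_mem /GH ->.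
Qed.

Definition ptcvg (u : nat -> C) (l : C) := forall e : R, 0 < e ->
  exists N0, forall N, (N0 <= N)%N -> normc (u N - l) <= e.

Lemma ptcvg_Re u l : ptcvg u l -> (fun N => complex.Re (u N)) @ \oo --> complex.Re l.
Proof.
move=> ul; apply/cvgrPdist_le => e e0; have [N0 HN] := ul e e0.
exists N0 => //= N /= /HN; apply: le_trans; rewrite distrC -ReN -ReD; exact: normc_Re.
Qed.

Lemma ptcvg_Im u l : ptcvg u l -> (fun N => complex.Im (u N)) @ \oo --> complex.Im l.
Proof.
move=> ul; apply/cvgrPdist_le => e e0; have [N0 HN] := ul e e0.
exists N0 => //= N /= /HN; apply: le_trans; rewrite distrC -ImN -ImD; exact: normc_Im.
Qed.

Lemma cm_lim (F : nat -> T -> C) G : (forall N, cm (F N)) ->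
  (forall x, D x -> ptcvg (F^~ x) (G x)) -> cm G.
Proof.
move=> cF FG; split.
  apply: (@measurable_fun_cvg _ _ _ _ (fun N x => complex.Re (F N x))).
    by move=> N; case: (cF N).
  by move=> x Dx; apply: (ptcvg_Re (FG x Dx)).
apply: (@measurable_fun_cvg _ _ _ _ (fun N x => complex.Im (F N x))).
  by move=> N; case: (cF N).
by move=> x Dx; apply: (ptcvg_Im (FG x Dx)).
Qed.

Lemma measurable_l2 G : cm G -> measurable_fun D (fun x => (normc (G x) ^+ 2 * W x)%:E).
Proof.
move=> [Gr Gi]; apply/measurable_EFinP; apply: measurable_funM => //.
under eq_fun do rewrite sqr_normc_def.
by apply: measurable_funD; exact: measurable_funX.
Qed.

Lemma l2_int_ge0 G x : D x -> (0 <= (normc (G x) ^+ 2 * W x)%:E)%E.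
Proof. by move=> Dx; rewrite lee_fin mulr_ge0 ?sqr_ge0 ?W0. Qed.

Lemma l2_ge0 G : (0 <= l2 G)%E.
Proof. by apply: integral_ge0 => x; exact: l2_int_ge0. Qed.

(** Lower semicontinuity of the norm under pointwise convergence. The bound is asked only from some
    index on, because it is also applied to the differences of partial sums F M - F N, with M >=
    N. *)
Lemma l2_fatou (F : nat -> T -> C) G (M : \bar R) : (forall N, cm (F N)) ->
  (forall x, D x -> ptcvg (F^~ x) (G x)) ->
  (exists N0, forall N, (N0 <= N)%N -> (l2 (F N) <= M)%E) -> (l2 G <= M)%E.
Proof.
move=> cF FG [N0 HM].
pose h N x := (normc (F (N + N0)%N x) ^+ 2 * W x)%:E.
have mh N : measurable_fun D (h N) by exact: measurable_l2.
have h0 N x : D x -> (0 <= h N x)%E by exact: l2_int_ge0.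
have hc x : D x -> h^~ x @ \oo --> (normc (G x) ^+ 2 * W x)%:E.
  move=> Dx; apply/cvg_EFin; first by near=> N.
  rewrite sqr_normc_def; apply: cvgMr_tmp.
  have := ptcvg_Im (FG x Dx); rewrite -(cvg_shiftn N0) => cI.
  have := ptcvg_Re (FG x Dx); rewrite -(cvg_shiftn N0) => cR.
  under eq_fun do rewrite /= sqr_normc_def !expr2.
  by rewrite !expr2; apply: cvgD; exact: cvgM.
have -> : l2 G = (\int[mu]_(x in D) limn_einf (h^~ x))%E.
  apply: eq_integral => x /set_mem Dx.
  rewrite is_cvg_limn_einfE; last by apply/cvg_ex; eexists; exact: hc.
  by apply/esym/cvg_lim => //; exact: hc.
apply: le_trans (fatou mu mD mh h0) _.
rewrite limn_einf_lim; apply: lime_le; first exact: is_cvg_einfs.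
apply: nearW => N; apply: ereal_inf_le => /=.
exists (l2 (F (N + N0)%N)); first by exists N => //=.
by apply: HM; rewrite leq_addl.
Unshelve. all: by end_near.
Qed.

Lemma conjcM (z y : C) : conjc (z * y) = conjc z * conjc y.
Proof. exact: (rmorphM (@conjc R)). Qed.

Lemma conjcD (z y : C) : conjc (z + y) = conjc z + conjc y.
Proof. exact: (rmorphD (@conjc R)). Qed.

Lemma sqr_normcD_le (z y : C) : normc (z + y) ^+ 2 <= 2 * normc z ^+ 2 + 2 * normc y ^+ 2.
Proof.
have h := normcD z y; have a := normc_ge0 z; have b := normc_ge0 y; have c := normc_ge0 (z + y).
have : normc (z + y) ^+ 2 <= (normc z + normc y) ^+ 2 by rewrite ler_pXn2r // nnegrE addr_ge0.
move: (sqr_ge0 (normc z - normc y)); nra.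
Qed.

Lemma l2Z (c : C) G : cm G -> l2 (fun x => c * G x) = ((normc c ^+ 2)%:E * l2 G)%E.
Proof.
move=> cG; rewrite /l2 -ge0_integralZl_EFin //.
- by apply: eq_integral => x _; rewrite normcM exprMn -mulrA EFinM.
- exact: l2_int_ge0.
- exact: measurable_l2.
- exact: sqr_ge0.
Qed.

Lemma inL2_Z (c : C) G : inL2 G -> inL2 (fun x => c * G x).
Proof.
move=> [cG lG]; split; first by apply: cmM => //; exact: cm_cst.
by rewrite l2Z // lte_mul_pinfty // lee_fin sqr_ge0.
Qed.

Lemma l2D_le G H : cm G -> cm H -> (l2 (fun x => G x + H x)%R <= 2%:E * l2 G + 2%:E * l2 H)%E.
Proof.
move=> cG cH; rewrite /l2 -!ge0_integralZl_EFin //; try solve [exact: l2_int_ge0|exact: measurable_l2].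
have mE K : cm K -> measurable_fun D (fun x => 2%:E * (normc (K x) ^+ 2 * W x)%:E)%E.
  by move=> cK; apply: measurable_funeM; exact: measurable_l2.
have E0 K x : D x -> (0 <= 2%:E * (normc (K x) ^+ 2 * W x)%:E)%E.
  by move=> Dx; apply: mule_ge0; [rewrite lee_fin|exact: l2_int_ge0].
rewrite -ge0_integralD //; try solve [exact: mE|exact: E0].
apply: ge0_le_integral => //; try solve [exact: l2_int_ge0
  | apply: measurable_l2; exact: cmD | apply: emeasurable_funD; exact: mE
  | move=> x Dx; rewrite adde_ge0 //; exact: E0].
move=> x Dx; rewrite -!EFinM -EFinD lee_fin.
by have := ler_wpM2r (W0 Dx) (sqr_normcD_le (G x) (H x)); rewrite mulrDl -!(mulrA 2).
Qed.

Lemma inL2_D G H : inL2 G -> inL2 H -> inL2 (fun x => G x + H x).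
Proof.
move=> [cG lG] [cH lH]; split; first exact: cmD.
apply: le_lt_trans (l2D_le cG cH) _.
by apply: lte_add_pinfty; rewrite lte_mul_pinfty // lee_fin.
Qed.

Lemma l2_integrable G : inL2 G -> mu.-integrable D (EFin \o (fun x => normc (G x) ^+ 2 * W x)).
Proof.
move=> [cG lG]; apply/integrableP; split; first exact: measurable_l2.
rewrite (eq_integral (fun x => (normc (G x) ^+ 2 * W x)%:E)) // => x /set_mem Dx /=.
by rewrite ger0_norm // mulr_ge0 ?sqr_ge0 ?W0.
Qed.

Lemma normcM_le (z y : C) : normc (z * conjc y) <= normc z ^+ 2 + normc y ^+ 2.
Proof.
rewrite normcM normc_conj; have a := normc_ge0 z; have b := normc_ge0 y.
move: (sqr_ge0 (normc z - normc y)); nra.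
Qed.

(** Here p stands for the real or the imaginary part, and |G|^2 + |H|^2 dominates the product. *)
Lemma inL2_integrable G H (p : C -> R) : inL2 G -> inL2 H ->
  measurable_fun D (fun x => p (G x * conjc (H x))) -> (forall z, `|p z| <= normc z) ->
  mu.-integrable D (EFin \o (fun x => p (G x * conjc (H x)) * W x)).
Proof.
move=> LG LH mp pn.
apply: (le_integrable mD _ _ (integrableD mD (l2_integrable LG) (l2_integrable LH))).
  by apply/measurable_EFinP; exact: measurable_funM.
move=> x Dx /=; rewrite lee_fin -mulrDl normrM (ger0_norm (W0 Dx)).
rewrite [leRHS]ger0_norm; last by apply: mulr_ge0; [rewrite addr_ge0 ?sqr_ge0|exact: W0].
by apply: ler_wpM2r; [exact: W0|apply: le_trans (pn _) (normcM_le _ _)].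
Qed.

Lemma cip_integrable G H : inL2 G -> inL2 H ->
  mu.-integrable D (EFin \o (fun x => complex.Re (G x * conjc (H x)) * W x)) /\
  mu.-integrable D (EFin \o (fun x => complex.Im (G x * conjc (H x)) * W x)).
Proof.
move=> LG LH; have [cG _] := LG; have [cH _] := LH; have [mr mi] := cmM cG (cm_conj cH).
by split; [apply: (inL2_integrable LG LH mr) => z; exact: normc_Re|
           apply: (inL2_integrable LG LH mi) => z; exact: normc_Im].
Qed.

Lemma cipD G G' H : inL2 G -> inL2 G' -> inL2 H ->
  cip (fun x => G x + G' x) H = cip G H + cip G' H.
Proof.
move=> LG LG' LH; have [r1 i1] := cip_integrable LG LH; have [r2 i2] := cip_integrable LG' LH.
rewrite /cip /cint; apply: complexP; rewrite ?ReD ?ImD /=.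
  by rewrite -RintegralD //; apply: eq_Rintegral => x _; rewrite mulrDl ReD mulrDl.
by rewrite -RintegralD //; apply: eq_Rintegral => x _; rewrite mulrDl ImD mulrDl.
Qed.

Lemma cipZ (c : C) G H : inL2 G -> inL2 H -> cip (fun x => c * G x) H = c * cip G H.
Proof.
move=> LG LH; have [r1 i1] := cip_integrable LG LH.
have iZ (r : R) h : mu.-integrable D (EFin \o h) -> mu.-integrable D (EFin \o (fun x => r * h x)).
  by move=> ih; apply: eq_integrable (integrableZl mD r ih).
rewrite /cip /cint; apply: complexP; rewrite ?ReM ?ImM /=.
  rewrite -!RintegralZl // -RintegralB //; try exact: iZ.
  by apply: eq_Rintegral => x _; rewrite -mulrA ReM mulrBl !mulrA.
rewrite -!RintegralZl // -RintegralD //; try exact: iZ.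
by apply: eq_Rintegral => x _; rewrite -mulrA ImM mulrDl !mulrA.
Qed.

Lemma cipC G H : inL2 G -> inL2 H -> cip H G = conjc (cip G H).
Proof.
move=> LG LH; have [r1 i1] := cip_integrable LG LH.
have E x : H x * conjc (G x) = conjc (G x * conjc (H x)).
  by rewrite conjcM conjcK mulrC.
rewrite /cip /cint; apply: complexP => /=.
  by apply: eq_Rintegral => x _; rewrite E; case: (G x * _).
rewrite -[RHS]mulN1r -RintegralZl //.
by apply: eq_Rintegral => x _; rewrite E mulN1r -mulNr; case: (G x * _).
Qed.

Lemma cip_norm G : inL2 G -> cip G G = (fine (l2 G))%:C%C.
Proof.
move=> LG; rewrite /cip /cint; apply: complexP => /=.
  by rewrite /Rintegral; congr fine; apply: eq_integral => x _; rewrite mul_conjc.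
rewrite (@eq_Rintegral _ _ _ _ _ (fun=> 0)) ?Rintegral_cst ?mul0r // => x _.
by rewrite mul_conjc mul0r.
Qed.

End WeightedL2.

(** * Finite sums over an index type *)

Section FiniteSums.
Context {R : realType} {I : choiceType}.
Implicit Types (g : I -> R) (s : seq I).

Lemma sum_le_esum g s : (forall i, 0 <= g i) -> uniq s ->
  ((\sum_(i <- s) g i)%:E <= \esum_(i in setT) (g i)%:E)%E.
Proof.
move=> g0 us; apply: esum_ge; exists [set` s]; first by split => //; exact: finite_seq.
by rewrite -fsbig_seq // sumEFin.
Qed.

Lemma lt_esum_sum g (x : \bar R) : (x < \esum_(i in setT) (g i)%:E)%E ->
  exists2 s, uniq s & (x < (\sum_(i <- s) g i)%:E)%E.
Proof.
move=> /ereal_sup_gt[_ [A [fA _] <-] xA].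
by exists (finmap.enum_fset (fset_set A)) => //; rewrite -sumEFin -fsbig_finite.
Qed.

Lemma sum_uniq_le g s t : (forall i, 0 <= g i) -> uniq s -> uniq t -> {subset s <= t} ->
  \sum_(i <- s) g i <= \sum_(i <- t) g i.
Proof.
move=> g0 us ut st; rewrite [leRHS](bigID (mem s)) /= -[X in _ <= X + _]big_filter.
rewrite [X in _ <= X + _](perm_big s) /=; first by rewrite lerDl sumr_ge0.
apply: uniq_perm => //; first exact: filter_uniq.
by move=> i; rewrite mem_filter; case: (boolP (i \in s)) => //= /st ->.
Qed.

Lemma sqr_sum_le (s : seq I) (a b : I -> R) : (forall i, 0 <= a i) -> (forall i, 0 <= b i) ->
  (\sum_(i <- s) a i * b i) ^+ 2 <= (\sum_(i <- s) a i ^+ 2) * (\sum_(i <- s) b i ^+ 2).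
Proof.
move=> a0 b0; elim: s => [|i s IH]; first by rewrite !big_nil mul0r expr0n.
rewrite !big_cons.
have X0 : 0 <= \sum_(j <- s) a j * b j by apply: sumr_ge0 => j _; rewrite mulr_ge0.
have A0 : 0 <= \sum_(j <- s) a j ^+ 2 by apply: sumr_ge0 => j _; rewrite sqr_ge0.
have B0 : 0 <= \sum_(j <- s) b j ^+ 2 by apply: sumr_ge0 => j _; rewrite sqr_ge0.
move: X0 A0 B0 IH (a0 i) (b0 i).
move: (\sum_(j <- s) a j * b j) (\sum_(j <- s) a j ^+ 2) (\sum_(j <- s) b j ^+ 2) (a i) (b i).
move=> X A B x y X0 A0 B0 XAB x0 y0.
(* This follows from X^2 <= A * B and (A y^2 - B x^2)^2 >= 0 after squaring, both sides being
   nonnegative. *)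
suff H : 2 * X * x * y <= A * y ^+ 2 + B * x ^+ 2.
  rewrite (_ : (x * y + X) ^+ 2 = X ^+ 2 + 2 * X * x * y + x ^+ 2 * y ^+ 2); last by ring.
  rewrite (_ : (x ^+ 2 + A) * (y ^+ 2 + B) = A * B + (A * y ^+ 2 + B * x ^+ 2) + x ^+ 2 * y ^+ 2); last by ring.
  by rewrite lerD2r lerD.
have n1 : 0 <= 2 * X * x * y by rewrite !mulr_ge0.
have n2 : 0 <= A * y ^+ 2 + B * x ^+ 2 by rewrite addr_ge0 ?mulr_ge0 ?exprn_ge0.
rewrite -(@ler_pXn2r _ 2) ?nnegrE //.
rewrite (_ : (2 * X * x * y) ^+ 2 = 4 * (x * y) ^+ 2 * X ^+ 2); last by ring.
apply: (@le_trans _ _ (4 * (x * y) ^+ 2 * (A * B))); first by rewrite ler_wpM2l // mulr_ge0 // sqr_ge0.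
rewrite -subr_ge0 (_ : _ - _ = (A * y ^+ 2 - B * x ^+ 2) ^+ 2) ?sqr_ge0 //; ring.
Qed.

End FiniteSums.

(** * Positive semidefinite Hermitian forms and orthonormal families *)

Section InnerProduct.
Context {R : realType} {X : Type} {I : choiceType}.
Local Notation C := (R[i]).
Variables (carr : set (X -> C)) (B : (X -> C) -> (X -> C) -> C) (e : I -> X -> C).
Hypothesis carr0 : carr (fun=> 0).
Hypothesis carrL : forall (a : C) f g, carr f -> carr g -> carr (fun x => a * f x + g x).
Hypothesis BL : forall (a : C) f g h, carr f -> carr g -> carr h ->
  B (fun x => a * f x + g x) h = a * B f h + B g h.
Hypothesis Bherm : forall f g, carr f -> carr g -> B g f = conjc (B f g).
Hypothesis Bpos : forall f, carr f -> 0 <= complex.Re (B f f).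
Hypothesis carre : forall i, carr (e i).
Hypothesis Be : forall i j, B (e i) (e j) = (i == j)%:R.

Definition sqn f : R := complex.Re (B f f).
(** Besides the basis, this is also used with the rotated copies of a function as the family e, in
    [roots_average_le]. *)
Definition psum (a : I -> C) (s : seq I) : X -> C := fun x => \sum_(i <- s) a i * e i x.

Lemma form0l h : carr h -> B (fun=> 0) h = 0.
Proof.
move=> ch; have := BL (-1) carr0 carr0 ch.
by rewrite (_ : (fun x => -1 * 0 + 0) = fun=> 0) ?mulN1r ?addNr //; apply/funext => x; rewrite mulr0 addr0.
Qed.

Lemma form_linear_r (a : C) f g h : carr f -> carr g -> carr h ->
  B h (fun x => a * f x + g x) = conjc a * B h f + B h g.
Proof.
move=> cf cg ch; have cl := carrL a cf cg.
by rewrite (Bherm cl ch) BL // conjcD conjcM -!Bherm.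
Qed.

Lemma form_scale (a b : C) f g : carr f -> carr g ->
  B (fun x => a * f x) (fun x => b * g x) = a * conjc b * B f g.
Proof.
have E (c : C) h : (fun x => c * h x) = fun x : X => c * h x + 0.
  by apply/funext => x; rewrite addr0.
move=> cf cg; have cbg := carrL b cg carr0.
rewrite E (E b) BL // form_linear_r // (form0l cbg) (Bherm carr0 cf) (form0l cf) rmorph0.
by rewrite !addr0 mulrA.
Qed.

Lemma sqnE f : carr f -> B f f = (sqn f)%:C%C.
Proof.
move=> cf; apply: complexP => //=; have := Bherm cf cf.
case: (B f f) => x y /= [] /eqP; rewrite -subr_eq0 opprK -mulr2n mulrn_eq0 /= => /eqP //.
Qed.

Lemma sqnL (a : C) f g : carr f -> carr g ->
  sqn (fun x => a * f x + g x) = normc a ^+ 2 * sqn f + sqn g + 2 * complex.Re (a * B f g).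
Proof.
move=> cf cg; have cl := carrL a cf cg.
rewrite /sqn BL // !form_linear_r // (sqnE cf) (sqnE cg) (Bherm cf cg) sqr_normc_def.
case: a (B f g) {cl} => a b [x y] /=; ring.
Qed.

(** Comparing the square norms of a * f + g and of its image gives the real part of a * B f g for
    every a; a = 1 and a = -i recover the real and imaginary parts. *)
Lemma polarization (U : (X -> C) -> X -> C) f g : (forall h, carr h -> carr (U h)) ->
  (forall (a : C) h k, U (fun x => a * h x + k x) = fun x => a * U h x + U k x) ->
  (forall h, carr h -> sqn (U h) = sqn h) -> carr f -> carr g ->
  B (U f) (U g) = B f g.
Proof.
move=> cU UL Us cf cg.
have H a : complex.Re (a * B (U f) (U g)) = complex.Re (a * B f g).
  have := Us _ (carrL a cf cg); rewrite UL !sqnL ?Us //; try exact: cU.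
  by move=> /addrI /mulfI; apply; rewrite pnatr_eq0.
apply: complexP; first by have := H 1; rewrite !mul1r.
have := H (- 'i%C); case: (B (U f) (U g)) (B f g) => a b [c d] /=; lra.
Qed.

Lemma carr_psum a s : carr (psum a s).
Proof.
rewrite /psum; elim: s => [|i s IH].
  by rewrite (_ : (fun x => _) = fun=> 0) //; apply/funext => x; rewrite big_nil.
rewrite (_ : (fun x => _) = fun x => a i * e i x + \sum_(i <- s) a i * e i x); first exact: carrL.
by apply/funext => x; rewrite big_cons.
Qed.

Lemma B_psum a s g : carr g -> B (psum a s) g = \sum_(i <- s) a i * B (e i) g.
Proof.
move=> cg; rewrite /psum; elim: s => [|i s IH].
  rewrite big_nil (_ : (fun x => _) = fun=> 0) ?form0l //; apply/funext => x; by rewrite big_nil.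
rewrite (_ : (fun x => _) = fun x => a i * e i x + psum a s x).
  rewrite BL ?IH ?big_cons //; exact: carr_psum.
by apply/funext => x; rewrite big_cons.
Qed.

Lemma coef_psum a s j : uniq s -> B (psum a s) (e j) = if j \in s then a j else 0.
Proof.
move=> us; rewrite B_psum //; case: ifPn => js.
  rewrite (bigD1_seq j) //= Be eqxx mulr1 big1 ?addr0 // => i /negbTE ij.
  by rewrite Be ij mulr0.
rewrite big_seq big1 // => i iS; rewrite Be; case: eqP iS js => [->|_ _ _]; last by rewrite mulr0.
by move=> ->.
Qed.

Lemma sqn_psum a s : uniq s -> sqn (psum a s) = \sum_(i <- s) normc (a i) ^+ 2.
Proof.
move=> us; have cs := carr_psum a s.
apply: complexI; rewrite -sqnE // B_psum // rmorph_sum [LHS]big_seq [RHS]big_seq.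
apply: eq_bigr => i iS; rewrite (Bherm cs (carre i)) coef_psum // iS.
by rewrite /= -mul_conjc.
Qed.

Lemma sqn_sub_psum f s : carr f -> uniq s ->
  sqn (fun x => (-1) * psum (fun i => B f (e i)) s x + f x) =
  sqn f - \sum_(i <- s) normc (B f (e i)) ^+ 2.
Proof.
move=> cf us; have cs := carr_psum (fun i => B f (e i)) s.
rewrite sqnL // sqn_psum // normcN normc1 expr1n mul1r mulN1r ReN B_psum //.
rewrite (eq_bigr (fun i => (normc (B f (e i)) ^+ 2)%:C%C)) => [|i _].
  rewrite -rmorph_sum /=; ring.
by rewrite (Bherm cf (carre i)) mul_conjc.
Qed.

Lemma bessel f s : carr f -> uniq s -> \sum_(i <- s) normc (B f (e i)) ^+ 2 <= sqn f.
Proof.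
move=> cf us; rewrite -subr_ge0 -sqn_sub_psum //; apply: Bpos.
apply: carrL => //; exact: carr_psum.
Qed.

Lemma bessel_esum f : carr f -> (\esum_(i in setT) (normc (B f (e i)) ^+ 2)%:E <= (sqn f)%:E)%E.
Proof.
move=> cf; rewrite leNgt; apply/negP => /lt_esum_sum[s us].
by rewrite lte_fin ltNge bessel.
Qed.

(** The square norm of f - t B(f, g) g is nonnegative for every real t, and t = 1 / |g|^2 is
    optimal. The form is only semidefinite, so |g|^2 = 0 is treated apart: if b = |B(f, g)|^2 were
    positive, t = (|f|^2 + 1) / (2 b) would produce the value -1. *)
Lemma cauchy_schwarz f g : carr f -> carr g -> normc (B f g) ^+ 2 <= sqn f * sqn g.
Proof.
move=> cf cg; have f0 : 0 <= sqn f := Bpos cf; have g0 : 0 <= sqn g := Bpos cg.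
have H (t : R) : 0 <= t ^+ 2 * normc (B f g) ^+ 2 * sqn g + sqn f - 2 * t * normc (B f g) ^+ 2.
  have := Bpos (carrL (- (t%:C%C * B f g)) cg cf); rewrite -/(sqn _) sqnL //.
  rewrite normcN normcM exprMn normcR real_normK ?num_real // (Bherm cf cg) mulNr -(mulrA t%:C%C) mul_conjc.
  by rewrite ReN -rmorphM /= => H; rewrite (le_trans H) // le_eqVlt; apply/orP; left; apply/eqP; ring.
have b0 : 0 <= normc (B f g) ^+ 2 by rewrite sqr_ge0.
move: (normc _ ^+ 2) (sqn f) (sqn g) b0 f0 g0 H => b F G b0 F0 G0 H.
have [G1|] := ltP 0 G.
  have := H G^-1; rewrite (_ : _ - _ = (F * G - b) / G); last by field; rewrite gt_eqF.
  by rewrite pmulr_lge0 ?invr_gt0 // subr_ge0.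
move=> G1; have {}G1 : G = 0 by apply/eqP; rewrite eq_le G1 G0.
rewrite G1 mulr0 leNgt; apply/negP => bp.
have := H ((F + 1) / (2 * b)); rewrite G1 mulr0 add0r.
rewrite (_ : F - _ = -1) ?oppr_ge0 ?ler10 //; field; exact: lt0r_neq0.
Qed.

(** Completeness enters as the reverse of Bessel's inequality, for f alone: f minus a large partial
    sum has square norm at most dl, and Cauchy-Schwarz against g bounds the error of the series. The
    sum is a limit along finite index sets, so the estimate must hold for every A containing s. *)
Lemma parseval f g : carr f -> carr g ->
  ((sqn f)%:E <= \esum_(i in setT) (normc (B f (e i)) ^+ 2)%:E)%E ->
  summability.sum (fun i => B f (e i) * conjc (B g (e i)) : C^o) = B f g.
Proof.
move=> cf cg fe; have f0 : 0 <= sqn f := Bpos cf; have g0 : 0 <= sqn g := Bpos cg.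
pose FF := @summability.totally_filter I.
apply: (cvg_lim (@norm_hausdorff _ _)).
suff : forall eps : C, 0 < eps -> \forall A \near @summability.totally I,
    `|B f g - (summability.partial_sum (fun i => B f (e i) * conjc (B g (e i)) : C^o) A : C)| <= eps.
  by move=> H; apply/(@cvgrPdist_le C C^o).
move=> _ /complex_gt0P[r r0 ->].
pose dl := r ^+ 2 / (sqn g + 1).
have g1 : 0 < sqn g + 1 by rewrite ltr_wpDl.
have d0 : 0 < dl by rewrite divr_gt0 // exprn_gt0.
have : ((sqn f - dl)%:E < \esum_(i in setT) (normc (B f (e i)) ^+ 2)%:E)%E.
  by apply: lt_le_trans fe; rewrite lte_fin gtrBl.
move=> /lt_esum_sum[s us]; rewrite lte_fin => Hs.
exists (finmap.seq_fset tt s) => // A /= sA.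
have uA := finmap.fset_uniq A.
rewrite /summability.partial_sum.
rewrite (_ : \sum_i _ = B (psum (fun i => B f (e i)) (finmap.enum_fset A)) g); last first.
  rewrite B_psum // (finmap.big_seq_fsetE _ A xpredT (fun i => B f (e i) * B (e i) g)).
  by apply: eq_bigr => i _; rewrite (Bherm cg (carre _)) .
rewrite normcT lecR.
pose h := fun x => (-1) * psum (fun i => B f (e i)) (finmap.enum_fset A) x + f x.
have ch : carr h by apply: carrL => //; exact: carr_psum.
rewrite (_ : B f g - _ = B h g); last by rewrite BL //; [rewrite mulN1r addrC|exact: carr_psum].
rewrite -(@ler_pXn2r _ 2) ?nnegrE ?normc_ge0 ?(ltW r0) //.
apply: (le_trans (cauchy_schwarz ch cg)); rewrite sqn_sub_psum //.
apply: (@le_trans _ _ (dl * sqn g)); last first.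
  by rewrite /dl mulrAC ler_pdivrMr // ler_wpM2l ?sqr_ge0 // lerDl.
apply: ler_wpM2r => //; rewrite lerBlDr addrC -lerBlDr.
apply: (le_trans (ltW Hs)); apply: sum_uniq_le => // [i|i iS]; first by rewrite sqr_ge0.
by have /finmap.fsubsetP := sA; apply; rewrite finmap.sort_keysE.
Qed.

End InnerProduct.

(** * The Bergman space *)

Section BergmanSpace.
Context {R : realType} {n : nat}.
Variable alpha : R.
Hypothesis alpha_gt : -1 < alpha.
Local Notation C := (R[i]).
Local Notation V := ('rV[C]_n).
Local Notation mu := (lebesgueC R n).
Local Notation D := (@uball_coords R n).
Local Notation W := (fun w : n.-tuple (plane R) => bergman_weight alpha (vecC w)).
Local Notation H := (bergman n alpha).
Implicit Types (f g : V -> C) (m : mindex n) (z : V).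

Lemma normsq_vecC (w : n.-tuple (plane R)) : normsq (vecC w) = tsq w.
Proof.
by rewrite /normsq /tsq; apply: eq_bigr => i _; rewrite mxE sqr_normc_def.
Qed.

Lemma uball_coordsE : D = [set w | tsq w < 1].
Proof. by rewrite /uball_coords /uball; apply/seteqP; split => w /=; rewrite normsq_vecC. Qed.

Lemma measurable_uball_coords : measurable D.
Proof.
rewrite uball_coordsE -[X in measurable X]setTI.
have -> : [set w | tsq w < 1] = (@tsq R n) @^-1` `]-oo, 1[%classic.
  by apply/seteqP; split => w /=; rewrite in_itv.
exact: (@measurable_tsq R n).
Qed.

Definition mzero : mindex n := [ffun=> 0%N].

Lemma tpw_zero w : tpw mzero w = 1 :> R.
Proof. by rewrite /tpw big1 // => i _; rewrite ffunE expr0. Qed.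

Lemma lebesgueC_uball : mu D = (pi ^+ n / n`!%:R)%:E.
Proof.
transitivity (Imom mzero (0 : R)).
  rewrite -[LHS]mul1e -integral_cst; last exact: measurable_uball_coords.
  rewrite integral_mkcond /Imom; apply: eq_integral => w _.
  rewrite patchE uball_coordsE tpw_zero powRr0 mulr1.
  by case: ifPn => [/set_mem /= ->|/negP H] //; case: ifP => // w1; case: H; exact/mem_set.
rewrite ImomE ?ltrN10 // !addr0 add0r Gamma1 /mfact big1 => [|i _]; last by rewrite ffunE.
rewrite /mdeg big1 => [|i _]; last by rewrite ffunE.
by rewrite addr0 natr1 Gamma_nat !mulr1.
Qed.

(** The constant c_alpha divided by the volume pi^n / n! of the ball, after cancelling n!. *)
Definition kappa : R := Gamma (n%:R + alpha + 1) / (pi ^+ n * Gamma (alpha + 1)).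

Lemma alpha1 : 0 < alpha + 1.
Proof. by rewrite -ltrBlDr sub0r. Qed.

Lemma nalpha1 k : 0 < n%:R + k%:R + alpha + 1.
Proof. by rewrite -addrA ltr_wpDl ?alpha1 // addr_ge0. Qed.

Lemma GammaN_gt0 : 0 < Gamma (n%:R + alpha + 1).
Proof. by have := Gamma_gt0 (nalpha1 0); rewrite addr0. Qed.

Lemma kappa_gt0 : 0 < kappa.
Proof.
by rewrite divr_gt0 ?GammaN_gt0 // mulr_gt0 ?exprn_gt0 ?pi_gt0 // Gamma_gt0 // alpha1.
Qed.

Lemma weightE w : W w = kappa * (1 - tsq w) `^ alpha.
Proof.
rewrite /bergman_weight lebesgueC_uball normsq_vecC /kappa /=.
have ? : pi ^+ n != 0 :> R by rewrite lt0r_neq0 // exprn_gt0 // pi_gt0.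
have ? : n`!%:R != 0 :> R by rewrite pnatr_eq0 -lt0n fact_gt0.
have ? : Gamma (alpha + 1) != 0 by rewrite lt0r_neq0 // Gamma_gt0 // alpha1.
by field; do ?[apply/andP; split].
Qed.

Lemma weight_ge0 w : D w -> 0 <= W w.
Proof. by move=> _ /=; rewrite weightE mulr_ge0 ?powR_ge0 // ltW // kappa_gt0. Qed.

Lemma measurable_weight (E : set _) : measurable_fun E W.
Proof.
apply: (@measurable_funS _ _ _ _ setT) => //.
rewrite (_ : W = fun w => kappa * (1 - tsq w) `^ alpha); last by apply/funext => w; exact: weightE.
apply: measurable_funM; first exact: measurable_cst.
apply: (measurableT_comp (measurable_fun_pow alpha (D := setT))).
by apply: measurable_funB; [exact: measurable_cst|exact: measurable_tsq].
Qed.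

Lemma cm_coord (E : set _) (i : 'I_n) : cm E (fun w => (vecC w : V) 0 i).
Proof.
split.
  rewrite (_ : (fun w => _) = fun w => (tnth w i).1 : R); last by apply/funext => w; rewrite mxE.
  apply: (@measurable_funS _ _ _ _ setT) => //.
  exact: (measurableT_comp measurable_fst (measurable_tnth i)).
rewrite (_ : (fun w => _) = fun w => (tnth w i).2 : R); last by apply/funext => w; rewrite mxE.
apply: (@measurable_funS _ _ _ _ setT) => //.
exact: (measurableT_comp measurable_snd (measurable_tnth i)).
Qed.

Lemma cm_monomial m : cm D (fun w => monomial m (vecC w : V)).
Proof.
apply: (@eq_cm _ _ _ _ (fun w => \prod_(i < n) ((vecC w : V) 0 i) ^+ m i)).
  by move=> w; rewrite /uball_coords /uball /monomial /= => ->.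
by apply: cm_prod => i; apply: cmX; exact: cm_coord.
Qed.

Lemma hp_ptcvg f z : hol_ball f -> uball z -> ptcvg (fun J => \sum_(j < J.+1) hp f j z) (f z).
Proof.
move=> hf zb e e0; have [K [q [q0 q1 Kq]]] := hp_expansion hf zb.
have K0 : 0 <= K by have := Kq 0%N; rewrite expr0 mulr1; apply: le_trans; exact: normc_ge0.
have : (fun J => K * q ^+ J) @ \oo --> K * 0.
  by apply: cvgMl_tmp; apply: cvg_expr; rewrite ger0_norm.
rewrite mulr0 => /cvgrPdist_le /(_ _ e0)[N0 _ HN]; exists N0 => N /HN /=.
rewrite sub0r normrN ger0_norm ?mulr_ge0 ?exprn_ge0 // => h.
by rewrite normc_distC (le_trans (Kq N)).
Qed.

(** On the ball f is the pointwise limit of the partial sums of its homogeneous expansion, which are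
    polynomials. *)
Lemma cm_hol f : hol_ball f -> cm D (fun w => f (vecC w)).
Proof.
move=> hf; apply: (@cm_lim _ _ _ _ (fun J w => \sum_(j < J.+1)
  (if tsq w < 1 then hp f j (vecC w) else 0))).
  move=> J; apply: cm_sum => j; have [s [_ Hs]] := hp_polynomial j hf.
  apply: (@eq_cm _ _ _ _ (fun w => \sum_(p <- s) p.1 * monomial p.2 (vecC w))).
    by move=> w Dw; move: (Dw); rewrite uball_coordsE /= => ->; rewrite Hs.
  by apply: cm_sum => p; apply: cmM; [exact: cm_cst|exact: cm_monomial].
move=> w Dw; have := hp_ptcvg hf (Dw : uball (vecC w)).
congr (ptcvg _ _); apply/funext => J; apply: eq_bigr => j _.
by move: Dw; rewrite uball_coordsE /= => ->.
Qed.

Local Notation pull f := (fun w => f (vecC w)).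

Lemma bergmanP f : carrier H f <->
  [/\ forall z, ~ uball z -> f z = 0, hol_ball f & (l2 mu D W (pull f) < +oo)%E].
Proof.
split=> -[f0 hf lf]; split=> // z zb.
  by apply: differentiable_hol; exact: hf.
by apply: hol_differentiable; exact: hf.
Qed.

Lemma bergman_inL2 f : carrier H f -> inL2 mu D W (pull f).
Proof. by move=> /bergmanP[_ hf lf]; split => //; exact: cm_hol. Qed.

Lemma ipE f g : ip H f g = cip mu D W (pull f) (pull g).
Proof. by []. Qed.

Lemma bergman0 : carrier H (fun=> 0).
Proof.
apply/bergmanP; split=> // [z _|]; first exact: hol_at_cst.
rewrite /l2 (eq_integral (fun=> 0%E)) ?integral0 // => w _.
by rewrite normc0 expr0n mul0r.
Qed.

Lemma bergmanL (a : C) f g : carrier H f -> carrier H g -> carrier H (fun x => a * f x + g x).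
Proof.
move=> cf cg; have /bergmanP[f0 hf _] := cf; have /bergmanP[g0 hg _] := cg.
apply/bergmanP; split=> [z zb|z zb|]; first by rewrite f0 // g0 // mulr0 addr0.
  by apply: hol_atD; [apply: hol_atZ; exact: hf|exact: hg].
by have [] := inL2_D measurable_uball_coords (measurable_weight (E := D)) weight_ge0
  (inL2_Z measurable_uball_coords (measurable_weight (E := D)) weight_ge0 a (bergman_inL2 cf)) (bergman_inL2 cg).
Qed.

Lemma ip_linear (a : C) f g h : carrier H f -> carrier H g -> carrier H h ->
  ip H (fun x => a * f x + g x) h = a * ip H f h + ip H g h.
Proof.
move=> cf cg ch; rewrite !ipE.
have mW := measurable_weight (E := D); have mD := measurable_uball_coords.
have lZ := inL2_Z mD mW weight_ge0 a (bergman_inL2 cf).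
rewrite (cipD mD mW weight_ge0 lZ (bergman_inL2 cg) (bergman_inL2 ch)).
by rewrite (cipZ mD mW weight_ge0 a (bergman_inL2 cf) (bergman_inL2 ch)).
Qed.

Lemma ip_herm f g : carrier H f -> carrier H g -> ip H g f = conjc (ip H f g).
Proof.
move=> cf cg; rewrite !ipE.
exact: (cipC measurable_uball_coords (measurable_weight (E := D)) weight_ge0
  (bergman_inL2 cf) (bergman_inL2 cg)).
Qed.

Lemma sqn_l2 f : carrier H f -> (sqn (ip H) f)%:E = l2 mu D W (pull f).
Proof.
move=> cf; rewrite /sqn ipE.
rewrite (cip_norm measurable_uball_coords (bergman_inL2 cf)) /=.
rewrite fineK // ge0_fin_numE; first by case: (bergman_inL2 cf).
exact: l2_ge0 weight_ge0 _.
Qed.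

Lemma ip_ge0 f : carrier H f -> 0 <= complex.Re (ip H f f).
Proof.
move=> cf; rewrite -lee_fin -/(sqn _ _) sqn_l2 //; exact: l2_ge0 weight_ge0 _.
Qed.

End BergmanSpace.

(** * The torus action on functions *)

Section Torus.
Context {R : realType} {n : nat}.
Local Notation C := (R[i]).
Local Notation V := ('rV[C]_n).
Implicit Types (f g : V -> C) (m k : mindex n) (z : V) (t : 'I_n -> C).

Definition rotv t z : V := \row_i (t i * z 0 i).

Lemma normsq_rotv t z : (forall i, normc (t i) = 1) -> normsq (rotv t z) = normsq z.
Proof. by move=> t1; apply: eq_bigr => i _; rewrite mxE normcM t1 mul1r. Qed.

Lemma uball_rotv t z : (forall i, normc (t i) = 1) -> uball (rotv t z) = uball z.
Proof. by move=> t1; rewrite /uball /= normsq_rotv. Qed.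

Lemma monomial_rotv t m z : (forall i, normc (t i) = 1) ->
  monomial m (rotv t z) = (\prod_i t i ^+ m i) * monomial m z.
Proof.
move=> t1; rewrite /monomial normsq_rotv //; case: ifP => _; last by rewrite mulr0.
by rewrite -big_split; apply: eq_bigr => i _ /=; rewrite mxE exprMn.
Qed.

Lemma rotv_cst (c : C) z : rotv (fun=> c) z = c *: z.
Proof. by apply/rowP => i; rewrite !mxE. Qed.

Lemma hol_at_rotv f t z : (forall i, normc (t i) = 1) -> hol_at f (rotv t z) ->
  hol_at (fun x => f (rotv t x)) z.
Proof.
move=> t1 [l K]; exists (fun i => l i * t i) => e /K[r r0 {}K]; exists r => // h hr.
have nh : nrm (rotv t h) = nrm h by apply: eq_bigr => i _; rewrite mxE normcM t1 mul1r.
have := K (rotv t h); rewrite nh => /(_ hr).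
rewrite (_ : rotv t (z + h) = rotv t z + rotv t h); last first.
  by apply/rowP => i; rewrite !mxE mulrDr.
rewrite (_ : lin l _ = lin (fun i => l i * t i) h) //.
by apply: eq_bigr => i _; rewrite mxE mulrA.
Qed.

Lemma vecC_tmap t (w : n.-tuple (plane R)) :
  vecC (tmap (fun i => rot (complex.Re (t i)) (complex.Im (t i))) w) = rotv t (vecC w).
Proof.
apply/rowP => i; rewrite !mxE tnth_mktuple /rot.
by apply: complexP; rewrite ?ReM ?ImM /= // addrC.
Qed.

Definition rot1 (i : 'I_n) (c : C) : 'I_n -> C := fun j => if j == i then c else 1.

Lemma normc_rot1 i c : normc c = 1 -> forall j, normc (rot1 i c j) = 1.
Proof. by move=> c1 j; rewrite /rot1; case: ifP => // _; rewrite normc1. Qed.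

Lemma monomial_rot1 i c m z : normc c = 1 ->
  monomial m (rotv (rot1 i c) z) = c ^+ m i * monomial m z.
Proof.
move=> /(normc_rot1 i) c1; rewrite monomial_rotv //; congr (_ * _).
rewrite (bigD1 i) //= big1 ?mulr1 /rot1 ?eqxx // => j /negbTE ->.
by rewrite expr1n.
Qed.

End Torus.

(** * Orthonormality of the normalized monomials *)

Section Basis.
Context {R : realType} {n : nat}.
Variable alpha : R.
Hypothesis alpha_gt : -1 < alpha.
Local Notation C := (R[i]).
Local Notation V := ('rV[C]_n).
Local Notation mu := (lebesgueC R n).
Local Notation D := (@uball_coords R n).
Local Notation W := (fun w : n.-tuple (plane R) => bergman_weight alpha (vecC w)).
Local Notation H := (bergman n alpha).
Local Notation pull f := (fun w => f (vecC w)).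
Implicit Types (f g : V -> C) (m k : mindex n) (z : V) (t : 'I_n -> C).

(** Rotating each coordinate preserves Lebesgue measure, and both the ball and the weight depend on
    |z| alone. *)
Lemma l2_rotv f t : (forall i, normc (t i) = 1) -> cm D (pull f) ->
  l2 mu D W (fun w => f (rotv t (vecC w))) = l2 mu D W (pull f).
Proof.
move=> t1 cf; rewrite /l2 integral_mkcond [RHS]integral_mkcond.
have mh := measurable_l2 (measurable_weight (E := D) alpha_gt) cf.
pose h := (fun w => (normc (f (vecC w)) ^+ 2 * W w)%:E).
rewrite -/h; have mhD : measurable_fun setT (h \_ D).
  by apply/(measurable_restrictT h (@measurable_uball_coords R n)).
pose phi (i : 'I_n) := rot (complex.Re (t i)) (complex.Im (t i)).
have := @scales_tmap R n phi (fun=> 1) (fun i => measurable_rot _ _) (fun=> ler01) _ _ mhD.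
rewrite big1 // mul1e => <-.
- apply: eq_integral => w _; rewrite !patchE /phi.
  rewrite /h /= vecC_tmap /bergman_weight normsq_rotv //.
  have -> : (w \in D) = (tmap phi w \in D); last by [].
  by apply/idP/idP => /set_mem Dw; apply/mem_set; move: Dw; rewrite /uball_coords /= vecC_tmap uball_rotv.
- move=> i; apply: scales_rot; rewrite -sqr_normc_def t1 expr1n //.
- move=> w; rewrite patchE; case: ifP => // /set_mem Dw.
  rewrite lee_fin; apply: mulr_ge0; first exact: sqr_ge0.
  exact: weight_ge0 alpha_gt _ Dw.
Qed.

Lemma bergman_rotv f t : (forall i, normc (t i) = 1) -> carrier H f ->
  carrier H (fun z => f (rotv t z)).
Proof.
move=> t1 /bergmanP[f0 hf lf]; apply/bergmanP; split=> [z zb|z zb|].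
- by apply: f0; rewrite uball_rotv.
- by apply: hol_at_rotv => //; apply: hf; rewrite uball_rotv.
- by rewrite l2_rotv //; exact: cm_hol.
Qed.

Lemma ip_rotv f g t : (forall i, normc (t i) = 1) -> carrier H f -> carrier H g ->
  ip H (fun z => f (rotv t z)) (fun z => g (rotv t z)) = ip H f g.
Proof.
move=> t1 cf cg.
apply: (polarization (@bergmanL R n alpha alpha_gt) (@ip_linear R n alpha alpha_gt)
  (@ip_herm R n alpha alpha_gt) (U := fun f z => f (rotv t z))) => // h ch; first exact: bergman_rotv.
apply: EFin_inj; rewrite !sqn_l2 //; last exact: bergman_rotv.
by rewrite l2_rotv //; have /bergmanP[_ hh _] := ch; exact: cm_hol.
Qed.

(** Stated for eigenvectors of the rotations of one coordinate rather than for monomials, because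
    [intertwiner_e] applies it to the image of a basis vector under T. *)
Lemma ip_weight_orth h g i (a b : nat) : carrier H h -> carrier H g ->
  (forall c z, normc c = 1 -> h (rotv (rot1 i c) z) = c ^+ a * h z) ->
  (forall c z, normc c = 1 -> g (rotv (rot1 i c) z) = c ^+ b * g z) ->
  a != b -> ip H h g = 0.
Proof.
move=> ch cg hh gg ab.
(* Chosen so that c ^ a times the conjugate of c ^ b is e^(i pi) = -1; invariance of the inner
   product then makes it equal to its opposite. *)
pose c : C := cis (pi / (a%:R - b%:R)).
have c1 : normc c = 1 by rewrite normc_cis.
have := ip_rotv (normc_rot1 i c1) ch cg.
have -> : (fun z => h (rotv (rot1 i c) z)) = fun z => c ^+ a * h z.
  by apply/funext => z; rewrite hh.
have -> : (fun z => g (rotv (rot1 i c) z)) = fun z => c ^+ b * g z.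
  by apply/funext => z; rewrite gg.
have := form_scale (bergman0 alpha) (bergmanL alpha_gt) (ip_linear alpha_gt) (ip_herm alpha_gt)
  (c ^+ a) (c ^+ b) ch cg.
have -> : c ^+ a * conjc (c ^+ b) = -1.
  have cX j : c ^+ j = cis (pi / (a%:R - b%:R) * j%:R).
    elim: j => [|j IH]; first by rewrite mulr0 cis0.
    by rewrite exprS IH -cisD -natr1; congr cis; ring.
  have cJ (x : R) : conjc (cis x) = cis (- x) by rewrite /cis /= cosN sinN.
  rewrite !cX cJ -cisD -mulrBr mulfVK; last by rewrite subr_eq0 eqr_nat.
  by rewrite /cis cospi sinpi; apply: complexP => /=; rewrite ?oppr0.
by move=> -> /eqP; rewrite mulN1r eq_sym -subr_eq0 opprK -mulr2n mulrn_eq0 /= => /eqP ->.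
Qed.

Definition ecoef m : R := Num.sqrt (Gamma (n%:R + (mdeg m)%:R + alpha + 1)
             / ((mfact m)%:R * Gamma (n%:R + alpha + 1))).

Lemma mfact_gt0 m : (0 < mfact m)%N.
Proof. by apply: prodn_gt0 => i; exact: fact_gt0. Qed.

Lemma ecoef_sqr m : ecoef m ^+ 2 = Gamma (n%:R + (mdeg m)%:R + alpha + 1)
             / ((mfact m)%:R * Gamma (n%:R + alpha + 1)).
Proof.
have G1 := Gamma_gt0 (nalpha1 (n := n) alpha_gt (mdeg m)).
have G2 := GammaN_gt0 (n := n) alpha_gt.
have M0 : (0 : R) < (mfact m)%:R by rewrite ltr0n mfact_gt0.
exact: sqr_sqrtr (divr_ge0 (ltW G1) (ltW (mulr_gt0 M0 G2))).
Qed.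

Lemma ecoef_gt0 m : 0 < ecoef m.
Proof.
have G1 := Gamma_gt0 (nalpha1 (n := n) alpha_gt (mdeg m)).
have G2 := GammaN_gt0 (n := n) alpha_gt.
have M0 : (0 : R) < (mfact m)%:R by rewrite ltr0n mfact_gt0.
by rewrite sqrtr_gt0; exact: divr_gt0 G1 (mulr_gt0 M0 G2).
Qed.

Lemma l2_monomial m : l2 mu D W (pull (monomial m)) = (ecoef m ^- 2)%:E.
Proof.
have k0 := kappa_gt0 (n := n) alpha_gt.
transitivity ((@kappa R n alpha)%:E * Imom m alpha)%E.
  rewrite /l2 integral_mkcond /Imom -ge0_integralZl_EFin //; last 3 first.
  - by move=> w _; rewrite lee_fin; case: ifP => // _; rewrite mulr_ge0 ?tpw_ge0 ?powR_ge0.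
  - apply/measurable_EFinP; apply: measurable_fun_ifT.
    + by apply: measurable_fun_ltr; [exact: measurable_tsq|exact: measurable_cst].
    + apply: measurable_funM; first exact: measurable_tpw.
      apply: (measurableT_comp (measurable_fun_pow alpha (D := setT))).
      by apply: measurable_funB; [exact: measurable_cst|exact: measurable_tsq].
    + exact: measurable_cst.
  - exact: ltW.
  apply: eq_integral => w _; rewrite patchE -EFinM.
  have -> : (w \in D) = (tsq w < 1).
    by apply/idP/idP => [/set_mem|h]; [|apply/mem_set]; rewrite uball_coordsE.
  case: ifPn => w1; last by rewrite mulr0.
  rewrite weightE // mulrCA; congr (_ * (_ * _))%:E.
  rewrite /monomial normsq_vecC w1 /tpw.
  rewrite (big_morph (fun z : C => normc z ^+ 2) (id1 := 1) (op1 := *%R)); last 2 first.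
  - by move=> x y; rewrite normcM exprMn.
  - by rewrite normc1 expr1n.
  by apply: eq_bigr => i _; rewrite normcX exprAC sqr_normc_def mxE.
rewrite ImomE // -EFinM ecoef_sqr /kappa; congr _%:E.
have g1 : Gamma (alpha + 1) != 0 by rewrite lt0r_neq0 // Gamma_gt0 // alpha1.
have g2 := lt0r_neq0 (Gamma_gt0 (nalpha1 (n := n) alpha_gt (mdeg m))).
have g3 := lt0r_neq0 (GammaN_gt0 (n := n) alpha_gt).
have p0 : pi ^+ n != 0 :> R by rewrite lt0r_neq0 // exprn_gt0 // pi_gt0.
have m0 : (mfact m)%:R != 0 :> R by rewrite pnatr_eq0 -lt0n mfact_gt0.
move: (Gamma (alpha + 1)) (Gamma (n%:R + (mdeg m)%:R + alpha + 1)) (Gamma (n%:R + alpha + 1)) g1 g2 g3.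
move: (pi ^+ n) (mfact m)%:R p0 m0 => p M p0 M0 x y z x0 y0 z0.
by field; do ?[apply/andP; split].
Qed.

Lemma carrier_monomial m : carrier H (monomial m).
Proof.
apply/bergmanP; split.
- by move=> z; rewrite /uball /= /monomial; case: ifP.
- exact: hol_ball_monomial.
- by rewrite l2_monomial ltry.
Qed.

Lemma carrierZ (a : C) f : carrier H f -> carrier H (fun z => a * f z).
Proof.
move=> cf; have := bergmanL alpha_gt a cf (bergman0 _).
by congr (carrier H _); apply/funext => z; rewrite addr0.
Qed.

Lemma carrier_e m : carrier H (e_ alpha m).
Proof. by apply: carrierZ; exact: carrier_monomial. Qed.

Lemma ip_e m k : ip H (e_ alpha m) (e_ alpha k) = (m == k)%:R.
Proof.
have [<-|mk] := eqVneq m k.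
  rewrite (sqnE (ip_herm alpha_gt) (carrier_e m)) mulr1n; congr (_%:C)%C.
  apply: EFin_inj; rewrite (sqn_l2 alpha_gt (carrier_e m)) l2Z; last exact: cm_monomial.
  - rewrite l2_monomial -EFinM normcR gtr0_norm ?ecoef_gt0 // mulfV //.
    by rewrite expf_neq0 // lt0r_neq0 // ecoef_gt0.
  - exact: measurable_uball_coords.
  - exact: measurable_weight.
  - exact: weight_ge0.
have [i mki] : exists i, m i != k i.
  by apply/existsP; rewrite -negb_forall; apply: contra mk => /forallP mk; apply/eqP/ffunP => i; apply/eqP.
have rot_e j (c : C) z : normc c = 1 ->
    e_ alpha j (rotv (rot1 i c) z) = c ^+ j i * e_ alpha j z.
  by move=> c1; rewrite /e_ monomial_rot1 // mulrCA.
exact: ip_weight_orth (carrier_e m) (carrier_e k) (rot_e m) (rot_e k) mki.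
Qed.

End Basis.

(** * Averages over roots of unity *)

Section RootsOfUnity.
Context {R : realType}.
Local Notation C := (R[i]).

Definition zeta (N : nat) : C := cis (2 * pi / N%:R).

Lemma cisX (x : R) k : cis x ^+ k = cis (x * k%:R).
Proof.
elim: k => [|k IH]; first by rewrite mulr0 cis0.
by rewrite exprS IH -cisD -natr1; congr cis; ring.
Qed.

Lemma normc_zeta N l : normc (zeta N ^+ l) = 1.
Proof. by rewrite cisX normc_cis. Qed.

Lemma zeta_expN N : (0 < N)%N -> zeta N ^+ N = 1.
Proof. by move=> N0; rewrite cisX mulfVK ?cis2pi // pnatr_eq0 -lt0n. Qed.

Lemma zeta_neq1 N k : (0 < k < N)%N -> zeta N ^+ k != 1.
Proof.
move=> /andP[k0 kN]; have N1 : (0 < N)%N by apply: leq_trans kN.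
have N0 : (0 : R) < N%:R by rewrite ltr0n.
rewrite cisX; apply/eqP => /(congr1 (@complex.Re R)) /=.
(* Half the angle: cos (2 x) = 1 would force sin x = 0, while 0 < x < pi. *)
pose x : R := pi / N%:R * k%:R.
have -> : 2 * pi / N%:R * k%:R = x *+ 2 by rewrite /x mulr2n; ring.
rewrite cos_mulr2n => h.
have : 0 < sin x.
  apply: sin_gt0_pi; rewrite !mulr_gt0 ?pi_gt0 ?invr_gt0 ?ltr0n //=.
  by rewrite /x mulrAC ltr_pdivrMr // ltr_pM2l ?pi_gt0 // ltr_nat.
move=> s0; have := cos2Dsin2 x; have : 0 < sin x ^+ 2 by rewrite exprn_gt0.
move: h; rewrite mulr2n; move: (cos x ^+ 2) (sin x ^+ 2) => a b.
lra.
Qed.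

Lemma zeta_expN_inj N j k : (j < k < N)%N -> zeta N ^+ j != zeta N ^+ k.
Proof.
move=> /andP[jk kN]; rewrite -(subnK (ltnW jk)) exprD -subr_eq0 -{1}[_ ^+ j]mul1r -mulrBl mulf_neq0 //.
  by rewrite subr_eq0 eq_sym zeta_neq1 // subn_gt0 jk (leq_ltn_trans (leq_subr _ _)).
by rewrite -normc_eq0 normc_zeta oner_eq0.
Qed.

Lemma sum_zeta N j k : (j < N)%N -> (k < N)%N ->
  \sum_(l < N) (zeta N ^+ l)^-1 ^+ k * (zeta N ^+ l) ^+ j = N%:R * (j == k)%:R.
Proof.
move=> jN kN; have N0 : (0 < N)%N by exact: leq_trans jN.
have z0 l : zeta N ^+ l != 0 by rewrite -normc_eq0 normc_zeta oner_eq0.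
pose w := (zeta N ^+ k)^-1 * zeta N ^+ j.
have wl (l : nat) : (zeta N ^+ l)^-1 ^+ k * (zeta N ^+ l) ^+ j = w ^+ l.
  by rewrite /w exprMn !exprVn -!exprM mulnC [(j * l)%N]mulnC.
rewrite (eq_bigr (fun l : 'I_N => w ^+ l)) => [|l _]; last exact: wl.
have [jk|jk] := eqVneq j k.
  have -> : w = 1 by rewrite /w jk mulVf.
  by under eq_bigr do rewrite expr1n; rewrite sumr_const card_ord mulr1.
rewrite mulr0; apply/eqP.
have w1 : w != 1.
  have zjk : zeta N ^+ j != zeta N ^+ k.
    have := jk; rewrite neq_ltn => /orP[?|?]; first by rewrite zeta_expN_inj ?kN ?andbT.
    by rewrite eq_sym zeta_expN_inj ?jN ?andbT.
  by apply: contra zjk => /eqP wE; apply/eqP; rewrite -[LHS](mulVKf (z0 k)) -/w wE mulr1.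
have : (w - 1) * \sum_(l < N) w ^+ l == 0.
  rewrite -subrX1 exprMn exprVn -!exprM [(k * N)%N]mulnC [(j * N)%N]mulnC !exprM zeta_expN //.
  by rewrite !expr1n invr1 mulr1 subrr.
by rewrite mulf_eq0 subr_eq0 (negbTE w1).
Qed.

Lemma sum_geometric_le (q K : R) (N M : nat) : 0 <= q -> q < 1 -> 0 <= K ->
  \sum_(i < M) K * q ^+ (N + i) <= K * q ^+ N / (1 - q).
Proof.
move=> q0 q1 K0; have q1' : 0 < 1 - q by rewrite subr_gt0.
rewrite ler_pdivlMr //; apply: (@le_trans _ _ (K * q ^+ N - K * q ^+ (N + M))).
  elim: M => [|M IH]; first by rewrite big_ord0 mul0r addn0 subrr.
  rewrite big_ord_recr /= mulrDl addnS exprS.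
  have := lerD IH (lexx (K * q ^+ (N + M) * (1 - q))).
  by rewrite (_ : _ - _ + _ = K * q ^+ N - K * (q * q ^+ (N + M))) //; ring.
by rewrite gerBl mulr_ge0 // exprn_ge0.
Qed.

(* Averaging over the N-th roots of unity kills the coefficients j < N other
   than k; the remaining ones are O(q^N). *)
Lemma zeta_average (h : C -> C) (u : nat -> C) (K q : R) k : 0 <= q -> q < 1 -> 0 <= K ->
  (forall j, normc (u j) <= K * q ^+ j) ->
  (forall c, normc c = 1 -> ptcvg (fun J => \sum_(j < J.+1) c ^+ j * u j) (h c)) ->
  ptcvg (fun N => N%:R^-1 * \sum_(l < N) (zeta N ^+ l)^-1 ^+ k * h (zeta N ^+ l)) (u k).
Proof.
move=> q0 q1 K0 uK hu; have q1' : 0 < 1 - q by rewrite subr_gt0.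
(* The limit h c is replaced by a longer partial sum at the cost of an arbitrary e; the extra terms
   form a geometric series whose bound does not depend on its length. *)
have tail N c : normc c = 1 -> normc (h c - \sum_(j < N) c ^+ j * u j) <= K * q ^+ N / (1 - q).
  move=> c1; apply/ler_addgt0Pr => e e0; have [J HJ] := hu c c1 e e0.
  have := HJ (N + J)%N (leq_addl _ _); rewrite -addnS big_split_ord /= => Hc.
  set S := \sum_(j < N) _ in Hc *; set T := \sum_(j < J.+1) _ in Hc.
  rewrite (_ : h c - S = T - (S + T - h c)); last by ring.
  apply: le_trans (normcB _ _) _; apply: lerD => //.
  apply: le_trans (sum_geometric_le N J.+1 q0 q1 K0).
  rewrite /T; elim/big_ind2 : _ => [|x y x' y' A B|i _]; first by rewrite normc0.
    by apply: le_trans (normcD _ _) _; exact: lerD.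
  by rewrite normcM normcX c1 expr1n mul1r.
move=> e e0.
have : (fun N => (K / (1 - q)) * q ^+ N) @ \oo --> (K / (1 - q)) * 0.
  by apply: cvgMl_tmp; apply: cvg_expr; rewrite ger0_norm.
rewrite mulr0 => /cvgrPdist_le /(_ _ e0)[N0 _ HN]; exists (maxn N0 k.+1) => N.
rewrite geq_max => /andP[/HN /= eN kN].
have N00 : (0 < N)%N by exact: leq_trans kN.
have NC : (N%:R : C) != 0 by rewrite pnatr_eq0 -lt0n.
have -> : u k = N%:R^-1 * \sum_(l < N) (zeta N ^+ l)^-1 ^+ k * (\sum_(j < N) (zeta N ^+ l) ^+ j * u j).
  under eq_bigr do rewrite mulr_sumr; rewrite exchange_big /=.
  rewrite (eq_bigr (fun j : 'I_N => N%:R * (val j == k)%:R * u j)) => [|j _]; last first.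
    by under eq_bigr do rewrite mulrA; rewrite -mulr_suml sum_zeta.
  rewrite (bigD1 (Ordinal kN)) //= eqxx mulr1 big1 ?addr0 ?mulKf // => j jk.
  by rewrite (_ : (val j == k) = false) ?mulr0 ?mul0r //; apply: contra_neqF jk => /eqP jk; exact: val_inj.
rewrite -mulrBr -sumrB normcM normcV.
have -> : normc (N%:R : C) = N%:R by rewrite -(rmorph_nat (real_complex R)) normcR ger0_norm.
rewrite ler_pdivrMl ?ltr0n //.
move: eN; rewrite sub0r normrN ger0_norm; last by rewrite mulr_ge0 ?exprn_ge0 // divr_ge0 // ltW.
move=> eN; apply: (@le_trans _ _ (\sum_(l < N) e)); last by rewrite sumr_const card_ord mulr_natl.
elim/big_ind2 : _ => [|x y x' y' A B'|l _]; first by rewrite normc0.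
  by apply: le_trans (normcD _ _) _; exact: lerD.
rewrite -mulrBr normcM normcX normcV normc_zeta invr1 expr1n mul1r.
by apply: le_trans (tail _ _ (normc_zeta _ _)) _; rewrite mulrAC.
Qed.

End RootsOfUnity.

(** * Homogeneous components as averages *)

Section Homogeneous.
Context {R : realType} {n : nat}.
Local Notation C := (R[i]).
Local Notation V := ('rV[C]_n).
Implicit Types (f g : V -> C) (m : mindex n) (z : V).

Lemma monomial_scale (c : C) m z : normc c = 1 -> monomial m (c *: z) = c ^+ mdeg m * monomial m z.
Proof.
move=> c1; rewrite -rotv_cst monomial_rotv //; congr (_ * _).
by rewrite /mdeg prodrXr.
Qed.

Lemma hp_homogeneous f j (c : C) z : hol_ball f -> uball z -> normc c = 1 ->
  hp f j (c *: z) = c ^+ j * hp f j z.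
Proof.
move=> hf zb c1; have [s [sd Hs]] := hp_polynomial j hf.
have cb : uball (c *: z) by apply: uball_shrink; rewrite ?c1.
rewrite !Hs // mulr_sumr !big_seq; apply: eq_bigr => p /sd pj.
by rewrite monomial_scale // pj mulrCA.
Qed.

Lemma hp_bound f z : hol_ball f -> uball z -> exists (K q : R),
  [/\ 0 <= q, q < 1, 0 <= K & forall j, normc (hp f j z) <= K * q ^+ j].
Proof.
move=> hf zb; have [K [q [q0 q1 Kq]]] := hp_expansion hf zb.
have K0 : 0 <= K by have := Kq 0%N; rewrite expr0 mulr1; apply: le_trans; exact: normc_ge0.
(* Each component is a difference of consecutive remainders of [hp_expansion]. Raising the rate to
   at least 1/2 gives K p^j <= 2 K p^(j+1), hence the constant 3 K; |f z| is added for j = 0. *)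
pose p := Num.max q (1 / 2).
have qp : q <= p by rewrite le_max lexx.
have p2 : 1 / 2 <= p by rewrite le_max lexx orbT.
have p0 : 0 <= p by apply: le_trans qp.
exists (normc (f z) + 3 * K), p; split=> //.
- by rewrite gt_max q1 /=; lra.
- by rewrite addr_ge0 ?normc_ge0 ?mulr_ge0.
have Kp J : normc (f z - \sum_(j < J.+1) hp f j z) <= K * p ^+ J.
  by apply: le_trans (Kq J) _; apply: ler_wpM2l => //; apply: lerXn2r; rewrite ?nnegrE.
have f0 := normc_ge0 (f z).
case=> [|j].
  have := Kp 0%N; rewrite big_ord1 /= !expr0 !mulr1 => h.
  rewrite (_ : hp f 0 z = f z - (f z - hp f 0 z)); last by ring.
  by apply: le_trans (normcB _ _) _; apply: lerD => //; lra.
have h1 := Kp j; have h2 := Kp j.+1.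
rewrite big_ord_recr /= in h2.
set S := \sum_(i < j.+1) _ in h1 h2.
rewrite (_ : hp f j.+1 z = (f z - S) - (f z - (S + hp f j.+1 z))); last by ring.
apply: le_trans (normcB _ _) _.
apply: (le_trans (lerD h1 h2)).
have pj : 0 <= p ^+ j by rewrite exprn_ge0.
have : K * p ^+ j <= 2 * (K * p ^+ j.+1).
  rewrite exprS; have := ler_wpM2r (mulr_ge0 K0 pj) p2; lra.
have : 0 <= normc (f z) * p ^+ j.+1 by rewrite mulr_ge0 ?exprn_ge0.
rewrite mulrDl; lra.
Qed.

Lemma hp_average f k z : hol_ball f -> uball z ->
  ptcvg (fun N => N%:R^-1 * \sum_(l < N) (zeta N ^+ l)^-1 ^+ k * f (zeta N ^+ l *: z)) (hp f k z).
Proof.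
move=> hf zb; have [K [q [q0 q1 K0 Kq]]] := hp_bound hf zb.
apply: (@zeta_average R (fun c => f (c *: z)) (fun j => hp f j z) K q k) => // c c1.
have cb : uball (c *: z) by apply: uball_shrink; rewrite ?c1.
have := hp_ptcvg hf cb; congr (ptcvg _ _); apply/funext => J; apply: eq_bigr => j _.
by rewrite hp_homogeneous.
Qed.

End Homogeneous.

(** * Completeness of the basis *)

Section Completeness.
Context {R : realType} {n : nat}.
Variable alpha : R.
Hypothesis alpha_gt : -1 < alpha.
Local Notation C := (R[i]).
Local Notation V := ('rV[C]_n).
Local Notation mu := (lebesgueC R n).
Local Notation D := (@uball_coords R n).
Local Notation W := (fun w : n.-tuple (plane R) => bergman_weight alpha (vecC w)).
Local Notation H := (bergman n alpha).
Local Notation B := (ip (bergman n alpha)).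
Local Notation pull f := (fun w => f (vecC w)).
Local Notation e := (@e_ R n alpha).
Implicit Types (f g : V -> C) (m k : mindex n) (z : V).

Let c0 := @bergman0 R n alpha.
Let cL := bergmanL (n := n) alpha_gt.
Let BL := ip_linear (n := n) alpha_gt.
Let Bh := ip_herm (n := n) alpha_gt.
Let Bp := ip_ge0 (n := n) alpha_gt.
Let ce := carrier_e (n := n) alpha_gt.
Let Be := ip_e (n := n) alpha_gt.

(** Terms of [hp_polynomial] with equal exponents are merged, since the norm formula [sqn_psum] asks
    for distinct indices. *)
Lemma hp_psum f (j : nat) : hol_ball f -> exists (a : mindex n -> C) s, uniq s /\
  forall z, uball z -> hp f j z = psum e a s z.
Proof.
move=> hf; have [s [_ Hs]] := hp_polynomial j hf.
exists (fun m => (\sum_(p <- s | p.2 == m) p.1) / (ecoef alpha m)%:C%C), (undup (map snd s)).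
split=> [|z zb]; first exact: undup_uniq.
rewrite Hs // /psum.
transitivity (\sum_(m <- undup (map snd s)) \sum_(p <- s | p.2 == m) p.1 * monomial m z).
  rewrite (exchange_big_dep xpredT) //= !big_seq; apply: eq_bigr => p ps.
  rewrite (eq_bigl (pred1 p.2)) => [|m]; last by rewrite /= eq_sym.
  rewrite -big_filter filter_pred1_uniq ?undup_uniq ?big_seq1 //.
  by rewrite mem_undup; apply: map_f.
apply: eq_bigr => m _; rewrite /e_ -/(ecoef alpha m) -mulr_suml mulrA mulfVK //.
by rewrite -normc_eq0 normcR normr_eq0 lt0r_neq0 // ecoef_gt0.
Qed.

(** The average g satisfies |g|^2 = B g g <= |f| |g|: expand the first argument and apply
    Cauchy-Schwarz to each of the N terms, whose functions all have the norm of f. *)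
Lemma roots_average_le f N (a : 'I_N -> C) (c : 'I_N -> C) : carrier H f ->
  (forall l, normc (c l) = 1) -> (forall l, normc (a l) = N%:R^-1) ->
  sqn B (psum (fun l z => f (c l *: z)) a (index_enum 'I_N)) <= sqn B f.
Proof.
move=> cf c1 a1; pose F l z := f (c l *: z).
have FE l : F l = fun z => f (rotv (fun=> c l) z) by apply/funext => z; rewrite rotv_cst.
have cF l : carrier H (F l) by rewrite FE; exact: bergman_rotv.
have sF l : sqn B (F l) = sqn B f by rewrite /sqn FE ip_rotv.
rewrite -/F; set g := psum F a _.
have cg : carrier H g := carr_psum c0 cL cF a _.
have A0 : 0 <= sqn B f := Bp cf; have G0 : 0 <= sqn B g := Bp cg.
have XY l : normc (B (F l) g) <= Num.sqrt (sqn B f * sqn B g).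
  rewrite -[leLHS](ger0_norm (normc_ge0 _)) -sqrtr_sqr ler_wsqrtr //.
  by have := cauchy_schwarz cL BL Bh Bp (cF l) cg; rewrite sF.
have GY : sqn B g <= Num.sqrt (sqn B f * sqn B g).
  rewrite {1}/sqn {1}/g (B_psum c0 cL BL cF _ _ cg).
  apply: (le_trans (ler_norm _)); apply: (le_trans (normc_Re _)).
  have YY : \sum_(l < N) N%:R^-1 * Num.sqrt (sqn B f * sqn B g) <= Num.sqrt (sqn B f * sqn B g).
    rewrite sumr_const card_ord -[leLHS]mulr_natl mulrA.
    have [->|N0] := eqVneq (N%:R : R) 0; first by rewrite mul0r mul0r sqrtr_ge0.
    by rewrite mulfV // mul1r.
  apply: le_trans YY.
  elim/big_ind2 : _ => [|x y x' y' U U'|l _]; first by rewrite normc0.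
    by apply: le_trans (normcD _ _) _; exact: lerD.
  by rewrite normcM a1 ler_wpM2l // invr_ge0.
have [G1|] := ltP 0 (sqn B g); last by move=> /le_trans; apply.
rewrite -(ler_pM2r G1) -expr2 -[leRHS]sqr_sqrtr ?mulr_ge0 //.
by rewrite ler_pXn2r // nnegrE ?sqrtr_ge0.
Qed.

Lemma bergman_complete f : carrier H f -> (forall m, B f (e m) = 0) -> f = fun=> 0.
Proof.
move=> cf f_e; have /bergmanP[f0 hf _] := cf.
suff hp0 j z : uball z -> hp f j z = 0.
  apply/funext => z; have [zb|/f0 //] := pselect (uball z).
  apply/eqP; rewrite -normc_eq0; apply/eqP/le_anti; rewrite normc_ge0 andbT.
  apply/ler_addgt0Pr => r r0; have [N /(_ N (leqnn N))] := hp_ptcvg hf zb r0.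
  by rewrite big1 => [|i _]; [rewrite sub0r normcN add0r|exact: hp0].
move: z; have [a [s [us Hs]]] := hp_psum j hf; pose P := psum e a s.
have cP : carrier H P := carr_psum c0 cL ce a s.
have /bergmanP[P0 _ _] := cP.
have fP : B f P = 0.
  rewrite (Bh cP cf) (B_psum c0 cL BL ce _ _ cf) big1 ?rmorph0 // => m _.
  by rewrite (Bh cf (ce m)) f_e rmorph0 mulr0.
(* P is used in place of [hp f j] because it belongs to the space: it vanishes outside the ball, so
   homogeneity holds at every z. *)
have hom (c : C) z : normc c = 1 -> P (rotv (fun=> c) z) = c ^+ j * P z.
  move=> c1; rewrite rotv_cst; have [zb|zb] := pselect (uball z).
    by rewrite /P -!Hs ?hp_homogeneous //; apply: uball_shrink; rewrite ?c1.
  by rewrite !P0 ?mulr0 // -rotv_cst uball_rotv.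
(* Rotating both arguments leaves B f P = 0 unchanged and multiplies P by c ^ j, a nonzero factor
   that can be removed. *)
have fcP (c : C) : normc c = 1 -> B (fun z => f (c *: z)) P = 0.
  move=> c1; have cfc : carrier H (fun z => f (rotv (fun=> c) z)) by exact: bergman_rotv.
  have E : (fun z => f (c *: z)) = fun z => 1 * f (rotv (fun=> c) z).
    by apply/funext => z; rewrite rotv_cst mul1r.
  have := ip_rotv alpha_gt (fun=> c1) cf cP; rewrite fP.
  rewrite (_ : (fun z => P _) = fun z => c ^+ j * P z); last by apply/funext => z; exact: hom.
  rewrite (_ : (fun z => f _) = fun z => 1 * f (rotv (fun=> c) z)); last by apply/funext => z; rewrite mul1r.
  rewrite (form_scale c0 cL BL Bh _ _ cfc cP) mul1r => /eqP; rewrite mulf_eq0 => /orP[|/eqP fP0].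
    by rewrite -normc_eq0 normc_conj normcX c1 expr1n oner_eq0.
  by rewrite E -[P](_ : (fun z => 1 * P z) = P) ?(form_scale c0 cL BL Bh _ _ cfc cP) ?fP0 ?mulr0 //; apply/funext => z; rewrite mul1r.
pose av N := psum (fun (l : 'I_N) z => f (zeta N ^+ l *: z))
  (fun l => N%:R^-1 * (zeta N ^+ l)^-1 ^+ j) (index_enum 'I_N).
have cF N (l : 'I_N) : carrier H (fun z => f (zeta N ^+ l *: z)).
  rewrite (_ : (fun z => _) = fun z => f (rotv (fun=> zeta N ^+ l) z)).
    by apply: bergman_rotv => // _; exact: normc_zeta.
  by apply/funext => z; rewrite rotv_cst.
have cav N : carrier H (av N) := carr_psum c0 cL (cF N) _ _.
have avP N : B (av N) P = 0.
  rewrite (B_psum c0 cL BL (cF N) _ _ cP) big1 // => l _.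
  by rewrite fcP ?mulr0 // normc_zeta.
have sav N : sqn B (av N) <= sqn B f.
  apply: roots_average_le => // l; first exact: normc_zeta.
  rewrite normcM normcX !normcV normc_zeta invr1 expr1n mulr1.
  by rewrite -(rmorph_nat (real_complex R)) normcR ger0_norm.
have avl z : uball z -> ptcvg (av^~ z) (P z).
  move=> zb; have := hp_average j hf zb; rewrite Hs // -/(P z).
  congr (ptcvg _ _); apply/funext => N; rewrite /av /psum mulr_sumr.
  by apply: eq_bigr => l _; rewrite mulrA.
have q0 : 0 <= sqn B P := Bp cP.
(* Fatou gives (r + 1)^2 |P|^2 <= r^2 |f|^2 + |P|^2; subtract |P|^2 and divide by r. If |P|^2 were
   positive, r = |P|^2 / (|f|^2 + 1) would give a contradiction below. *)
have key (r : R) : 0 < r -> (r + 2) * sqn B P <= r * sqn B f.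
  move=> r0; pose h N := fun z => r%:C%C * av N z + P z.
  have ch N : carrier H (h N) by exact: cL.
  pose g := fun z => r%:C%C * P z + P z; have cg : carrier H g by exact: cL.
  have sh N : sqn B (h N) <= r ^+ 2 * sqn B f + sqn B P.
    rewrite (sqnL cL BL Bh _ (cav N) cP) avP mulr0 /= mulr0 addr0 normcR gtr0_norm //.
    by rewrite lerD2r ler_wpM2l // sqr_ge0.
  have : (l2 mu D W (pull g) <= (r ^+ 2 * sqn B f + sqn B P)%:E)%E.
    apply: (l2_fatou (measurable_uball_coords (n := n)) (measurable_weight alpha_gt (E := D))
      (weight_ge0 alpha_gt) (F := fun N => pull (h N))).
    - by move=> N; have /bergmanP[_ hh _] := ch N; exact: cm_hol.
    - move=> w Dw eps e0; have [N0 HN] := avl _ Dw (eps / r) (divr_gt0 e0 r0).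
      exists N0 => N /HN Hh; rewrite /h /g (_ : _ - _ = r%:C%C * (av N (vecC w) - P (vecC w))); last by ring.
      by rewrite normcM normcR gtr0_norm // mulrC -ler_pdivlMr.
    - by exists 0%N => N _; rewrite -(sqn_l2 alpha_gt (ch N)) lee_fin.
  rewrite -(sqn_l2 alpha_gt cg) lee_fin (sqnL cL BL Bh _ cP cP) normcR gtr0_norm //.
  rewrite (sqnE Bh cP) -rmorphM /= => hr.
  rewrite -(ler_pM2l r0); lra.
have Pq : sqn B P = 0.
  apply/eqP; rewrite eq_le q0 andbT leNgt; apply/negP => qp.
  have f00 : 0 <= sqn B f := Bp cf.
  have f1 : 0 < sqn B f + 1 by rewrite ltr_wpDl.
  have := key _ (divr_gt0 qp f1).
  have : sqn B P / (sqn B f + 1) * sqn B f <= sqn B P.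
    by rewrite mulrAC ler_pdivrMr // ler_wpM2l // lerDl.
  have : 0 <= sqn B P / (sqn B f + 1) * sqn B P by rewrite mulr_ge0 // divr_ge0 // ltW.
  rewrite mulrDl; lra.
move=> z zb; rewrite Hs // /psum big_seq big1 // => m ms.
suff -> : a m = 0 by rewrite mul0r.
have := sqn_psum c0 cL BL Bh ce Be a us; rewrite -/P Pq => /esym/eqP.
rewrite psumr_eq0 => [/allP/(_ m ms)|i _]; last exact: sqr_ge0.
by rewrite /= sqrf_eq0 normc_eq0 => /eqP.
Qed.

End Completeness.

(** * Cubes of multi-indices *)

Section Boxes.
Context {R : realType} {n : nat}.
Implicit Types (m : mindex n).

(** Cubes exhaust the multi-indices and, unlike the sets of bounded degree, turn sums of products
    into products of sums ([sum_box_prod]). *)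
Definition box (N : nat) : seq (mindex n) :=
  [seq [ffun i => val (f i)] | f : {ffun 'I_n -> 'I_N}].

Lemma box_uniq N : uniq (box N).
Proof.
rewrite map_inj_uniq ?enum_uniq // => f g /ffunP fg; apply/ffunP => i.
by apply: val_inj; have := fg i; rewrite !ffunE.
Qed.

Lemma mem_box m N : (m \in box N) = [forall i, (m i < N)%N].
Proof.
apply/mapP/forallP => [[f _ ->] i|mN]; first by rewrite ffunE ltn_ord.
exists [ffun i => Ordinal (mN i)]; first by rewrite mem_enum.
by apply/ffunP => i; rewrite !ffunE.
Qed.

Lemma box_sub N M : (N <= M)%N -> {subset box N <= box M}.
Proof.
move=> NM m; rewrite !mem_box => /forallP mN; apply/forallP => i.
exact: leq_trans (mN i) NM.
Qed.

Lemma seq_sub_box (s : seq (mindex n)) : exists N, {subset s <= box N}.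
Proof.
elim: s => [|m s [N sN]]; first by exists 0%N.
exists (maxn N (\max_i m i).+1) => k; rewrite inE => /orP[/eqP ->|/sN].
  rewrite mem_box; apply/forallP => i; rewrite leq_max ltnS; apply/orP; right.
  exact: (leq_bigmax i).
by apply: box_sub; rewrite leq_maxl.
Qed.

Lemma sum_box_prod N (g : 'I_n -> nat -> R) :
  \sum_(m <- box N) \prod_i g i (m i) = \prod_i \sum_(j < N) g i j.
Proof.
rewrite bigA_distr_bigA /box big_map big_enum /=; apply: eq_bigr => f _.
by apply: eq_bigr => i _; rewrite ffunE.
Qed.

End Boxes.

(** * A local bound for the reproducing kernel *)

Section Kernel.
Context {R : realType} {n : nat}.
Variable alpha : R.
Hypothesis alpha_gt : -1 < alpha.
Local Notation C := (R[i]).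
Local Notation V := ('rV[C]_n).
Local Notation leb := (@lebesgue_measure R).

Lemma sum_exp_le (y : R) N : 0 <= y -> \sum_(j < N) y ^+ j / j`!%:R <= expR y.
Proof.
move=> y0.
have c : cvgn (series (exp_coeff y)) by exact: is_cvg_series_exp_coeff.
have := nondecreasing_cvgn_le _ c N; rewrite /series /= big_mkord; apply.
by apply: nondecreasing_series => k _ _; rewrite /exp_coeff /= divr_ge0 ?exprn_ge0.
Qed.

(** The Gamma integrand with decay rate c, extended by 0 to the line: c = 1 represents Gamma itself,
    and c = 1 - s is the rate left in the bound, from e^(-t) e^(t |z|^2) <= e^(-(1 - s) t). *)
Definition ogamma (x c t : R) : R := if 0 < t then t `^ (x - 1) * expR (- (c * t)) else 0.

Lemma ogamma_ge0 x c t : 0 <= ogamma x c t.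
Proof. by rewrite /ogamma; case: ifP => // _; rewrite mulr_ge0 ?powR_ge0 ?expR_ge0. Qed.

Lemma measurable_ogamma x c : measurable_fun setT (ogamma x c : measurableTypeR R -> R).
Proof.
apply: measurable_fun_ifT.
- by apply: measurable_fun_ltr; [exact: measurable_cst|exact: measurable_id].
- apply: measurable_funM; first exact: measurable_fun_pow.
  apply: (measurableT_comp (measurable_expN (D := setT)) (g := fun t => c * t)).
  by apply: measurable_funM => //; exact: measurable_cst.
- exact: measurable_cst.
Qed.

Lemma egammaE x : egamma x = (\int[leb]_t (ogamma x 1 t)%:E)%E.
Proof.
rewrite /egamma [LHS]integral_mkcond; apply: eq_integral => t _.
by rewrite patchE mem_setE in_itv /= andbT /ogamma mul1r; case: ifP.
Qed.

Lemma ogamma_lty x c : 0 < x -> 0 < c -> (\int[leb]_t (ogamma x c t)%:E < +oo)%E.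
Proof.
move=> x0 c0; have cx : 0 <= (c `^ (x - 1))^-1 by rewrite invr_ge0 powR_ge0.
have -> : (\int[leb]_t (ogamma x c t)%:E)%E = (\int[leb]_t ((c `^ (x - 1))^-1 * ogamma x 1 (c * t))%:E)%E.
  apply: eq_integral => t _; congr _%:E; rewrite /ogamma pmulr_rgt0 //.
  case: ifPn => t0; last by rewrite mulr0.
  rewrite powRM ?(ltW c0) ?(ltW t0) // mul1r !mulrA mulVf ?mul1r //.
  by rewrite gt_eqF // powR_gt0.
have h0 t : (0 <= ((c `^ (x - 1))^-1 * ogamma x 1 t)%:E)%E by rewrite lee_fin mulr_ge0 ?ogamma_ge0.
rewrite (scales_mul c0 (F := fun t => ((c `^ (x - 1))^-1 * ogamma x 1 t)%:E)) //; last first.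
  by apply/measurable_EFinP; apply: measurable_funM; [exact: measurable_cst|exact: measurable_ogamma].
under eq_integral do rewrite EFinM.
rewrite ge0_integralZl_EFin //; last 2 first.
- by move=> t _; rewrite lee_fin ogamma_ge0.
- by apply/measurable_EFinP; exact: measurable_ogamma.
rewrite -egammaE GammaE // -!EFinM; exact: ltry.
Qed.

(* Writing Gamma(n + |m| + alpha + 1) as an integral turns the sum of the
   squares of the basis functions into the integral of
   t^(n + alpha) e^(-t) e^(t |z|^2), up to a constant. *)
Lemma kernel_bound (s : R) : 0 <= s -> s < 1 -> exists2 K : R, 0 <= K & forall (z : V) N,
  normsq z <= s -> \sum_(m <- box N) normc (e_ alpha m z) ^+ 2 <= K.
Proof.
move=> s0 s1; pose b := n%:R + alpha + 1.
have b0 : 0 < b by have := nalpha1 (n := n) alpha_gt 0; rewrite addr0.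
have G0 := Gamma_gt0 b0.
have c0 : 0 < 1 - s by rewrite subr_gt0.
have If := ogamma_lty b0 c0.
have I0 : (0 <= \int[leb]_t (ogamma b (1 - s) t)%:E)%E.
  by apply: integral_ge0 => t _; rewrite lee_fin ogamma_ge0.
exists (fine (\int[leb]_t (ogamma b (1 - s) t)%:E)%E / Gamma b).
  exact: divr_ge0 (fine_ge0 I0) (ltW G0).
move=> z N zs; rewrite ler_pdivlMr //.
pose x (i : 'I_n) : R := normc (z 0 i) ^+ 2.
have x0 i : 0 <= x i by exact: sqr_ge0.
pose c (m : mindex n) := \prod_i (x i ^+ m i / (m i)`!%:R).
have c_ge0 m : 0 <= c m.
  by apply: prodr_ge0 => i _; apply: divr_ge0; [apply: exprn_ge0; exact: x0|exact: ler0n].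
have zb : normsq z < 1 := le_lt_trans zs s1.
have eb m : normc (e_ alpha m z) ^+ 2 * Gamma b = c m * Gamma (n%:R + (mdeg m)%:R + alpha + 1).
  rewrite /e_ -/(ecoef alpha m) normcM normcR (gtr0_norm (ecoef_gt0 alpha_gt m)) exprMn (ecoef_sqr alpha_gt).
  rewrite /monomial zb.
  rewrite (big_morph (fun z : C => normc z ^+ 2) (id1 := 1) (op1 := *%R)); last 2 first.
  - by move=> u y; rewrite normcM exprMn.
  - by rewrite normc1 expr1n.
  rewrite (eq_bigr (fun i => x i ^+ m i)) => [|i _]; last by rewrite normcX exprAC.
  have P0 : (mfact m)%:R != 0 :> R by rewrite pnatr_eq0 -lt0n mfact_gt0.
  have -> : c m = (\prod_(i < n) x i ^+ m i) / (mfact m)%:R.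
    by rewrite /c big_split /= prodfV /mfact natr_prod.
  have Gn := lt0r_neq0 G0; rewrite -/b.
  move: (Gamma b) Gn (Gamma (n%:R + _ + _ + _)) (mfact m)%:R P0 => g g0 g' p p0.
  by field; rewrite p0.
rewrite mulr_suml (eq_bigr _ (fun m _ => eb m)) -lee_fin fineK ?ge0_fin_numE //.
rewrite -sumEFin.
have mt m : 0 < n%:R + (mdeg m)%:R + alpha + 1 by exact: nalpha1.
rewrite (eq_bigr (fun m => \int[leb]_t (c m * ogamma (n%:R + (mdeg m)%:R + alpha + 1) 1 t)%:E)%E); last first.
  move=> m _; rewrite EFinM -GammaE // egammaE -ge0_integralZl_EFin //.
  - by move=> t _; rewrite lee_fin ogamma_ge0.
  - by apply/measurable_EFinP; exact: measurable_ogamma.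
rewrite -ge0_integral_sum //; last 2 first.
- move=> m; apply/measurable_EFinP; apply: measurable_funM; first exact: measurable_cst.
  exact: measurable_ogamma.
- by move=> m t _; rewrite lee_fin mulr_ge0 ?ogamma_ge0.
apply: ge0_le_integral => //.
- by move=> t _; apply: sume_ge0 => m _; rewrite lee_fin mulr_ge0 ?ogamma_ge0.
- apply: emeasurable_sum => m; apply/measurable_EFinP; apply: measurable_funM; first exact: measurable_cst.
  exact: measurable_ogamma.
- by apply/measurable_EFinP; exact: measurable_ogamma.
move=> t _; rewrite sumEFin lee_fin /ogamma.
case: ifPn => t0; last by rewrite big1 // => m _; rewrite mulr0.
have -> : \sum_(m <- box N) c m * (t `^ (n%:R + (mdeg m)%:R + alpha + 1 - 1) * expR (- (1 * t))) =
    t `^ (b - 1) * expR (- t) * \sum_(m <- box N) \prod_i ((t * x i) ^+ m i / (m i)`!%:R).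
  rewrite mulr_sumr; apply: eq_bigr => m _.
  rewrite (_ : n%:R + (mdeg m)%:R + alpha + 1 - 1 = (b - 1) + (mdeg m)%:R); last by rewrite /b; ring.
  rewrite powRD ?(gt_eqF t0) ?implybT // powR_mulrn ?(ltW t0) // mul1r.
  rewrite (_ : \prod_i ((t * x i) ^+ m i / _) = t ^+ mdeg m * c m); first by ring.
  rewrite /mdeg -prodrXr -big_split; apply: eq_bigr => i _ /=.
  by rewrite exprMn mulrA.
rewrite (sum_box_prod N (fun i j => (t * x i) ^+ j / j`!%:R)).
rewrite -mulrA ler_wpM2l ?powR_ge0 //.
apply: (@le_trans _ _ (expR (- t) * \prod_(i < n) expR (t * x i))).
  rewrite ler_wpM2l ?expR_ge0 //; apply: ler_prod => i _.
  have y0 : 0 <= t * x i by rewrite mulr_ge0 // ltW.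
  by rewrite sum_exp_le // andbT sumr_ge0 // => j _; rewrite divr_ge0 ?exprn_ge0.
rewrite -expR_sum -expRD ler_expR -mulr_sumr -/(normsq z).
have := ler_wpM2l (ltW t0) zs; lra.
Qed.

End Kernel.

(** * Surjectivity onto square summable families *)

Section RieszFischer.
Context {R : realType} {n : nat}.
Variable alpha : R.
Hypothesis alpha_gt : -1 < alpha.
Local Notation C := (R[i]).
Local Notation V := ('rV[C]_n).
Local Notation mu := (lebesgueC R n).
Local Notation D := (@uball_coords R n).
Local Notation W := (fun w : n.-tuple (plane R) => bergman_weight alpha (vecC w)).
Local Notation H := (bergman n alpha).
Local Notation B := (ip (bergman n alpha)).
Local Notation pull f := (fun w => f (vecC w)).
Local Notation e := (@e_ R n alpha).
Implicit Types (f g : V -> C) (m k : mindex n) (z : V).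

Let c0 := @bergman0 R n alpha.
Let cL := bergmanL (n := n) alpha_gt.
Let BL := ip_linear (n := n) alpha_gt.
Let Bh := ip_herm (n := n) alpha_gt.
Let Bp := ip_ge0 (n := n) alpha_gt.
Let ce := carrier_e (n := n) alpha_gt.
Let Be := ip_e (n := n) alpha_gt.

Lemma real_cauchy (u : nat -> R) : (forall r, 0 < r -> exists N0, forall N M, (N0 <= N)%N ->
  (N <= M)%N -> `|u M - u N| <= r) -> cvgn u.
Proof.
move=> Hu; apply/cauchy_cvgP/cauchy_exP => r r0.
have [N0 HN] := Hu (r / 2) (divr_gt0 r0 (ltr0n _ 2)).
exists (u N0); exists N0 => // N /= NN; rewrite /ball /= distrC.
by apply: le_lt_trans (HN _ _ (leqnn _) NN) _; lra.
Qed.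

Lemma complex_cauchy (u : nat -> C) : (forall r, 0 < r -> exists N0, forall N M, (N0 <= N)%N ->
  (N <= M)%N -> normc (u M - u N) <= r) -> exists l, ptcvg u l.
Proof.
move=> Hu.
have cR : cvgn (fun N => complex.Re (u N)).
  apply: real_cauchy => r /Hu[N0 HN]; exists N0 => N M h1 h2.
  by rewrite -ReN -ReD; apply: le_trans (normc_Re _) (HN N M h1 h2).
have cI : cvgn (fun N => complex.Im (u N)).
  apply: real_cauchy => r /Hu[N0 HN]; exists N0 => N M h1 h2.
  by rewrite -ImN -ImD; apply: le_trans (normc_Im _) (HN N M h1 h2).
exists (limn (fun N => complex.Re (u N)) +i* limn (fun N => complex.Im (u N)))%C => r r0.
have r2 : 0 < r / 2 by rewrite divr_gt0.
move/cvgrPdist_le : cR => /(_ _ r2)[N1 _ H1].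
move/cvgrPdist_le : cI => /(_ _ r2)[N2 _ H2].
exists (maxn N1 N2) => N; rewrite geq_max => /andP[/H1 /= h1 /H2 /= h2].
apply: le_trans (normc_le_ReIm _) _; rewrite ReD ImD ReN ImN /=.
by rewrite distrC [X in _ + X]distrC; lra.
Qed.

Lemma ptcvg_le (u : nat -> C) l c (r : R) N0 : ptcvg u l ->
  (forall N, (N0 <= N)%N -> normc (u N - c) <= r) -> normc (l - c) <= r.
Proof.
move=> ul uc; apply/ler_addgt0Pr => d d0; have [N1 HN] := ul d d0.
have h1 := HN (maxn N0 N1) (leq_maxr _ _); have h2 := uc (maxn N0 N1) (leq_maxl _ _).
rewrite (_ : l - c = (u (maxn N0 N1) - c) - (u (maxn N0 N1) - l)); last by ring.
by apply: le_trans (normcB _ _) _; exact: lerD.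
Qed.

(** Some c > 1 still maps a neighbourhood of z into the ball; this leaves the margin s = c ^- 2 that
    [kernel_bound] requires. *)
Lemma uball_near z : uball z -> exists r s : R, [/\ 0 < r, 0 <= s, s < 1 &
  forall h, nrm h < r -> normsq (z + h) <= s].
Proof.
move=> zb; have [rho r1 Hr] := uball_scale zb.
pose c : R := (1 + rho) / 2.
have c1 : 1 < c by rewrite /c; lra.
have c0' : 0 < c by lra.
have nc : normc (c%:C%C : C) = c by rewrite normcR gtr0_norm.
have [|r r0 K] := @uball_open _ _ (c%:C%C *: z); first by apply: Hr; rewrite nc /c; lra.
exists (r / c), (c ^- 2); split.
- by rewrite divr_gt0.
- by rewrite invr_ge0 exprn_ge0 // ltW.
- by rewrite invf_lt1 ?exprn_gt0 // exprn_egt1.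
move=> h hr; have := K (c%:C%C *: h); rewrite nrmZ nc mulrC -ltr_pdivlMr // => /(_ hr).
rewrite -scalerDr uballE normsqZ nc => /ltW.
by rewrite -(ler_pdivlMl _ _ (exprn_gt0 2 c0')) mulr1.
Qed.

(** Cauchy-Schwarz with the kernel bound makes the partial sums over cubes Cauchy at each point, at
    a rate uniform near it; [weierstrass] then gives holomorphy and [l2_fatou] the norm estimates.
    The inequality for the norm of f is part of the conclusion because [coeff_map_complete] derives
    the reverse of Bessel's inequality from it. *)
Theorem riesz_fischer (a : mindex n -> C) : carrier (ell2 R n) a ->
  exists2 f, carrier H f & (forall m, B f (e m) = a m) /\
    ((sqn B f)%:E <= \esum_(m in setT) (normc (a m) ^+ 2)%:E)%E.
Proof.
move=> /= aoo; pose g m := normc (a m) ^+ 2.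
have g0 m : 0 <= g m by exact: sqr_ge0.
pose S := fine (\esum_(m in setT) (g m)%:E)%E.
have SE : (\esum_(m in setT) (g m)%:E = S%:E)%E.
  by rewrite fineK // ge0_fin_numE // esum_ge0 // => m _; rewrite lee_fin.
pose p N := \sum_(m <- box N) g m.
have pS N : p N <= S by rewrite -lee_fin -SE; apply: sum_le_esum => //; exact: box_uniq.
have pmono N M : (N <= M)%N -> p N <= p M.
  by move=> NM; apply: sum_uniq_le => //; [exact: box_uniq|exact: box_uniq|exact: box_sub].
have plim d : 0 < d -> exists N0, forall N, (N0 <= N)%N -> S - p N <= d.
  move=> d0; have : ((S - d)%:E < \esum_(m in setT) (g m)%:E)%E by rewrite SE lte_fin gtrBl.
  move=> /lt_esum_sum[s us]; rewrite lte_fin => hs; have [N0 sN] := seq_sub_box s.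
  exists N0 => N NN; have := pmono _ _ NN.
  have : \sum_(m <- s) g m <= p N0 by apply: sum_uniq_le => //; exact: box_uniq.
  lra.
pose F N := psum e a (box N); pose rest N M := [seq m <- @box n M | m \notin box N].
have ur N M : uniq (rest N M) by rewrite filter_uniq // box_uniq.
have split_box (X : nmodType) (h : mindex n -> X) N M : (N <= M)%N ->
    \sum_(m <- box M) h m = \sum_(m <- box N) h m + \sum_(m <- rest N M) h m.
  move=> NM; rewrite (bigID (mem (box N))) /= -big_filter big_filter; congr (_ + _).
    rewrite -big_filter; apply: perm_big; apply: uniq_perm; rewrite ?filter_uniq ?box_uniq // => m.
    by rewrite mem_filter; case: (boolP (m \in box N)) => //= /(box_sub NM) ->.
  by rewrite big_filter.
have FB N M z : (N <= M)%N -> F M z - F N z = psum e a (rest N M) z.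
  by move=> NM; rewrite /F /psum (split_box _ _ _ _ NM) addrC addKr.
have pB N M : (N <= M)%N -> \sum_(m <- rest N M) g m = p M - p N.
  by move=> NM; rewrite /p (split_box _ _ _ _ NM) addrC addKr.
have cF N : carrier H (F N) := carr_psum c0 cL ce a _.
have point (K : R) z N M : 0 <= K -> (forall N, \sum_(m <- box N) normc (e m z) ^+ 2 <= K) ->
    (N <= M)%N -> normc (F M z - F N z) <= Num.sqrt ((S - p N) * K).
  move=> K0 HK NM; rewrite FB // -[leLHS](ger0_norm (normc_ge0 _)) -sqrtr_sqr ler_wsqrtr //.
  apply: (@le_trans _ _ ((\sum_(m <- rest N M) normc (a m) * normc (e m z)) ^+ 2)).
    rewrite ler_pXn2r ?nnegrE ?normc_ge0 //; last by apply: sumr_ge0 => m _; rewrite mulr_ge0 ?normc_ge0.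
    rewrite /psum; elim/big_ind2 : _ => [|x y x' y' U U'|m _]; first by rewrite normc0.
      by apply: le_trans (normcD _ _) _; exact: lerD.
    by rewrite normcM.
  apply: le_trans (sqr_sum_le _ _ _) _ => [m|m|]; [exact: normc_ge0|exact: normc_ge0|].
  rewrite pB //; apply: ler_pM.
  - by rewrite subr_ge0 pmono.
  - by apply: sumr_ge0 => m _; rewrite sqr_ge0.
  - by rewrite lerD2r.
  - apply: le_trans (HK M); apply: sum_uniq_le => //; [by move=> m; rewrite sqr_ge0|exact: box_uniq|].
    by move=> m; rewrite mem_filter => /andP[].
have sqrt_lim (K : R) : 0 <= K -> forall r, 0 < r ->
    exists N0, forall N, (N0 <= N)%N -> Num.sqrt ((S - p N) * K) <= r.
  move=> K0 r r0; have K1 : 0 < K + 1 by rewrite ltr_wpDl.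
  have [N0 HN] := plim (r ^+ 2 / (K + 1)) (divr_gt0 (exprn_gt0 2 r0) K1).
  exists N0 => N /HN h; rewrite -[leRHS](gtr0_norm r0) -sqrtr_sqr ler_wsqrtr //.
  apply: (@le_trans _ _ (r ^+ 2 / (K + 1) * K)); first exact: ler_wpM2r.
  by rewrite mulrAC ler_pdivrMr // ler_wpM2l ?sqr_ge0 // lerDl.
(* The condition on z sits inside the existential, so that one function on the whole space can be
   chosen. *)
have /choice[lf Hlf] : forall z, exists l, uball z -> ptcvg (F^~ z) l.
  move=> z; have [zb|zb] := pselect (uball z); last by exists 0.
  have [K K0 HK] := kernel_bound (n := n) alpha_gt (normsq_ge0 z) zb.
  have [|l Hl] := @complex_cauchy (F^~ z); last by exists l.
  move=> r /(sqrt_lim K K0)[N0 HN]; exists N0 => N M h1 h2.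
  by apply: le_trans (HN N h1); apply: point => // N'; exact: HK.
pose f z := if normsq z < 1 then lf z else 0.
have fF z : uball z -> ptcvg (F^~ z) (f z).
  by move=> zb; rewrite /f; move: (zb); rewrite uballE => ->; exact: Hlf.
have hf : hol_ball f.
  move=> z zb; have [r [s [r0 s0 s1 Hs]]] := uball_near zb.
  apply: (@weierstrass _ _ f z r r0) => d d0.
  have [K K0 HK] := kernel_bound (n := n) alpha_gt s0 s1.
  have [N0 HN] := sqrt_lim K K0 d d0.
  have hb h : nrm h < r -> uball (z + h) by move=> /Hs; rewrite uballE => /le_lt_trans; apply.
  exists (F N0) => h hr.
    by have /bergmanP[_ hF _] := cF N0; exact/hF/hb.
  rewrite normc_distC; apply: (ptcvg_le (fF _ (hb _ hr)) (N0 := N0)) => N NN.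
  apply: le_trans (HN N0 (leqnn _)); apply: point => // N'.
  by apply: HK; exact: Hs.
have f0 z : ~ uball z -> f z = 0 by rewrite uballE /f => /negP /negbTE ->.
have sF N : sqn B (F N) = p N by rewrite (sqn_psum c0 cL BL Bh ce Be) // box_uniq.
have cm_car h : carrier H h -> cm D (pull h).
  by move=> /bergmanP[_ hh _]; exact: cm_hol.
have lf_le : (l2 mu D W (pull f) <= S%:E)%E.
  apply: (l2_fatou (measurable_uball_coords (n := n)) (measurable_weight alpha_gt (E := D))
    (weight_ge0 alpha_gt) (F := fun N => pull (F N))).
  - by move=> N; exact: cm_car.
  - by move=> w Dw; exact: fF.
  - by exists 0%N => N _; rewrite -(sqn_l2 alpha_gt (cF N)) lee_fin sF.
have cf : carrier H f by apply/bergmanP; split => //; exact: le_lt_trans lf_le (ltry _).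
exists f => //; split=> [m|]; last by rewrite (sqn_l2 alpha_gt cf) SE.
pose dl N := fun z => (-1) * F N z + f z.
have cd N : carrier H (dl N) by exact: cL.
(* Fatou in M, with N fixed, applied to F M - F N. Once the cube contains m, the m-th coefficient of
   F N is a m, so the m-th coefficient of f differs from a m by arbitrarily little. *)
have sd N : sqn B (dl N) <= S - p N.
  rewrite -lee_fin (sqn_l2 alpha_gt (cd N)).
  apply: (l2_fatou (measurable_uball_coords (n := n)) (measurable_weight alpha_gt (E := D))
    (weight_ge0 alpha_gt) (F := fun M => pull (fun z => (-1) * F N z + F M z))).
  - by move=> M; exact: (cm_car _ (cL (-1) (cF N) (cF M))).
  - move=> w Dw r /(fF _ Dw)[N0 HN]; exists N0 => M /HN.
    by rewrite /dl (_ : _ + _ - _ = F M (vecC w) - f (vecC w)) //; ring.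
  - exists N => M NM; rewrite -(sqn_l2 alpha_gt (cL _ (cF N) (cF M))) lee_fin.
    rewrite (_ : (fun z => _) = psum e a (rest N M)).
      by rewrite (sqn_psum c0 cL BL Bh ce Be) // pB // lerD2r.
    by apply/funext => z; rewrite -FB // mulN1r addrC.
have [N1 mN1] := seq_sub_box [:: m].
apply/eqP; rewrite -subr_eq0 -normc_eq0 -sqrf_eq0; apply/eqP/le_anti; rewrite sqr_ge0 andbT.
apply/ler_addgt0Pr => d d0; rewrite add0r; have [N0 HN] := plim d d0.
pose N := maxn N0 N1.
have mN : m \in box N by apply: (box_sub (leq_maxr N0 N1)); apply: mN1; rewrite inE.
have := cauchy_schwarz cL BL Bh Bp (cd N) (ce m).
rewrite BL // (coef_psum c0 cL BL ce Be) ?box_uniq // mN mulN1r addrC => /le_trans; apply.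
rewrite {2}/sqn Be eqxx mulr1; apply: le_trans (sd N) _.
by apply: HN; rewrite leq_maxl.
Qed.

End RieszFischer.

(** * Invariant operators *)

Section Invariants.
Context {R : realType} {n : nat}.
Variable alpha : R.
Hypothesis alpha_gt : -1 < alpha.
Local Notation C := (R[i]).
Local Notation V := ('rV[C]_n).
Local Notation H := (bergman n alpha).
Local Notation B := (ip (bergman n alpha)).
Local Notation e := (@e_ R n alpha).
Local Notation l2 := (ell2 R n).
Local Notation Rm := (@coeff_map R n alpha).
Implicit Types (f g h : V -> C) (m k : mindex n) (z : V) (T : (V -> C) -> V -> C).

Let c0 := @bergman0 R n alpha.
Let cL := bergmanL (n := n) alpha_gt.
Let BL := ip_linear (n := n) alpha_gt.
Let Bh := ip_herm (n := n) alpha_gt.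
Let Bp := ip_ge0 (n := n) alpha_gt.
Let ce := carrier_e (n := n) alpha_gt.
Let Be := ip_e (n := n) alpha_gt.

Lemma coeff_map_inj f g : carrier H f -> carrier H g -> Rm f = Rm g -> f = g.
Proof.
move=> cf cg fg; have := bergman_complete alpha_gt (cL (-1) cg cf).
move=> /(_ _)/wrap[m|E].
  by rewrite BL // -/(Rm f m) -/(Rm g m) fg mulN1r addNr.
by apply/funext => z; have /= := congr1 (@^~ z) E; rewrite mulN1r addrC => /eqP; rewrite subr_eq0 => /eqP.
Qed.

Lemma coeff_map_carrier f : carrier H f -> carrier l2 (Rm f).
Proof.
move=> cf; apply: le_lt_trans (ltry (sqn B f)).
exact: (bessel_esum c0 cL BL Bh Bp ce Be cf).
Qed.

(** Riesz-Fischer builds a function with the coefficients of f and the desired norm bound; by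
    completeness it is f itself. *)
Lemma coeff_map_complete f : carrier H f ->
  ((sqn B f)%:E <= \esum_(m in setT) (normc (B f (e m)) ^+ 2)%:E)%E.
Proof.
move=> cf; have [g cg [gf gle]] := riesz_fischer alpha_gt (coeff_map_carrier cf).
by rewrite -(coeff_map_inj cg cf (funext gf)) in gle *.
Qed.

Lemma coeff_map_unitary : unitary_map H l2 Rm.
Proof.
split.
- split; first exact: coeff_map_carrier.
  by move=> a f g cf cg; apply/funext => m; exact: BL.
- move=> f g cf cg.
  exact: (parseval c0 cL BL Bh Bp ce Be cf cg (coeff_map_complete cf)).
- by move=> a /(riesz_fischer alpha_gt)[f cf [fa _]]; exists f => //; exact: funext.
Qed.

(** By isometry f is a representing vector; any other one has the same products with the basis
    vectors, hence equals f. *)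
Lemma coeff_map_adjoint f : carrier H f -> adjoint H l2 Rm (Rm f) = f.
Proof.
move=> cf; have [_ iso _] := coeff_map_unitary.
rewrite /adjoint; case: xgetP => [g _ [cg Hg]|/(_ f)]; last first.
  by case; split=> // h ch; rewrite iso.
apply: coeff_map_inj => //; apply/funext => m.
by rewrite /coeff_map (Bh (ce m) cg) (Bh (ce m) cf) Hg // iso.
Qed.

Section Intertwiner.
Variable T : (V -> C) -> V -> C.
Hypothesis T_End : End_AT n alpha T.

Let cT f : carrier H f -> carrier H (T f).
Proof. by case: T_End => -[[cT _] _] _; exact: cT. Qed.

Let TL (a : C) f g : carrier H f -> carrier H g ->
  T (fun x => a * f x + g x) = fun x => a * T f x + T g x.
Proof. by case: T_End => -[[_ TL] _] _; exact: TL. Qed.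

Lemma intertwiner0 : T (fun=> 0) = fun=> 0.
Proof.
have := TL (-1) c0 c0; rewrite (_ : (fun x => -1 * 0 + 0) = fun=> 0).
  by move=> {1}->; apply/funext => z; rewrite mulN1r addNr.
by apply/funext => z; rewrite mulr0 addr0.
Qed.

Lemma intertwinerZ (a : C) f : carrier H f -> T (fun x => a * f x) = fun x => a * T f x.
Proof.
move=> cf; have := TL a cf c0; rewrite intertwiner0.
rewrite (_ : (fun x => a * f x + 0) = fun x => a * f x); last by apply/funext => z; rewrite addr0.
by move=> ->; apply/funext => z; rewrite addr0.
Qed.

Lemma torus_normc (t : 'I_n -> C) : (forall i, normc (t i) = 1) -> torus t.
Proof. by move=> t1 i; rewrite normcT t1. Qed.

Lemma pi_alpha_rotv (t : 'I_n -> C) f : pi_alpha 1%g t f = fun z => f (rotv (fun j => (t j)^-1) z).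
Proof.
apply/funext => z; rewrite /pi_alpha /=; congr f.
by apply/rowP => i; rewrite !mxE invg1 perm1.
Qed.

Lemma intertwiner_e m : T (e m) = fun z => gamma alpha T m * e m z.
Proof.
apply: coeff_map_inj; [exact: cT|exact: carrierZ|].
apply/funext => k; rewrite /coeff_map.
have -> : B (fun z => gamma alpha T m * e m z) (e k) = gamma alpha T m * (m == k)%:R.
  rewrite (_ : (fun z => _) = fun z => gamma alpha T m * e m z + 0).
    by rewrite BL // (form0l c0 BL) // addr0 Be.
  by apply/funext => z; rewrite addr0.
have [<-|mk] := eqVneq m k; first by rewrite mulr1.
rewrite mulr0; have [i mki] : exists i, m i != k i.
  apply/existsP; rewrite -negb_forall; apply: contra mk => /forallP mk.
  by apply/eqP/ffunP => i; apply/eqP.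
have rot_e j (c : C) z : normc c = 1 -> e j (rotv (rot1 i c) z) = c ^+ j i * e j z.
  by move=> c1; rewrite /e_ monomial_rot1 // mulrCA.
apply: (ip_weight_orth alpha_gt (cT (ce m)) (ce k) _ (rot_e k) mki) => c z c1.
(* The representation composes with the inverse group element, so invariance is used at c^-1 in
   order to rotate by c. *)
have rc : (fun j => (rot1 i c^-1 j)^-1) = rot1 i c.
  by apply/funext => j; rewrite /rot1; case: ifP => _; rewrite ?invrK ?invr1.
have c1' : normc c^-1 = 1 by rewrite normcV c1 invr1.
have [_ /(_ 1%g _ (e m) (group1 _) (torus_normc (normc_rot1 i c1')) (ce m))] := T_End.
rewrite !pi_alpha_rotv rc.
rewrite (_ : (fun z => e m _) = fun z => c ^+ m i * e m z); last by apply/funext => y; exact: rot_e.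
by rewrite intertwinerZ // => /(congr1 (@^~ z)).
Qed.

(** The formula holds for finite sums of basis vectors. A general f differs from such a sum by an h
    of small norm, by [coeff_map_complete], and T h is small because T is bounded. *)
Lemma intertwiner_coeff f : carrier H f -> Rm (T f) = mult_op (gamma alpha T) (Rm f).
Proof.
move=> cf; apply/funext => m; rewrite /mult_op.
have [[_ [M HM]] _] := T_End.
have sT h : carrier H h -> sqn B (T h) <= M ^+ 2 * sqn B h.
  move=> ch; have := HM h ch; rewrite /fnorm -!/(sqn B _) => hM.
  rewrite -[leLHS](sqr_sqrtr (Bp (cT ch))) -[sqn B h](sqr_sqrtr (Bp ch)) -exprMn.
  by rewrite ler_pXn2r // nnegrE ?sqrtr_ge0 // (le_trans (sqrtr_ge0 _) hM).
have Tpsum (a : mindex n -> C) s : T (psum e a s) = psum e (fun m => gamma alpha T m * a m) s.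
  rewrite /psum; elim: s => [|k s IH].
    rewrite (_ : (fun z => _) = fun=> 0); last by apply/funext => z; rewrite big_nil.
    by rewrite intertwiner0; apply/funext => z; rewrite big_nil.
  rewrite (_ : (fun z => _) = fun z => a k * e k z + \sum_(i <- s) a i * e i z); last first.
    by apply/funext => z; rewrite big_cons.
  rewrite TL //; last exact: (carr_psum c0 cL ce a s).
  rewrite IH intertwiner_e; apply/funext => z; rewrite big_cons.
  by rewrite mulrA [a k * _]mulrC.
apply/eqP; rewrite -subr_eq0 -normc_eq0 -sqrf_eq0; apply/eqP/le_anti; rewrite sqr_ge0 andbT.
apply/ler_addgt0Pr => d d0; rewrite add0r.
have M1 : 0 < M ^+ 2 + 1 by rewrite ltr_wpDl ?sqr_ge0.
have : ((sqn B f - d / (M ^+ 2 + 1))%:E < \esum_(m in setT) (normc (B f (e m)) ^+ 2)%:E)%E.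
  by apply: lt_le_trans (coeff_map_complete cf); rewrite lte_fin gtrBl divr_gt0.
move=> /lt_esum_sum[s us]; rewrite lte_fin => hs.
(* Adding m to the index set makes the finite sum carry the m-th coefficient exactly, so that the
   whole error is the m-th coefficient of T h. *)
pose s' := undup (m :: s); have us' : uniq s' by exact: undup_uniq.
have ms : m \in s' by rewrite mem_undup mem_head.
have le_s : \sum_(k <- s) normc (B f (e k)) ^+ 2 <= \sum_(k <- s') normc (B f (e k)) ^+ 2.
  apply: sum_uniq_le => // [k|k ks]; first exact: sqr_ge0.
  by rewrite mem_undup inE ks orbT.
pose a k := B f (e k).
pose h := fun z => (-1) * psum e a s' z + f z.
have cp := carr_psum c0 cL ce a s'.
have ch : carrier H h by exact: cL.
have -> : Rm (T f) m - gamma alpha T m * Rm f m = B (T h) (e m).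
  rewrite /h TL // BL //; [|exact: cT|exact: cT].
  by rewrite Tpsum (coef_psum c0 cL BL ce Be) // ms mulN1r addrC.
apply: le_trans (cauchy_schwarz cL BL Bh Bp (cT ch) (ce m)) _.
rewrite [X in _ * X](_ : _ = 1); last by rewrite /sqn Be eqxx.
rewrite mulr1; apply: le_trans (sT _ ch) _.
rewrite (sqn_sub_psum c0 cL BL Bh ce Be) //.
apply: (@le_trans _ _ (M ^+ 2 * (d / (M ^+ 2 + 1)))).
  by apply: ler_wpM2l; [exact: sqr_ge0|lra].
by rewrite mulrCA ler_piMr ?(ltW d0) // ler_pdivrMr // mul1r lerDl.
Qed.

Lemma mperm_mul (s t : 'S_n) m : mperm (s * t)%g m = mperm s (mperm t m).
Proof. by apply/ffunP => i; rewrite !ffunE permM. Qed.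

Lemma mperm1 m : mperm 1%g m = m.
Proof. by apply/ffunP => i; rewrite ffunE perm1. Qed.

Lemma pi_alpha_e (s : 'S_n) m : pi_alpha s (fun=> 1) (e m) = e (mperm s m).
Proof.
apply/funext => z; rewrite /pi_alpha /= /e_.
have -> : mdeg (mperm s m) = mdeg m.
  by rewrite /mdeg [RHS](reindex_perm s); apply: eq_bigr => i _; rewrite ffunE.
have -> : mfact (mperm s m) = mfact m.
  by rewrite /mfact [RHS](reindex_perm s); apply: eq_bigr => i _; rewrite ffunE.
congr (_ * _); rewrite /monomial.
have -> : normsq (gact_inv s (fun=> 1) z) = normsq z.
  rewrite /normsq [LHS](reindex_perm s); apply: eq_bigr => i _.
  by rewrite mxE invr1 mul1r permK.
case: ifP => // _; rewrite [LHS](reindex_perm s); apply: eq_bigr => i _.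
by rewrite mxE invr1 mul1r permK ffunE.
Qed.

Lemma gamma_even (s : 'S_n) m : s \in Alt 'I_n -> gamma alpha T (mperm s m) = gamma alpha T m.
Proof.
move=> sA; have t1 : @torus R n (fun=> 1) by apply: torus_normc => i; rewrite normc1.
have [_ /(_ s _ (e m) sA t1 (ce m))] := T_End.
rewrite pi_alpha_e (intertwiner_e m) => E.
have {}E : T (e (mperm s m)) = fun z => gamma alpha T m * e (mperm s m) z + 0.
  by rewrite E -pi_alpha_e; apply/funext => z; rewrite addr0.
by rewrite /gamma E BL // (form0l c0 BL) // addr0 Be eqxx mulr1.
Qed.

End Intertwiner.

Lemma fnorm_e m : fnorm H (e m) = 1.
Proof. by rewrite /fnorm Be eqxx sqrtr1. Qed.

Lemma monomial_span_e (A : set (mindex n)) m : A m -> monomial_span A (e m).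
Proof.
move=> Am; exists [:: m], (fun=> (ecoef alpha m)%:C%C); split=> [k|].
  by rewrite inE => /eqP ->.
by apply/funext => z; rewrite big_seq1.
Qed.

End Invariants.

Unset Implicit Arguments.

Theorem theorem5 (R : realType) (n : nat) (alpha : R)
    (n_ge2 : (2 <= n)%N) (alpha_gtN1 : -1 < alpha) :
  let H := bergman n alpha in
  let l2 := ell2 R n in
  let Rm := coeff_map n alpha in
  let Rstar := adjoint H l2 Rm in
  (forall S T, End_AT n alpha S -> End_AT n alpha T ->
     forall f, carrier H f -> S (T f) = T (S f)) /\
  unitary_map H l2 Rm /\
  (forall T, End_AT n alpha T ->
     unitarily_equivalent H l2 T (Rm \o T \o Rstar) /\
     (forall a, carrier l2 a ->
        (Rm \o T \o Rstar) a = mult_op (gamma alpha T) a)) /\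
  (forall s : 'S_n, odd_perm s ->
     let u := u_vec alpha s in
     (forall i : I_zero n,
        fnorm H (u (Zero i)) = 1 /\ P_full R (set_val i) (u (Zero i))) /\
     (forall i : I_strict n,
        [/\ fnorm H (u (Plus i)) = 1, P_plus R (set_val i) (u (Plus i)),
            fnorm H (u (Minus i)) = 1
          & P_minus R (set_val i) (u (Minus i))]) /\
     (forall T, End_AT n alpha T ->
        [/\ forall i : I_zero n,
              (forall m, orbit_full (set_val i) m ->
                 gamma_hat alpha s T (Zero i) = gamma alpha T m) /\
              (forall m m', orbit_full (set_val i) m ->
                 orbit_full (set_val i) m' -> gamma alpha T m = gamma alpha T m'),
            forall i : I_strict n,
              (forall m, orbit_plus (set_val i) m ->
                 gamma_hat alpha s T (Plus i) = gamma alpha T m) /\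
              (forall m m', orbit_plus (set_val i) m ->
                 orbit_plus (set_val i) m' -> gamma alpha T m = gamma alpha T m')
          & forall i : I_strict n,
              (forall m, orbit_minus (set_val i) m ->
                 gamma_hat alpha s T (Minus i) = gamma alpha T m) /\
              (forall m m', orbit_minus (set_val i) m ->
                 orbit_minus (set_val i) m' ->
                 gamma alpha T m = gamma alpha T m')])).
Proof.
move=> H l2 Rm Rstar.
have cTE T f : End_AT n alpha T -> carrier H f -> carrier H (T f).
  by case=> -[[cT _] _] _; exact: cT.
have RsK f : carrier H f -> Rstar (Rm f) = f by exact: coeff_map_adjoint.
have unR := coeff_map_unitary (n := n) alpha_gtN1.
split; [|split; [exact: unR|split]].
(* Both compositions multiply the coefficients of f by the product of the two diagonal functions. *)
- move=> S T SE TE f cf; apply: (coeff_map_inj alpha_gtN1 (cTE _ _ SE (cTE _ _ TE cf)) (cTE _ _ TE (cTE _ _ SE cf))).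
  rewrite (intertwiner_coeff alpha_gtN1 SE (cTE _ _ TE cf)) (intertwiner_coeff alpha_gtN1 TE cf).
  rewrite (intertwiner_coeff alpha_gtN1 TE (cTE _ _ SE cf)) (intertwiner_coeff alpha_gtN1 SE cf).
  by apply/funext => m; rewrite /mult_op mulrCA.
- move=> T TE; split; first by exists Rm => // f cf /=; rewrite RsK.
  case: unR => _ _ sur a /sur[f cf <-] /=; rewrite -/Rm RsK //.
  exact: intertwiner_coeff.
move=> s so u; split=> [i|].
  split; first exact: fnorm_e.
  by apply: monomial_span_e; exists 1%g => //; exact: mperm1.
have sA : s \notin Alt 'I_n by rewrite Alt_even negbK.
split=> [i|T TE].
  split; try exact: fnorm_e.
    apply: monomial_span_e; exists 1%g; [exact: group1|exact: mperm1].
  by apply: monomial_span_e; exists s.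
have even t m := gamma_even alpha_gtN1 TE (s := t) m.
split=> i.
- have zE m : orbit_full (set_val i) m -> gamma alpha T (set_val i) = gamma alpha T m.
    move=> [t _ <-]; have [_ [j [k [jk mjk]]]] := set_valP i.
    have [tA|tA] := boolP (t \in Alt 'I_n); first by rewrite even.
    (* By [mperm_mul] the transposition acts on the index first, and fixes it because its entries at
       j and k agree; the product with the odd t is even. *)
    rewrite -[mperm t _](_ : mperm (t * tperm j k)%g (set_val i) = _).
      by rewrite even // Alt_even odd_permM odd_tperm jk; move: tA; rewrite Alt_even negbK => ->.
    rewrite mperm_mul; congr (mperm t _); apply/ffunP => l; rewrite ffunE.
    by case: tpermP => [->|->|].
  by split=> [m /zE //|m m' /zE <- /zE].
- have pE m : orbit_plus (set_val i) m -> gamma alpha T (set_val i) = gamma alpha T m.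
    by move=> [t tA <-]; rewrite even.
  by split=> [m /pE //|m m' /pE <- /pE].
have mE m : orbit_minus (set_val i) m -> gamma alpha T (mperm s (set_val i)) = gamma alpha T m.
  move=> [t tA <-].
  (* The odd orbit is reached from the base point of u^- by products of two odd permutations, which
     are even. *)
  have -> : mperm t (set_val i) = mperm (t * s^-1)%g (mperm s (set_val i)) by rewrite -mperm_mul mulgKV.
  have to : odd_perm t by move: tA; rewrite /= Alt_even negbK.
  by apply/esym/even; rewrite Alt_even odd_permM odd_permV to so.
by split=> [m /mE //|m m' /mE <- /mE].
Qed.
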